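(* Let $\mathsf G$ be a weighted graph with a well. Let $\mathsf F$ be a Hermitian or Euclidean vector bundle over $\mathsf G$. Let $h$ be a connection on $\mathsf F$ and $H$ a non-negative potential on $\mathsf F$. Let $f\in\Omega^0(\mathsf V\setminus\mathsf W,\mathsf F)$. Let $\Phi$ have law $\mathbb P^h$, with expectation $\mathbb E^h$. Then the following identity holds in $\Omega^0(\mathsf V\setminus\mathsf W,\mathsf F)$: $$\mathbb E^h\otimes\int\Big[e^{-\frac12(\Phi+f,H(\Phi+f))_{\Omega^0}}\,\mathrm{hol}_{h,H}(\gamma^{-1})\Big]d\nu(\gamma)\;\Delta_hf=\mathbb E^h\Big[e^{-\frac12(\Phi+f,H(\Phi+f))_{\Omega^0}}(\Phi+f)\Big].$$ More concretely, for all $x\in\mathsf V\setminus\mathsf W$, $$\sum_{y\in\mathsf V\setminus\mathsf W}\lambda_y\int\mathrm{hol}_{h,H}(\gamma^{-1})\big((\Delta_hf)(y)\big)\,d\nu_{x,y}(\gamma)=\frac{\mathbb E^h\Big[e^{-\frac12(\Phi+f,H(\Phi+f))_{\Omega^0}}(\Phi_x+f_x)\Big]}{\mathbb E^h\Big[e^{-\frac12(\Phi+f,H(\Phi+f))_{\Omega^0}}\Big]}.$$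
   Context: Graphs. A graph $\mathsf G$ consists of non-empty finite sets $\mathsf V$ (vertices) and $\mathsf E$ (oriented edges), maps $s,t:\mathsf E\to\mathsf V$ and a fixed-point free involution $i$ of $\mathsf E$ with $t\circ i=s$; write $\underline e=s(e)$, $\overline e=t(e)$, $e^{-1}=i(e)$ (multiple edges and loop edges are allowed). A weighted graph with a well is a connected graph with a non-empty proper subset $\mathsf W\subset \mathsf V$ (the well; elements of $\mathsf V\setminus\mathsf W$ are the proper vertices) and a function $\chi:\mathsf E\to(0,\infty)$ with $\chi_{e^{-1}}=\chi_e$. Set $\lambda_x=\sum_{e:\underline e=x}\chi_e$ and $P_{x,e}=\chi_e/\lambda_x$ when $\underline e=x$. Paths. A discrete path is $(x_0,e_1,x_1,\dots,e_n,x_n)$, $n\ge0$, with $\underline{e_k}=x_{k-1}$, $\overline{e_k}=x_k$. A continuous path is $\gamma=((x_0,\tau_0),e_1,(x_1,\tau_1),\dots,e_n,(x_n,\tau_n))$ with $(x_0,e_1,\dots,x_n)$ a discrete path, $\tau_0,\dots,\tau_{n-1}\in(0,\infty)$, $\tau_n\in(0,\infty]$. $\mathsf P(\mathsf G)$ is the set of continuous paths with its natural $\sigma$-field. For $0\le t<|\gamma|=\sum_k\tau_k$, $\gamma_t=x_k$ if $\tau_0+\dots+\tau_{k-1}\le t<\tau_0+\dots+\tau_k$, and for $0<t<|\gamma|$, $\gamma_{|[0,t)}=((x_0,\tau_0),e_1,\dots,e_k,(x_k,t-(\tau_0+\dots+\tau_{k-1})))$. If $|\gamma|<\infty$, $\gamma^{-1}=((x_n,\tau_n),e_n^{-1},\dots,e_1^{-1},(x_0,\tau_0))$.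 Random walk. For $x\in\mathsf V$, $\mathbb P_x$ is the law on $\mathsf P(\mathsf G)$ of the path obtained as follows: start at $x_0=x$; from a proper vertex $x_k$ choose an edge $e_{k+1}$ issued from $x_k$ with probability $P_{x_k,e_{k+1}}$ and move to $\overline{e_{k+1}}$; stop at the first vertex in $\mathsf W$; holding times at the proper vertices visited are independent exponential variables of parameter $1$, and the last holding time (in the well) is $+\infty$. For proper $x,y$, $\int F\,d\nu_{x,y}=\int\int_0^\infty F(\gamma_{|[0,t)})\mathbf 1_{\{\gamma_t=y\}}\frac1{\lambda_y}\,dt\,d\mathbb P_x(\gamma)$, and $\nu=\sum_{x,y\in\mathsf V\setminus\mathsf W}\lambda_y\,\nu_{x,y}$. Bundles. A Euclidean (resp. Hermitian) vector bundle of rank $r$ is a collection of $r$-dimensional Euclidean (resp. Hermitian) spaces $\mathsf F_x$ ($x\in\mathsf V$), $\mathsf F_e=\mathsf F_{e^{-1}}$ ($e\in\mathsf E$). Hermitian products are linear in the second variable. A connection $h$ consists, for every edge $e$, of orthogonal (resp. unitary) isomorphisms $h_{e,\underline e}:\mathsf F_{\underline e}\to\mathsf F_e$ and $h_{\overline e,e}:\mathsf F_e\to\mathsf F_{\overline e}$ with $h_{\underline e,e^{-1}}=h_{e,\underline e}^{-1}$; set $h_e=h_{\overline e,e}\circ h_{e,\underline e}$. A potential $H$ is a family of symmetric (resp. Hermitian) operators $H_x\in\mathrm{End}(\mathsf F_x)$, $x\in\mathsf V$, with $H_x=0$ for $x\in\mathsf W$; it is non-negative if every $H_x$ is positive semidefinite.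 For a continuous path $\gamma=((x_0,\tau_0),e_1,(x_1,\tau_1),\dots,e_n,(x_n,\tau_n))$ with $\tau_n<\infty$, $\mathrm{hol}_{h,H}(\gamma)=e^{-\tau_nH_{x_n}}\circ h_{e_n}\circ\cdots\circ e^{-\tau_1H_{x_1}}\circ h_{e_1}\circ e^{-\tau_0H_{x_0}}:\mathsf F_{x_0}\to\mathsf F_{x_n}$. Since $\mathrm{End}(\Omega^0(\mathsf V\setminus\mathsf W,\mathsf F))=\bigoplus_{x,y}\mathrm{Hom}(\mathsf F_y,\mathsf F_x)$, for $\gamma$ from $x$ to $y$ the map $\mathrm{hol}_{h,H}(\gamma^{-1}):\mathsf F_y\to\mathsf F_x$ is regarded as an endomorphism of $\Omega^0(\mathsf V\setminus\mathsf W,\mathsf F)$ with a single non-zero block. Gaussian field. $\Omega^0(\mathsf V\setminus\mathsf W,\mathsf F)$ is the space of sections vanishing on $\mathsf W$, with $(f,g)_{\Omega^0}=\sum_x\lambda_x\langle f(x),g(x)\rangle_x$, and $(Hf)(x)=H_xf(x)$. The Laplacian is $(\Delta_hf)(x)=f(x)-\sum_{e:\underline e=x}P_{x,e}\mathbf 1_{\mathsf V\setminus\mathsf W}(\overline e)h_{e^{-1}}f(\overline e)$, $x\in\mathsf V\setminus\mathsf W$. $\mathbb P^h$ is the probability measure on $\Omega^0(\mathsf V\setminus\mathsf W,\mathsf F)$ with density proportional to $e^{-\frac12(f,\Delta_hf)_{\Omega^0}}$ with respect to the (real) Lebesgue measure. *)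

(* Defs.v *)
From HB Require Import structures.
From mathcomp Require Import all_boot all_order all_algebra.
From mathcomp Require Import complex.
From mathcomp Require Import all_classical all_reals all_analysis.
From mathcomp Require Import measurable_realfun.

Set Implicit Arguments.
Unset Strict Implicit.
Unset Printing Implicit Defensive.

Import Order.TTheory GRing.Theory Num.Theory.
Import numFieldNormedType.Exports.

Local Open Scope classical_set_scope.
Local Open Scope ring_scope.

Section MeasureConstructions.
Context d d' (T : measurableType d) (T' : measurableType d') (R : realType).

(* The library's measure structure on [pushforward m f] depends on a proof that
   [f] is measurable, which cannot be inferred from the term. *)
Definition mpush (m : {measure set T -> \bar R}) (f : T -> T')
  (mf : measurable_fun [set: T] f) : set T' -> \bar R := pushforward m f.

Section mpush.
Variables (m : {measure set T -> \bar R}) (f : T -> T').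
Hypothesis mf : measurable_fun [set: T] f.
Let mpush0 : mpush m mf set0 = 0%E. Proof. exact: measure0. Qed.
Let mpush_ge0 A : (0 <= mpush m mf A)%E. Proof. exact: measure_ge0. Qed.
Let mpush_sigma_additive : semi_sigma_additive (mpush m mf).
Proof. exact: measure_semi_sigma_additive. Qed.
HB.instance Definition _ := isMeasure.Build _ _ _ (mpush m mf)
  mpush0 mpush_ge0 mpush_sigma_additive.
End mpush.

Definition mfsum (I : finType) (P : pred I) (m : I -> {measure set T -> \bar R})
  (A : set T) : \bar R := (\sum_(i | P i) m i A)%E.

Section mfsum.
Variables (I : finType) (P : pred I) (m : I -> {measure set T -> \bar R}).
Let mfsum0 : mfsum P m set0 = 0%E.
Proof. by rewrite /mfsum big1. Qed.
Let mfsum_ge0 A : (0 <= mfsum P m A)%E.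
Proof. by rewrite /mfsum; apply: sume_ge0. Qed.
Let mfsum_sigma_additive : semi_sigma_additive (mfsum P m).
Proof.
move=> F mF tF mUF; rewrite [X in _ --> X](_ : _ =
    lim ((fun n => \sum_(0 <= i < n) mfsum P m (F i))%E @ \oo)).
  by apply: is_cvg_ereal_nneg_natsum => k _; exact: mfsum_ge0.
rewrite nneseries_sum//; apply: eq_bigr => /= i _.
exact: measure_semi_bigcup.
Qed.
HB.instance Definition _ := isMeasure.Build _ _ _ (mfsum P m)
  mfsum0 mfsum_ge0 mfsum_sigma_additive.
End mfsum.

End MeasureConstructions.

(* [exponential_prob 1]; its probability structure takes the positivity of the
   rate as an argument. *)
Definition exp_law (R : realType) : probability (measurableTypeR R) R :=
  exponential_distribution_exponential_prob__canonical__probability_measure_Probability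
    (ltr01 : 0 < 1 :> R).

Fixpoint lebesgue_tuple (R : realType) (n : nat) :
    {measure set (n.-tuple (measurableTypeR R)) -> \bar R} :=
  match n with
  | 0%N => dirac [tuple]
  | m.+1 => mpush (product_measure1 (lebesgue_tuple R m) lebesgue_measure)
              (measurable_cons (@measurable_snd _ _ _ _)
                 (@measurable_fst _ _ _ (measurableTypeR R)))
  end.

Record wgraph (R : realType) := WGraph {
  vertex : finType;
  edge : finType;
  src : edge -> vertex;
  tgt : edge -> vertex;
  erev : edge -> edge;
  edge_nonempty : (0 < #|edge|)%N;
  erevK : involutive erev;
  erev_neq : forall e, erev e != e;
  tgt_erev : forall e, tgt (erev e) = src e;
  connected_graph : forall x y : vertex,
    connect (fun u v => [exists e, (src e == u) && (tgt e == v)]) x y;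
  well : {set vertex};
  well_nonempty : exists x, x \in well;
  well_proper : exists x, x \notin well;
  chi : edge -> R;
  chi_gt0 : forall e, 0 < chi e;
  chi_erev : forall e, chi (erev e) = chi e
}.
Arguments src {R w}.
Arguments tgt {R w}.
Arguments erev {R w}.
Arguments well {R w}.
Arguments chi {R w}.

Section Graph.
Context {R : realType} {G : wgraph R}.
Implicit Types (x y : vertex G) (e : edge G).

Definition lambda x : R := \sum_(e | src e == x) chi e.

Lemma lambda_ge0 x : 0 <= lambda x.
Proof. by apply: sumr_ge0 => e _; rewrite ltW ?chi_gt0. Qed.

Definition trans x e : R := if src e == x then chi e / lambda x else 0.

Lemma trans_ge0 x e : 0 <= trans x e.
Proof.
by rewrite /trans; case: ifP => // _; rewrite divr_ge0 ?lambda_ge0 ?ltW ?chi_gt0.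
Qed.

Lemma inv_lambda_ge0 x : 0 <= (lambda x)^-1.
Proof. by rewrite invr_ge0 lambda_ge0. Qed.

Definition lambda_nng x : {nonneg R} := NngNum (lambda_ge0 x).
Definition inv_lambda_nng x : {nonneg R} := NngNum (inv_lambda_ge0 x).
Definition trans_nng x e : {nonneg R} := NngNum (trans_ge0 x e).

End Graph.

(* Continuous paths.  The sequence ((x0, tau0), e1, (x1, tau1), ..., en,
   (xn, taun)) is encoded as (x0, tau0, [:: (e1, tau1); ...; (en, taun)]), the
   vertices x1, ..., xn being the targets of e1, ..., en.  Not every such triple
   is a path: see [contpath]. *)

Definition cpath_pre {R : realType} (G : wgraph R) : Type :=
  (vertex G * \bar R * seq (edge G * \bar R))%type.

Section PathData.
Context {R : realType} {G : wgraph R}.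
Implicit Types (x y : vertex G) (e : edge G) (tau t : \bar R)
  (l : seq (edge G * \bar R)).
Local Open Scope ereal_scope.

Fixpoint is_contpath x tau l : bool :=
  if l is (e, sigma) :: l' then
    [&& 0 < tau, tau < +oo, src e == x & is_contpath (tgt e) sigma l']
  else 0 < tau.

Fixpoint end_vertex x l : vertex G :=
  if l is (e, _) :: l' then end_vertex (tgt e) l' else x.

(* The vertex occupied at time t, if t < |gamma|. *)
Fixpoint position x tau l t : option (vertex G) :=
  if t < tau then Some x
  else if l is (e, sigma) :: l' then position (tgt e) sigma l' (t - tau)
  else None.

(* The restriction to [0, t); a jump occurring exactly at time t is not
   included, so that the last holding time is positive. *)
Fixpoint cut x tau l t : cpath_pre G :=
  if t <= tau then (x, t, [::])
  else if l is (e, sigma) :: l' then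
    let: (_, sigma', l'') := cut (tgt e) sigma l' (t - tau) in
    (x, tau, (e, sigma') :: l'')
  else (x, t, [::]).

Fixpoint rev_path x tau l (acc : seq (edge G * \bar R)) : cpath_pre G :=
  if l is (e, sigma) :: l' then
    rev_path (tgt e) sigma l' ((erev e, tau) :: acc)
  else (x, tau, acc).

Definition skeleton (g : cpath_pre G) : vertex G * seq (edge G) :=
  (g.1.1, map fst g.2).

Definition holding (k : nat) (g : cpath_pre G) : \bar R :=
  nth 0 (g.1.2 :: map snd g.2) k.

(* The natural sigma-field is generated by the discrete path and the holding
   times. *)
Definition path_gen : set (set (cpath_pre G)) :=
  [set A | (exists p, A = [set g | skeleton g = p]) \/
           (exists k, exists2 B : set (\bar R), measurable B & A = holding k @^-1` B)]%classic.

End PathData.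

Section PathMeasurable.
Context {R : realType} (G : wgraph R).

HB.instance Definition _ := Choice.on (cpath_pre G).
HB.instance Definition _ := isPointed.Build (cpath_pre G)
  (xchoose (well_nonempty G), 0%E, [::]).

Definition cpath := g_sigma_algebraType (@path_gen R G).
HB.instance Definition _ := Measurable.on cpath.

End PathMeasurable.

Section PathMeasurability.
Context {R : realType} {G : wgraph R}.
Local Notation path := (cpath G).
Local Notation RR := (measurableTypeR R).

Lemma measurable_skeleton (Q : set (vertex G * seq (edge G))) :
  measurable [set g : path | Q (skeleton g)].
Proof.
have -> : [set g : path | Q (skeleton g)] =
    \bigcup_(n in [set n | if unpickle n is Some p then Q p else False])
      [set g : path | Some (skeleton g) = unpickle n].
  apply/seteqP; split=> g /=.
    by move=> Qg; exists (pickle (skeleton g)); rewrite /= pickleK.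
  by case=> n /=; case: unpickle => [p|//] + [->].
apply: bigcup_measurable => n _; case: (unpickle n) => [p|]; last first.
  by rewrite (_ : mkset _ = set0) //; apply/seteqP; split.
have -> : [set g : path | Some (skeleton g) = Some p] = [set g | skeleton g = p].
  by apply/seteqP; split=> g /= => [[]|->].
by apply: sub_sigma_algebra; left; exists p.
Qed.

Let measurable_skel d (T : measurableType d) (f : T -> path)
    (Q : set (vertex G * seq (edge G))) : measurable_fun [set: T] f ->
  measurable ([set: T] `&` [set t | Q (skeleton (f t))]).
Proof. by move=> mf; exact: (mf measurableT _ (measurable_skeleton Q)). Qed.

Lemma measurable_holding (k : nat) :
  measurable_fun [set: path] (holding k : path -> \bar R).
Proof.
by move=> _ B mB; rewrite setTI; apply: sub_sigma_algebra; right; exists k, B.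
Qed.

Lemma measurable_cpathP d (T : measurableType d) (D : set T) (f : T -> path) :
  (forall p, measurable (D `&` [set t | skeleton (f t) = p])) ->
  (forall k, measurable_fun D (holding k \o f : T -> \bar R)) ->
  measurable_fun D f.
Proof.
move=> fs fh; move=> mD; move: (mD).
apply: (@measurability _ _ T path D f (@path_gen R G) erefl) => A.
case=> B + <-; case=> [[p ->]|[k [C mC ->]]]; first exact: fs.
exact: fh.
Qed.

Definition cons_path (x : vertex G) (e : edge G) (u : path * RR) : path :=
  (x, u.2%:E, (e, u.1.1.2) :: u.1.2).

Lemma measurable_cons_path x e :
  measurable_fun [set: path * RR] (cons_path x e).
Proof.
apply: measurable_cpathP => [p|[|k]].
- by apply: (measurable_skel (f := fst) [set q | (x, e :: q.2) = p]); exact: measurable_fst.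
- exact: ((measurable_EFinP _ (@snd path RR)).2 measurable_snd).
- exact: (measurableT_comp (measurable_holding k) measurable_fst).
Qed.

Definition has_step (g : path) : bool := g.2 != [::].

Lemma measurable_has_step : measurable_fun [set: path] has_step.
Proof.
apply: (measurable_fun_bool true); rewrite setTI.
rewrite (_ : _ @^-1` _ = [set g | (skeleton g).2 != [::]]).
  exact: (measurable_skeleton [set q | q.2 != [::]]).
by apply/seteqP; split=> -[[? ?] []].
Qed.

Definition tail_path (g : path) : path :=
  if g.2 is (e, sigma) :: l then (tgt e, sigma, l) else g.

Lemma measurable_tail_path : measurable_fun [set: path] tail_path.
Proof.
apply: measurable_cpathP => [p|k].
- rewrite setTI (_ : mkset _ = [set g |
      (if (skeleton g).2 is e :: s then (tgt e, s) else skeleton g) = p]).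
    exact: (measurable_skeleton
      [set q | (if q.2 is e :: s then (tgt e, s) else q) = p]).
  by apply/seteqP; split=> -[[? ?] [|[] ? ?]].
- rewrite (_ : _ \o _ = fun g : path => if has_step g then holding k.+1 g else holding k g).
    by apply: measurable_fun_ifT; [exact: measurable_has_step|
      exact: measurable_holding|exact: measurable_holding].
  by apply/funext => -[[x t] [|[e s] l]].
Qed.

Definition glue (u : path * path) : path :=
  (u.1.1.1, u.1.1.2, if u.1.2 is (e, _) :: _ then (e, u.2.1.2) :: u.2.2 else [::]).

Lemma measurable_glue : measurable_fun [set: path * path] glue.
Proof.
apply: measurable_cpathP => [[x es]|k].
- rewrite setTI (_ : mkset _ =
      ([set g : path | (skeleton g).1 = x /\ if (skeleton g).2 is e :: _ then
          if es is e' :: _ then e = e' else False else es = [::]] `*` 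
       [set g : path | if es is _ :: es' then (skeleton g).2 = es' else True])).
    apply: measurableX.
      exact: (measurable_skeleton [set q | q.1 = x /\ if q.2 is e :: _ then
          if es is e' :: _ then e = e' else False else es = [::]]).
    exact: (measurable_skeleton [set q | if es is _ :: es' then q.2 = es' else True]).
  apply/seteqP; split=> -[[[y t] [|[e s] l]] [[y' t'] l']];
    case: es => [|e' es] //=; rewrite /skeleton /=.
  + by case=> ->.
  + by case=> -> -> ->.
  + by case=> -[->].
  + by case=> -[_ //].
  + by case=> -[_ //].
  + by case=> -[-> -> ->].
- case: k => [|k].
    exact: (measurableT_comp (measurable_holding 0) (@measurable_fst _ _ path path)).
  rewrite (_ : _ \o _ = fun u : path * path =>
     if has_step u.1 then holding k u.2 else 0%E).
    apply: measurable_fun_ifT => //.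
      exact: (measurableT_comp measurable_has_step (@measurable_fst _ _ path path)).
    exact: (measurableT_comp (measurable_holding k) (@measurable_snd _ _ path path)).
  by apply/funext => -[[[y t] [|[e s] l]] [[y' t'] l']] //; rewrite /holding /= nth_nil.
Qed.

Definition cut_path (u : path * \bar R) : path :=
  cut u.1.1.1 u.1.1.2 u.1.2 u.2.

Definition position_path (u : path * \bar R) : option (vertex G) :=
  position u.1.1.1 u.1.1.2 u.1.2 u.2.

Let step (u : path * \bar R) : path * \bar R :=
  (tail_path u.1, (u.2 - holding 0 u.1)%E).

Let measurable_step : measurable_fun [set: path * \bar R] step.
Proof.
apply: measurable_fun_pair.
  exact: (measurableT_comp measurable_tail_path measurable_fst).
apply: emeasurable_funB; first exact: measurable_snd.
exact: (measurableT_comp (measurable_holding 0) measurable_fst).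
Qed.

Let atom (u : path * \bar R) : path := (u.1.1.1, u.2, [::]).

Let measurable_atom : measurable_fun [set: path * \bar R] atom.
Proof.
apply: measurable_cpathP => [p|[|k]].
- by apply: (measurable_skel (f := fst) [set q | (q.1, [::]) = p]); exact: measurable_fst.
- exact: measurable_snd.
- rewrite (_ : _ \o _ = cst 0%E) //.
  by apply/funext => u; rewrite /holding /= nth_nil.
Qed.

Let fcut (n : nat) : path * \bar R -> path := iteri n (fun _ F u =>
  if (u.2 <= holding 0 u.1)%E || ~~ has_step u.1 then atom u
  else glue (u.1, F (step u))) atom.

Let measurable_fcut n : measurable_fun [set: path * \bar R] (fcut n).
Proof.
elim: n => [|n IH]; first exact: measurable_atom.
have m1 : measurable_fun [set: path * \bar R] (fun u => holding 0 u.1).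
  exact: (measurableT_comp (measurable_holding 0) measurable_fst).
apply: measurable_fun_ifT.
- apply: measurable_or; first by apply: measurable_fun_lee => //; exact: measurable_snd.
  apply: measurable_neg.
  exact: (measurableT_comp measurable_has_step measurable_fst).
- exact: measurable_atom.
- apply: (measurableT_comp measurable_glue); apply: measurable_fun_pair.
    exact: measurable_fst.
  exact: (measurableT_comp IH).
Qed.

Let fcutE n (u : path * \bar R) : (size u.1.2 <= n)%N -> fcut n u = cut_path u.
Proof.
elim: n u => [|n IH] [[[x t] l] s] /=; rewrite /cut_path /=.
  by case: l => //=; case: ifP.
case: l => [|[e t'] l] /=; rewrite /has_step /=.
  by rewrite orbT; case: ifP.
move=> ln; rewrite orbF {1}/holding /=; case: ifP => // _.
rewrite IH //= /cut_path /step /=.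
by case: cut => -[].
Qed.

Lemma measurable_cut_path : measurable_fun [set: path * \bar R] cut_path.
Proof.
pose D n := [set u : path * \bar R | size u.1.2 = n].
have mD n : measurable (D n).
  rewrite (_ : D n = [set g : path | size (skeleton g).2 = n] `*` setT).
    apply: measurableX => //.
    exact: (measurable_skeleton [set q | size q.2 = n]).
  by apply/seteqP; split=> -[g s]; rewrite /D /= size_map; [split|case].
rewrite (_ : [set: _] = \bigcup_n D n); last first.
  by apply/seteqP; split=> // u _; exists (size u.1.2).
apply/measurable_fun_bigcup => // n.
apply: (eq_measurable_fun (fcut n)).
  by move=> u; rewrite inE => un; rewrite fcutE // un.
exact: measurable_funTS.
Qed.

Let fpos (y : vertex G) (n : nat) : path * \bar R -> bool :=
  iteri n (fun _ F u =>
    if (u.2 < holding 0 u.1)%E then u.1.1.1 == y else has_step u.1 && F (step u))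
  (fun u => (u.2 < holding 0 u.1)%E && (u.1.1.1 == y)).

Let measurable_fpos y n : measurable_fun [set: path * \bar R] (fpos y n).
Proof.
have m1 : measurable_fun [set: path * \bar R] (fun u => holding 0 u.1).
  exact: (measurableT_comp (measurable_holding 0) measurable_fst).
have m2 : measurable_fun [set: path * \bar R] (fun u => (u.2 < holding 0 u.1)%E).
  by apply: measurable_fun_lte => //; exact: measurable_snd.
have m3 : measurable_fun [set: path * \bar R] (fun u => u.1.1.1 == y).
  apply: (measurable_fun_bool true).
  by apply: (measurable_skel (f := fst) [set q | q.1 == y]); exact: measurable_fst.
elim: n => [|n IH]; first exact: measurable_and.
apply: measurable_fun_ifT => //; apply: measurable_and.
  exact: (measurableT_comp measurable_has_step measurable_fst).
exact: (measurableT_comp IH).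
Qed.

Let fposE y n (u : path * \bar R) : (size u.1.2 <= n)%N ->
  fpos y n u = (position_path u == Some y).
Proof.
elim: n u => [|n IH] [[[x t] l] s] /=; rewrite /position_path /=.
  by case: l => //=; rewrite /holding /=; case: ifP.
case: l => [|[e t'] l] /=; rewrite /has_step /holding /=; first by case: ifP.
by move=> ln; case: ifP => // _; rewrite IH.
Qed.

Lemma measurable_position_path y :
  measurable [set u : path * \bar R | position_path u = Some y].
Proof.
rewrite (_ : mkset _ = \bigcup_n ([set u : path * \bar R |
    size (skeleton u.1).2 = n /\ fpos y n u])).
  apply: bigcupT_measurable => n; apply: measurableI.
    rewrite -[X in measurable X]setTI.
    by apply: (measurable_skel (f := fst) [set q | size q.2 = n]); exact: measurable_fst.
  have := measurable_fpos y n measurableT (Y := [set true]) Logic.I.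
  by rewrite setTI.
apply/seteqP; split=> u /=.
  move=> pu; exists (size u.1.2) => //=; rewrite size_map; split=> //.
  by rewrite fposE // pu.
by case=> n _ [] /=; rewrite size_map => un; rewrite fposE ?un // => /eqP.
Qed.

Definition at_time (u : path * RR) : path * \bar R := (u.1, u.2%:E).

Lemma measurable_at_time : measurable_fun [set: path * RR] at_time.
Proof.
apply: measurable_fun_pair; first exact: measurable_fst.
exact: ((measurable_EFinP _ (@snd path RR)).2 measurable_snd).
Qed.

Lemma measurable_restriction :
  measurable_fun [set: path * RR] (cut_path \o at_time).
Proof. exact: measurableT_comp measurable_cut_path measurable_at_time. Qed.

Definition occupation (y : vertex G) : set (path * RR) :=
  [set u | 0 < (u.2 : R) /\ position_path (at_time u) = Some y].

Lemma measurable_occupation y : measurable (occupation y).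
Proof.
apply: measurableI; last first.
  rewrite -[X in measurable X]setTI.
  exact: (measurable_at_time measurableT (measurable_position_path y)).
have mp : measurable (`]0, +oo[%classic : set RR) by exact: measurable_itv.
have := (@measurable_snd _ _ path RR) measurableT _ mp.
by rewrite setTI; congr measurable; apply/seteqP; split=> u /=; rewrite in_itv /= andbT.
Qed.

End PathMeasurability.

Section RandomWalk.
Context {R : realType} {G : wgraph R}.
Implicit Types x y : vertex G.

(* Law of the walk started at x, restricted to the event that it enters the well
   at its n-th step.  The first component of the product is the path followed
   after the first jump, the second one the holding time at x. *)
Fixpoint walk_law_steps (n : nat) x : {measure set (cpath G) -> \bar R} :=
  match n with
  | 0%N => if x \in well
      then (dirac ((x, +oo%E, [::]) : cpath G) : {measure set (cpath G) -> \bar R})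
      else (mzero : {measure set (cpath G) -> \bar R})
  | m.+1 => if x \in well
      then (mzero : {measure set (cpath G) -> \bar R})
      else mfsum (fun e => src e == x) (fun e =>
        mscale (trans_nng x e)
          (mpush (product_measure1 (walk_law_steps m (tgt e)) (exp_law R))
             (measurable_cons_path x e)))
  end.

Definition walk_law x : {measure set (cpath G) -> \bar R} :=
  mseries (fun n => walk_law_steps n x) 0.

(* nu_{x,y}: image under (gamma, t) |-> gamma_{|[0,t)} of the measure
   1{t > 0, gamma_t = y} lambda_y^-1 dP_x(gamma) dt. *)
Definition nu2 x y : {measure set (cpath G) -> \bar R} :=
  mscale (inv_lambda_nng y)
    (mpush (mrestr (product_measure1 (walk_law x) lebesgue_measure)
              (measurable_occupation y))
       measurable_restriction).

Definition nu : {measure set (cpath G) -> \bar R} :=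
  mfsum (fun p : vertex G * vertex G => (p.1 \notin well) && (p.2 \notin well))
    (fun p => mscale (lambda_nng p.2) (nu2 p.1 p.2)).

Definition contpath : set (cpath G) :=
  [set g | is_contpath g.1.1 g.1.2 g.2].

Definition path_inv (g : cpath G) : cpath G := rev_path g.1.1 g.1.2 g.2 [::].

End RandomWalk.
Arguments nu {R} G.

(* Euclidean and Hermitian spaces.  The field of scalars is R in the Euclidean
   case and R[i] in the Hermitian case; [kcoord j z] and [kunit j], for
   j < [kdeg k], are the real coordinates of a scalar and the corresponding real
   basis of the field. *)

Variant kind := Euclidean | Hermitian.

Definition kfield (R : realType) (k : kind) : numFieldType :=
  match k return numFieldType with Euclidean => R | Hermitian => R[i] end.

Definition kdeg (k : kind) : nat := if k is Hermitian then 2 else 1.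

Section Scalars.
Context {R : realType}.

Definition kconj k : kfield R k -> kfield R k :=
  match k with Euclidean => id | Hermitian => @conjc R end.

Definition kreal k : R -> kfield R k :=
  match k with Euclidean => id | Hermitian => real_complex R end.

Definition kcoord k (j : 'I_(kdeg k)) : kfield R k -> R :=
  match k with
  | Euclidean => id
  | Hermitian => if val j == 0%N then @complex.Re R else @complex.Im R
  end.

Definition kunit k (j : 'I_(kdeg k)) : kfield R k :=
  match k with
  | Euclidean => 1
  | Hermitian => if val j == 0%N then 1 else Complex 0 1
  end.

Definition kRe k : kfield R k -> R :=
  match k with Euclidean => id | Hermitian => @complex.Re R end.

End Scalars.
Arguments kreal {R} k.

Record ipspace (R : realType) (k : kind) := IPSpace {
  ip_space :> vectType (kfield R k);
  ip : ip_space -> ip_space -> kfield R k;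
  ip_linear : forall (a : kfield R k) (u v w : ip_space),
    ip u (a *: v + w) = a * ip u v + ip u w;
  ip_sym : forall u v : ip_space, ip v u = kconj (ip u v);
  ip_gt0 : forall u : ip_space, u != 0 -> 0 < ip u u
}.

Section RealCoordinates.
Context {R : realType} {k : kind}.
Implicit Types U : vectType (kfield R k).

Definition vidx U : finType := ('I_(\dim {:U}) * 'I_(kdeg k))%type.

Definition vcoord U (i : vidx U) (u : U) : R :=
  kcoord i.2 (coord (vbasis {:U}) i.1 u).

Definition of_vcoord U (c : vidx U -> R) : U :=
  \sum_(i : vidx U) (kreal k (c i) * kunit i.2) *: (vbasis {:U})`_i.1.

(* Limits and integrals in a finite-dimensional space are taken in real
   coordinates; they do not depend on the basis. *)
Definition vlim U (u : U^nat) : U :=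
  of_vcoord (fun i => lim (vcoord i (u n) @[n --> \oo])).

Definition vint U d (T : measurableType d) (mu : {measure set T -> \bar R})
  (D : set T) (g : T -> U) : U :=
  of_vcoord (fun i : vidx U => \int[mu]_(t in D) vcoord i (g t)).

Definition opexp U (A : 'End(U)) (u : U) : U :=
  vlim (fun n => \sum_(0 <= j < n) (j`!%:R)^-1 *: iter j A u).

End RealCoordinates.

Record bundle (R : realType) (G : wgraph R) (k : kind) (r : nat) := Bundle {
  vfib : vertex G -> ipspace R k;
  efib : edge G -> ipspace R k;
  efib_erev : forall e, efib (erev e) = efib e;
  dim_vfib : forall x, \dim {:vfib x} = r;
  dim_efib : forall e, \dim {:efib e} = r
}.

Definition transport R k (U U' : ipspace R k) (p : U = U') (u : U) : U' :=
  eq_rect U (fun X : ipspace R k => X : Type) u U' p.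

(* [hin e] is h_{e, s(e)} and [hout e] is h_{t(e), e}. *)
Record connection (R : realType) (G : wgraph R) k r (F : bundle G k r) :=
  Connection {
  hin : forall e, 'Hom(vfib F (src e), efib F e);
  hout : forall e, 'Hom(efib F e, vfib F (tgt e));
  hin_ip : forall e u v, ip (hin e u) (hin e v) = ip u v;
  hout_ip : forall e u v, ip (hout e u) (hout e v) = ip u v;
  houtK : forall e,
    let hback u := transport (congr1 (vfib F) (tgt_erev e))
      (hout (erev e) (transport (esym (efib_erev F e)) u)) in
    cancel (hin e) hback /\ cancel hback (hin e)
}.

Record potential (R : realType) (G : wgraph R) k r (F : bundle G k r) :=
  Potential {
  pot : forall x, 'End(vfib F x);
  pot_sym : forall x u v, ip (pot x u) v = ip u (pot x v);
  pot_well : forall x, x \in well -> pot x = 0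
}.

Definition pot_nonneg (R : realType) (G : wgraph R) k r (F : bundle G k r)
  (H : potential F) := forall x u, 0 <= ip u (pot H x u).

Section Sections.
Context {R : realType} {G : wgraph R} {k : kind} {r : nat} (F : bundle G k r).
Implicit Types (x y : vertex G) (h : connection F) (H : potential F).

Definition gsection := forall x, vfib F x.

Definition Omega0 : set gsection := [set f | forall x, x \in well -> f x = 0].

Definition ip_Omega0 (f g : gsection) : kfield R k :=
  \sum_x kreal k (lambda x) * ip (f x) (g x).

Definition add_section (f g : gsection) : gsection := fun x => f x + g x.

Definition pot_section H (f : gsection) : gsection := fun x => pot H x (f x).

(* The canonical identification of the fibres over x and y when x = y, and 0
   otherwise. *)
Definition fcast x y (u : vfib F x) : vfib F y :=
  match x =P y with
  | ReflectT p => transport (congr1 (vfib F) p) u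
  | ReflectF _ => 0
  end.

Definition hedge h e (u : vfib F (src e)) : vfib F (tgt e) :=
  hout h e (hin h e u).
Arguments hedge h e u : clear implicits.

Definition laplacian h (f : gsection) : gsection := fun x =>
  if x \in well then 0 else
  f x - \sum_(e | src e == x) kreal k (trans x e) *:
    (if tgt e \in well then 0
     else fcast x (hedge h (erev e) (fcast (src (erev e)) (f (tgt e))))).

Definition hol_pot H x (tau : \bar R) (u : vfib F x) : vfib F x :=
  opexp (kreal k (- fine tau) *: pot H x) u.

Fixpoint hol_rec h H x tau l {struct l} : vfib F x -> vfib F (end_vertex x l) :=
  match l return vfib F x -> vfib F (end_vertex x l) with
  | [::] => fun u => hol_pot H tau u
  | (e, sigma) :: l' => fun u =>
      @hol_rec h H (tgt e) sigma l'
        (hedge h e (fcast (src e) (hol_pot H tau u)))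
  end.

Definition path_end (g : cpath G) : vertex G := end_vertex g.1.1 g.2.

Definition hol h H (g : cpath G) : vfib F g.1.1 -> vfib F (path_end g) :=
  @hol_rec h H g.1.1 g.1.2 g.2.
Arguments hol h H g u : clear implicits.

(* hol(gamma) as the block from y to x of an endomorphism of the space of
   sections; it vanishes unless gamma goes from y to x. *)
Definition hol_block h H (g : cpath G) y x (u : vfib F y) : vfib F x :=
  fcast x (hol h H g (fcast g.1.1 u)).
Arguments hol_block h H g y x u : clear implicits.

Definition hol_End h H (g : cpath G) (f : gsection) : gsection :=
  fun x => \sum_(y | y \notin well) hol_block h H g y x (f y).

(* Integral of an endomorphism-valued function; the space being finite
   dimensional, it is computed on each section. *)
Definition int_End d (T : measurableType d) (mu : {measure set T -> \bar R})
  (D : set T) (A : T -> gsection -> gsection) (f : gsection) : gsection :=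
  fun x => vint mu D (fun t => A t f x).

Definition pot_weight H (f : gsection) : R :=
  expR (- 2^-1 * kRe (ip_Omega0 f (pot_section H f))).

Definition gff_density h (f : gsection) : R :=
  expR (- 2^-1 * kRe (ip_Omega0 f (laplacian h f))).

Definition sec_idx : finType :=
  {x : {x : vertex G | x \notin well} & vidx (vfib F (val x))}.

Definition of_sec_coord (c : #|sec_idx|.-tuple (measurableTypeR R)) : gsection :=
  fun x => match @idP (x \notin well) with
  | ReflectT p => of_vcoord (fun i : vidx (vfib F x) =>
      tnth c (enum_rank (Tagged (fun z : {x : vertex G | x \notin well} =>
        vidx (vfib F (val z))) (i : vidx (vfib F (val (exist _ x p)))) : sec_idx)))
  | ReflectF _ => 0
  end.

(* The law of Phi is P^h.  Lebesgue measure on the space of sections vanishing on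
   the well is the image of Lebesgue measure by the real coordinates
   [of_sec_coord]; another choice of basis only changes the normalisation Z. *)
Definition has_law_gff h d (T : measurableType d) (P : probability T R)
    (Phi : T -> gsection) : Prop :=
  exists X : {mfun T >-> #|sec_idx|.-tuple (measurableTypeR R)},
    (forall t, Phi t = of_sec_coord (X t)) /\
    exists2 Z : R, 0 < Z & forall A, measurable A ->
      distribution P X A =
      (\int[lebesgue_tuple R #|sec_idx|]_(c in A)
         (Z^-1 * gff_density h (of_sec_coord c))%:E)%E.

End Sections.

Arguments hedge {R G k r F} h e u.
Arguments hol {R G k r F} h H g u.
Arguments hol_block {R G k r F} h H g y x u.

(* Main.v *)
Require Import Defs.
From HB Require Import structures.
From mathcomp Require Import all_boot all_order all_algebra.
From mathcomp Require Import complex.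
From mathcomp Require Import all_classical all_reals all_analysis.
From mathcomp Require Import measurable_realfun.
From mathcomp Require Import ring lra.

(** Let [L = Delta_h + H], acting on the sections that vanish on the well, and let [M]
    be the solution of [L M = Delta_h f]. Write [w] for the weight
    [exp (- (Phi + f, H (Phi + f)) / 2)]. Each side of the two identities is computed
    separately: the integral of [hol (gamma^-1) (Delta_h f)] over paths is [M], and
    [E (w (Phi + f)) = E w * M].

    Path side. For a proper vertex [z] let [K_z(x)] be the integral of
    [hol (gamma^-1)] over the paths from [x] to [z], for the Green measure [green x z],
    which is [lambda_z nu_(x,z)]. Split the time integral at the first jump of the walk
    ([occ_time_first_jump], [green_first_step]). The first holding time is exponential
    and independent of the rest, so [exp (- tau H_x)] integrates to
    [(1 + H_x)^-1], eigenvalue by eigenvalue ([exp_law_laplace], [fk_step]). Hence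
    [(1 + H_x) K_z(x)] minus the weighted sum of [h_(e^-1) K_z] over the edges [e]
    issued from [x] is the identity if [x = z] and 0 otherwise ([fk_resolvent]): the
    path integral is a right inverse of [L] ([lap_pot_green_op]), so it maps
    [Delta_h f] to [M]. As [L] is symmetric, it is also injective, which shows that
    blocks over vertices other than the endpoint of the paths contribute nothing
    ([fk_neq]).

    Everything converges because the Green measure is finite ([green_fin]): its mass is
    dominated by the expected hitting time of the well, a solution of a linear system
    that the maximum principle makes invertible ([max_principle],
    [hitting_time_exists]). The same principle shows that the walk enters the well
    almost surely ([walk_law_mass]). Holonomies are contractions ([rip_bhol_le]).
    Integral identities are proved for nonnegative functions and extended to bounded
    ones by splitting them into positive and negative parts ([Rintegral_comb]).

    Field side. With respect to Lebesgue measure, [w] times the density of [Phi] is the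
    exponential of [- 1/2] times a quadratic polynomial in [phi], which up to a constant
    is the quadratic form of [L] at [chi = phi + f - M] ([exponent_centred]). The
    reflection [phi |-> 2 (M - f) - phi] changes [chi] into [- chi] and preserves
    Lebesgue measure ([lebesgue_tuple_reflect]). Every real linear form of [chi] thus
    has mean 0 under the tilted law ([tilted_symmetric], [tilted_mean]). Integrability
    comes from another reflection, which bounds exponential moments
    ([gff_exp_moment]).

    Euclidean and Hermitian bundles are treated together, through the real part of the
    inner product and real linear forms. The only spectral fact in use is that a
    symmetric non-negative operator has a real orthonormal basis of eigenvectors
    ([eigenbasis_exists]). *)

Set Implicit Arguments.
Unset Strict Implicit.
Unset Printing Implicit Defensive.

Import Order.TTheory GRing.Theory Num.Theory.
Import numFieldNormedType.Exports.

Local Open Scope classical_set_scope.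
Local Open Scope ring_scope.


(** * Real structure of Euclidean and Hermitian spaces *)

Section Scalars.
Context {R : realType} {k : kind}.
Local Notation K := (kfield R k).
Implicit Types (a b : R) (z w : K).

Lemma krealD a b : kreal k (a + b) = kreal k a + kreal k b.
Proof. by case: k => //=; rewrite rmorphD. Qed.

Lemma krealM a b : kreal k (a * b) = kreal k a * kreal k b.
Proof. by case: k => //=; rewrite rmorphM. Qed.

Lemma kreal0 : kreal k 0 = 0 :> K.
Proof. by case: k => //=; rewrite rmorph0. Qed.

Lemma kreal1 : kreal k 1 = 1 :> K.
Proof. by case: k => //=; rewrite rmorph1. Qed.

Lemma krealN a : kreal k (- a) = - kreal k a.
Proof. by case: k => //=; rewrite rmorphN. Qed.

Lemma krealV a : kreal k a^-1 = (kreal k a)^-1.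
Proof. by case: k => //=; rewrite fmorphV. Qed.

Lemma kReD z w : kRe (z + w) = kRe z + kRe w.
Proof. by move: z w; case: k => //= -[? ?] [? ?]. Qed.

Lemma kRe_real a z : kRe (kreal k a * z) = a * kRe z.
Proof. by move: z; case: k => //= -[? ?] /=; rewrite mul0r subr0. Qed.

Lemma kRe_conj z : kRe (kconj z) = kRe z.
Proof. by move: z; case: k => //= -[? ?]. Qed.

Lemma kRe_gt0 z : 0 < z -> 0 < kRe z.
Proof. by move: z; case: k => //= -[? ?]; rewrite ltcE => /andP[]. Qed.

Lemma kRe_ge0 z : 0 <= z -> 0 <= kRe z.
Proof. by move: z; case: k => //= -[? ?]; rewrite lecE => /andP[]. Qed.

Lemma kcoordD j z w : kcoord j (z + w) = kcoord (k := k) j z + kcoord j w.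
Proof. by move: j z w; case: k => //= j [? ?] [? ?]; case: ifP. Qed.

Lemma kcoord_real j a z : kcoord j (kreal k a * z) = a * kcoord (k := k) j z.
Proof.
by move: j z; case: k => //= j [? ?]; case: ifP => //= _; rewrite ?mul0r ?subr0 ?addr0.
Qed.

Lemma kcoordK z : z = \sum_j kreal k (kcoord j z) * kunit j.
Proof.
move: z; case: k => /= [z|[a b]]; first by rewrite big_ord1 mulr1.
rewrite !big_ord_recl big_ord0 /= mulr1 addr0 /real_complex_def.
by apply/eqP; rewrite eq_complex /= !mulr0 !mul0r !mulr1 ?subr0 ?addr0 ?add0r !eqxx.
Qed.

Lemma kcoord_sumK (c : 'I_(kdeg k) -> R) j :
  kcoord j (\sum_i kreal k (c i) * kunit i) = c j.
Proof.
move: c j; case: k => /= [c j|c j].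
  by rewrite big_ord1 mulr1; congr c; apply/val_inj; case: j => -[].
rewrite !big_ord_recl big_ord0 /= mulr1 addr0 /real_complex_def.
case: j => -[|[|//]] jp /=; rewrite !mulr0 ?mul0r ?subr0 ?addr0 ?add0r ?mulr1;
  by congr c; apply/val_inj.
Qed.

End Scalars.

Section RealStructure.
Context {R : realType} {k : kind}.
Local Notation K := (kfield R k).

Section Coordinates.
Variable U : vectType K.
Implicit Types (u v : U) (i : vidx U).

Lemma vcoordD i u v : vcoord i (u + v) = vcoord i u + vcoord i v.
Proof. by rewrite /vcoord linearD /= kcoordD. Qed.

Lemma vcoordZ i a u : vcoord i (kreal k a *: u) = a * vcoord i u.
Proof. by rewrite /vcoord linearZ /= kcoord_real. Qed.

Lemma of_vcoordE (c : vidx U -> R) : of_vcoord c =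
  \sum_i (\sum_j kreal k (c (i, j)) * kunit j) *: (vbasis {:U})`_i.
Proof.
under eq_bigr do rewrite scaler_suml.
by rewrite pair_bigA /=; apply: eq_bigr => -[].
Qed.

Lemma vcoordK u : of_vcoord (fun i => vcoord i u) = u.
Proof.
rewrite of_vcoordE {2}(coord_vbasis (memvf u)); apply: eq_bigr => i _.
by rewrite /vcoord /= -kcoordK.
Qed.

Lemma of_vcoordK (c : vidx U -> R) i : vcoord i (of_vcoord c) = c i.
Proof.
rewrite of_vcoordE /vcoord coord_sum_free ?(basis_free (vbasisP _)) //.
by rewrite kcoord_sumK; case: i.
Qed.

Lemma vcoord_inj u v : (forall i, vcoord i u = vcoord i v) -> u = v.
Proof.
by move=> uv; rewrite -(vcoordK u) -(vcoordK v); congr of_vcoord; apply/funext.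
Qed.

End Coordinates.

Section RealLinear.
Context {U U' : vectType K}.

Definition rlinear (f : U -> U') :=
  (forall u v, f (u + v) = f u + f v) /\
  (forall a u, f (kreal k a *: u) = kreal k a *: f u).

Definition rform (f : U -> R) :=
  (forall u v, f (u + v) = f u + f v) /\
  (forall a u, f (kreal k a *: u) = a * f u).

Lemma rlinear0 f : rlinear f -> f 0 = 0.
Proof. by case=> _ fZ; have := fZ 0 0; rewrite kreal0 !scale0r. Qed.

Lemma rlinear_sum f I (r : seq I) P (F : I -> U) : rlinear f ->
  f (\sum_(i <- r | P i) F i) = \sum_(i <- r | P i) f (F i).
Proof. by move=> lf; apply: (big_morph f lf.1 (rlinear0 lf)). Qed.

Lemma rform0 f : rform f -> f 0 = 0.
Proof. by case=> _ fZ; have := fZ 0 0; rewrite kreal0 scale0r mul0r. Qed.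

Lemma rformN f u : rform f -> f (- u) = - f u.
Proof. by case=> _ fZ; have := fZ (- 1) u; rewrite krealN kreal1 scaleN1r mulN1r. Qed.

Lemma rform_sum f I (r : seq I) P (F : I -> U) : rform f ->
  f (\sum_(i <- r | P i) F i) = \sum_(i <- r | P i) f (F i).
Proof. by move=> lf; apply: (big_morph f lf.1 (rform0 lf)). Qed.

End RealLinear.

Lemma vcoord_rform (U : vectType K) (i : vidx U) : rform (vcoord i).
Proof. by split=> *; rewrite (vcoordD, vcoordZ). Qed.

Lemma rform_comp (U U' : vectType K) (g : U' -> R) (f : U -> U') :
  rform g -> rlinear f -> rform (g \o f).
Proof. by move=> [gD gZ] [fD fZ]; split=> *; rewrite /= (fD, fZ) (gD, gZ). Qed.

Lemma hom_rlinear (U U' : vectType K) (f : 'Hom(U, U')) : rlinear f.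
Proof. by split=> *; rewrite (linearD, linearZ). Qed.

Definition vunit (U : vectType K) (i : vidx U) : U :=
  of_vcoord (fun j => (j == i)%:R).

Lemma rform_coord (U : vectType K) (f : U -> R) u : rform f ->
  f u = \sum_i vcoord i u * f (vunit i).
Proof.
move=> lf; have {1}-> : u = \sum_i kreal k (vcoord i u) *: vunit i.
  apply: vcoord_inj => i; rewrite (rform_sum _ _ _ (vcoord_rform i)).
  rewrite (bigD1 i) //= big1 => [|j ji].
    by rewrite vcoordZ of_vcoordK eqxx mulr1 addr0.
  by rewrite vcoordZ of_vcoordK eq_sym (negPf ji) mulr0.
by rewrite (rform_sum _ _ _ lf); apply: eq_bigr => i _; rewrite lf.2.
Qed.

Lemma rdependent (U : vectType K) n (w : 'I_n -> U) : (#|vidx U| < n)%N ->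
  exists2 c : 'I_n -> R, exists i, c i != 0 & \sum_i kreal k (c i) *: w i = 0.
Proof.
move=> ltn; pose M := \matrix_(i < n, j < #|vidx U|) vcoord (enum_val j) (w i).
have : kermx M != 0.
  rewrite -mxrank_eq0 mxrank_ker subn_eq0 -ltnNge.
  by apply: leq_ltn_trans ltn; exact: rank_leq_col.
case/rowV0Pn => u /sub_kermxP uM /rV0Pn [i ui].
exists (fun i => u 0 i); first by exists i.
apply: vcoord_inj => j; rewrite (rform_sum _ _ _ (vcoord_rform j)).
have /matrixP/(_ 0 (enum_rank j)) := uM; rewrite !mxE => /esym E.
rewrite (rform0 (vcoord_rform j)); apply: etrans (esym E); apply: eq_bigr => l _.
by rewrite vcoordZ mxE enum_rankK.
Qed.

Section InnerProduct.
Variable V : ipspace R k.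
Implicit Types (u v w : V) (a : R).

(** Symmetry of an operator and the norm of a vector only involve the real part of
    the Hermitian product, so both kinds of bundle are handled as real inner product
    spaces. *)
Definition rip u v : R := kRe (ip u v).

Lemma ripC u v : rip u v = rip v u.
Proof. by rewrite /rip (ip_sym v u) kRe_conj. Qed.

Lemma rip_rform u : rform (rip u).
Proof.
split=> [v w|a v].
  by rewrite /rip -{1}[v]scale1r ip_linear mul1r kReD.
have ip0 : ip u 0 = 0.
  by have := ip_linear (-1) u 0 0; rewrite scaler0 addr0 mulN1r addNr.
by rewrite /rip -[_ *: v]addr0 ip_linear ip0 addr0 kRe_real.
Qed.

Lemma ripDr u v w : rip u (v + w) = rip u v + rip u w.
Proof. exact: (rip_rform u).1. Qed.
Lemma ripZr u a v : rip u (kreal k a *: v) = a * rip u v.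
Proof. exact: (rip_rform u).2. Qed.
Lemma ripDl u v w : rip (v + w) u = rip v u + rip w u.
Proof. by rewrite ![rip _ u]ripC ripDr. Qed.
Lemma ripZl u a v : rip (kreal k a *: v) u = a * rip v u.
Proof. by rewrite ![rip _ u]ripC ripZr. Qed.
Lemma ripNr u v : rip u (- v) = - rip u v.
Proof. exact: rformN (rip_rform u). Qed.
Lemma ripNl u v : rip (- v) u = - rip v u.
Proof. by rewrite ![rip _ u]ripC ripNr. Qed.
Lemma rip0r u : rip u 0 = 0.
Proof. exact: rform0 (rip_rform u). Qed.
Lemma rip0l u : rip 0 u = 0.
Proof. by rewrite ripC rip0r. Qed.

Lemma rip_ge0 u : 0 <= rip u u.
Proof.
by have [->|u0] := eqVneq u 0; rewrite ?rip0r // ltW // kRe_gt0 // ip_gt0.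
Qed.

Lemma rip_eq0 u : (rip u u == 0) = (u == 0).
Proof.
apply/eqP/eqP => [|->]; last by rewrite rip0r.
by apply: contra_eq => u0; rewrite gt_eqF // kRe_gt0 // ip_gt0.
Qed.

Definition rorthonormal n (b : 'I_n -> V) := forall i j, rip (b i) (b j) = (i == j)%:R.

Lemma rip_orthonormal_sum n (b : 'I_n -> V) (c : 'I_n -> R) i : rorthonormal b ->
  rip (b i) (\sum_j kreal k (c j) *: b j) = c i.
Proof.
move=> ob; rewrite (rform_sum _ _ _ (rip_rform _)) (bigD1 i) //= big1 => [|j ji].
  by rewrite ripZr ob eqxx mulr1 addr0.
by rewrite ripZr ob eq_sym (negPf ji) mulr0.
Qed.

(** The bound that makes extending an orthonormal family terminate. *)
Lemma orthonormal_size n (b : 'I_n -> V) : rorthonormal b -> (n <= #|vidx V|)%N.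
Proof.
move=> ob; rewrite leqNgt; apply/negP => /(rdependent b) [c [i ci] cb].
by move: ci; rewrite -(rip_orthonormal_sum c i ob) cb rip0r eqxx.
Qed.

End InnerProduct.
End RealStructure.

(** * Spectral decomposition of a symmetric operator *)

Section Spectral.
Context {R : realType} {k : kind}.

(** Over the reals a polynomial has a factor of degree one, or of degree two
    without real root: pass to a complex root. *)
Lemma real_factor (p : {poly R}) : (1 < size p)%N ->
  exists2 q : {poly R}, (size q < size p)%N & (exists a, p = 'X * q - a *: q) \/
    (exists a b, b != 0 /\
       p = 'X * ('X * q) - (2 * a) *: ('X * q) + (a ^+ 2 + b ^+ 2) *: q).
Proof.
move=> p1; have p0 : p != 0 by rewrite -size_poly_gt0 ltnW.
pose pC := map_poly (real_complex R) p.
have : size pC != 1%N by rewrite size_map_poly; case: size p1 => [|[]].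
case/closed_rootP => -[a b] rz.
have [b0|b0] := eqVneq b 0.
  have : root p a.
    move: rz; rewrite b0 -[Complex a 0]/(real_complex R a) /pC /root horner_map.
    by rewrite -(rmorph0 (real_complex R)) (inj_eq (@complexI R)).
  case/factor_theorem => q pq; exists q.
    rewrite pq size_Mmonic ?monicXsubC ?size_XsubC ?addn2 //.
    by apply: contra_neq p0 => q0; rewrite pq q0 mul0r.
  by left; exists a; rewrite pq mulrC mulrBl mul_polyC.
pose d := 'X^2 - (2 * a) *: 'X + (a ^+ 2 + b ^+ 2)%:P : {poly R}.
have sd : size d = 3%N.
  rewrite /d -addrA size_polyDl ?size_polyXn //.
  apply: leq_ltn_trans (size_polyD _ _) _; rewrite gtn_max size_polyN.
  rewrite (leq_ltn_trans (size_scale_leq _ _)) ?size_polyX //=.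
  by rewrite (leq_ltn_trans (size_polyC_leq1 _)).
have dz : (map_poly (real_complex R) d).[Complex a b] = 0.
  rewrite /d rmorphD rmorphB /= map_polyXn map_polyZ map_polyX map_polyC /=.
  rewrite !hornerE /=; apply/eqP; rewrite eq_complex /=.
  by apply/andP; split; apply/eqP; rewrite /=; ring.
have d0 : d != 0 by rewrite -size_poly_gt0 sd.
have : p %% d = 0.
  have : (map_poly (real_complex R) (p %% d)).[Complex a b] = 0.
    move: rz; rewrite /pC {1}(divp_eq p d) rmorphD rmorphM /= /root !hornerE dz.
    by rewrite mulr0 add0r => /eqP.
  have : (size (p %% d)%R <= 2)%N by rewrite -ltnS -sd ltn_modp.
  move: (p %% d) => r sr; rewrite (horner_coef_wide _ (leq_trans _ sr)); last first.
    exact: size_poly.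
  rewrite !big_ord_recl big_ord0 /= !coef_map /= => /eqP.
  rewrite eq_complex /= => /andP[/eqP + /eqP].
  rewrite /bump /= !(mul0r, mulr0, mul1r, mulr1, addr0, subr0, add0r).
  move=> E1 /eqP; rewrite mulf_eq0 (negPf b0) orbF => /eqP r1.
  move: E1; rewrite r1 mul0r addr0 => r0.
  apply/polyP => -[|[|i]]; rewrite coef0 //.
  by rewrite nth_default // (leq_trans sr).
move=> pd; exists (p %/ d).
  by rewrite ltn_divpl // size_mul // sd addn3 /= ltnS leqnSn.
right; exists a, b; split => //.
rewrite {1}(divp_eq p d) pd addr0 mulrC /d mulrDl mulrBl mul_polyC.
by rewrite -scalerAl expr2 mulrA.
Qed.

Section Operator.
Variable V : ipspace R k.
Variable H : 'End(V).
Hypothesis H_sym : forall u v, ip (H u) v = ip u (H v).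
Implicit Types (u v w : V) (p q : {poly R}) (a : R).

Let rH u v : rip (H u) v = rip u (H v).
Proof. by rewrite /rip H_sym. Qed.

Definition poly_op p v : V := \sum_(i < size p) kreal k p`_i *: iter i H v.

Lemma poly_op_wide n p v : (size p <= n)%N ->
  poly_op p v = \sum_(i < n) kreal k p`_i *: iter i H v.
Proof.
move=> pn; rewrite /poly_op (big_ord_widen _ (fun i => kreal k p`_i *: iter i H v) pn).
rewrite big_mkcond /=; apply: eq_bigr => i _; case: ltnP => // pi.
by rewrite nth_default // kreal0 scale0r.
Qed.

Lemma poly_opD p q v : poly_op (p + q) v = poly_op p v + poly_op q v.
Proof.
pose n := maxn (size p) (size q).
rewrite !(@poly_op_wide n) ?leq_maxl ?leq_maxr ?size_polyD // -big_split /=.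
by apply: eq_bigr => i _; rewrite coefD krealD scalerDl.
Qed.

Lemma poly_opZ a p v : poly_op (a *: p) v = kreal k a *: poly_op p v.
Proof.
rewrite (@poly_op_wide (size p)) ?size_scale_leq // /poly_op scaler_sumr.
by apply: eq_bigr => i _; rewrite coefZ krealM scalerA.
Qed.

Lemma poly_opX p v : poly_op ('X * p) v = H (poly_op p v).
Proof.
have sX : (size ('X * p)%R <= (size p).+1)%N.
  have [->|p0] := eqVneq p 0; first by rewrite mulr0 size_poly0.
  by rewrite mulrC size_mulX.
rewrite (poly_op_wide v sX) big_ord_recl /= coefXM /= kreal0 scale0r add0r.
rewrite /poly_op linear_sum /=; apply: eq_bigr => i _.
by rewrite coefXM /= linearZ.
Qed.

(** In an invariant real subspace [S], the iterates of [H] on [v] are dependent, so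
    some polynomial kills [v]. Factors of that polynomial are peeled off: a factor
    without real root acts injectively since [H] is symmetric, and the first linear
    factor that kills something exhibits an eigenvector. *)
Lemma eigen_exists (S : V -> Prop) v :
  (forall u w, S u -> S w -> S (u + w)) -> (forall a u, S u -> S (kreal k a *: u)) ->
  (forall u, S u -> S (H u)) -> S v -> v != 0 ->
  exists a w, [/\ S w, w != 0 & H w = kreal k a *: w].
Proof.
move=> SD SZ SH Sv v0.
have Siter i : S (iter i H v) by elim: i => //= i; apply: SH.
have S0 : S 0 by have := SZ 0 v Sv; rewrite kreal0 scale0r.
have Sp p : S (poly_op p v).
  by rewrite /poly_op; apply: big_ind => // i _; apply: SZ.
have [p p0 pv] : exists2 p : {poly R}, p != 0 & poly_op p v = 0.
  have [c [i ci] cv] := rdependent (fun i : 'I_(#|vidx V|.+1) => iter i H v) (ltnSn _).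
  exists (\poly_(j < #|vidx V|.+1) c (inord j)).
    apply/eqP => /polyP/(_ i); rewrite coef0 coef_poly ltn_ord inord_val.
    by apply/eqP.
  rewrite (@poly_op_wide #|vidx V|.+1) ?size_poly // -[RHS]cv.
  by apply: eq_bigr => j _; rewrite coef_poly ltn_ord inord_val.
have [n] := ubnP (size p); elim: n p p0 pv => // n IH p p0 pv; rewrite ltnS => pn.
have [p1|p1] := leqP (size p) 1.
  case/negP: v0; move: p0 pv; rewrite (size1_polyC p1) polyC_eq0 => c0.
  rewrite (@poly_op_wide 1) ?size_polyC_leq1 // big_ord1 coefC /= => /eqP.
  rewrite scaler_eq0 => /orP[/eqP c1|//].
  case/negP: c0; apply/eqP; move: c1; case: (k) => //= c1.
  exact: (@complexI R).
have [q qp [[a pq]|[a [b [b0 pq]]]]] := real_factor p1.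
- have q0 : q != 0 by apply: contra_neq p0 => q0; rewrite pq q0 mulr0 scaler0 subr0.
  have [w0|w0] := eqVneq (poly_op q v) 0.
    by apply: (IH q) => //; exact: leq_trans qp pn.
  exists a, (poly_op q v); split => //; apply/subr0_eq.
  rewrite -[RHS]pv pq -[in RHS]scaleNr poly_opD poly_opX poly_opZ.
  by rewrite krealN scaleNr.
- have q0 : q != 0 by apply: contra_neq p0 => q0; rewrite pq q0 !mulr0 !scaler0 subrr addr0.
  pose w := poly_op q v.
  have Ew : H (H w) - kreal k (2 * a) *: H w + kreal k (a ^+ 2 + b ^+ 2) *: w = 0.
    rewrite -[RHS]pv pq -[in RHS]scaleNr !poly_opD !poly_opZ !poly_opX.
    by rewrite krealN scaleNr.
  suff w0 : w = 0 by apply: (IH q) => //; exact: leq_trans qp pn.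
  (* Pairing with [w] gives |Hw - a w|^2 + b^2 |w|^2 = 0. *)
  apply/eqP; rewrite -rip_eq0; have : rip w (H (H w) -
      kreal k (2 * a) *: H w + kreal k (a ^+ 2 + b ^+ 2) *: w) = 0 by rewrite Ew rip0r.
  rewrite !ripDr ripNr !ripZr -rH => E.
  have := rip_ge0 (H w - kreal k a *: w).
  rewrite ripDr ripNr ripZr !ripDl !ripNl !ripZl (ripC w (H w)) => E2.
  have b2 : 0 < b ^+ 2 by rewrite exprn_even_gt0.
  have := rip_ge0 w; rewrite (ripC w (H w)) in E.
  by move=> wge; rewrite eq_le wge andbT -(pmulr_rle0 _ b2); nra.
Qed.

Hypothesis H_ge0 : forall u, 0 <= ip u (H u).

Definition eigenbasis n (b : 'I_n -> V) (a : 'I_n -> R) :=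
  [/\ rorthonormal b, forall i, 0 <= a i, forall i, H (b i) = kreal k (a i) *: b i &
    forall v, v = \sum_i kreal k (rip (b i) v) *: b i].

(** An orthonormal family of eigenvectors that does not span can be extended, its
    orthogonal complement being invariant; orthonormal families have bounded size. *)
Lemma eigenbasis_exists : exists n (b : 'I_n -> V) (a : 'I_n -> R), eigenbasis b a.
Proof.
apply: contrapT => noP.
suff [b [a [ob _ _]]] : exists (b : 'I_(#|vidx V|.+1) -> V) (a : 'I_(#|vidx V|.+1) -> R),
    [/\ rorthonormal b, forall i, 0 <= a i & forall i, H (b i) = kreal k (a i) *: b i].
  by have := orthonormal_size ob; rewrite ltnn.
elim: (_.+1) => [|n [b [a [ob a0 Hb]]]].
  by exists (fun _ => 0), (fun _ => 0); split => -[].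
have /existsNP[v /eqP v0] : ~ forall v, v = \sum_i kreal k (rip (b i) v) *: b i.
  by move=> cb; apply: noP; exists n, b, a.
have [||u|||c [w [Sw w0 Hw]]] := @eigen_exists (fun u => forall i, rip (b i) u = 0)
    (v - \sum_i kreal k (rip (b i) v) *: b i).
- by move=> u w Su Sw i; rewrite ripDr Su Sw addr0.
- by move=> c u Su i; rewrite ripZr Su mulr0.
- by move=> Su i; rewrite -rH Hb ripZl Su mulr0.
- by move=> i; rewrite ripDr ripNr rip_orthonormal_sum ?subrr.
- by rewrite subr_eq0.
have ww : 0 < rip w w by rewrite lt_def rip_eq0 w0 rip_ge0.
pose w' := kreal k (Num.sqrt (rip w w))^-1 *: w.
have w'1 : rip w' w' = 1.
  rewrite /w' ripZl ripZr mulrA -expr2 exprVn sqr_sqrtr ?ltW // mulVf //.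
  by rewrite gt_eqF.
have bw i : rip (b i) w' = 0 by rewrite ripZr Sw mulr0.
exists (fun i => oapp b w' (unlift ord_max i)), (fun i => oapp a c (unlift ord_max i)).
split=> [i j|i|i].
- case: (unliftP ord_max i) => [i' ->|->]; case: (unliftP ord_max j) => [j' ->|->];
    rewrite /= ?ob ?(inj_eq lift_inj) ?eqxx ?bw //.
  + by rewrite eq_sym (negPf (neq_lift _ _)).
  + by rewrite ripC bw (negPf (neq_lift _ _)).
- case: (unliftP ord_max i) => [i' _|_] //=.
  have : 0 <= rip w (H w) by apply: kRe_ge0.
  by rewrite Hw ripZr pmulr_lge0.
- case: (unliftP ord_max i) => [i' _|_] //=.
  by rewrite /w' linearZ /= Hw !scalerA mulrC.
Qed.

(** The powers of [H] are diagonal in an eigenbasis, so the exponential series splits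
    into scalar ones. *)
Lemma opexp_eigenbasis n (b : 'I_n -> V) (a : 'I_n -> R) t v : eigenbasis b a ->
  opexp (kreal k t *: H) v =
  \sum_i kreal k (expR (t * a i) * rip (b i) v) *: b i.
Proof.
case=> ob a0 Hb cb; apply: vcoord_inj => i; rewrite of_vcoordK.
have iterE j : iter j (kreal k t *: H) v =
    \sum_l kreal k ((t * a l) ^+ j * rip (b l) v) *: b l.
  elim: j => [|j IH]; first by under eq_bigr do rewrite expr0 mul1r.
  rewrite iterS IH linear_sum /=; apply: eq_bigr => l _.
  rewrite linearZ /= scale_lfunE Hb !scalerA -!krealM; congr (kreal k _ *: _).
  by rewrite exprS; ring.
apply/cvg_lim => //; rewrite (rform_sum _ _ _ (vcoord_rform i)).
under eq_bigr do rewrite vcoordZ.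
rewrite (_ : (fun j => _) = fun m => \sum_l
    (series (exp_coeff (t * a l)) m) * (rip (b l) v * vcoord i (b l))).
  apply: cvg_big => [|l _]; first exact: add_continuous.
  rewrite -mulrA; apply: cvgMr_tmp.
  exact: is_cvg_series_exp_coeff.
apply/funext => m; rewrite (rform_sum _ _ _ (vcoord_rform i)).
under eq_bigr => j _.
  rewrite iterE (_ : (j`!%:R)^-1 = kreal k (j`!%:R)^-1); last first.
    by case: k => //=; rewrite fmorphV rmorph_nat.
  rewrite vcoordZ (rform_sum _ _ _ (vcoord_rform i)) mulr_sumr.
  over.
rewrite exchange_big /=; apply: eq_bigr => l _; rewrite mulr_suml.
apply: eq_bigr => j _; rewrite vcoordZ /exp_coeff /=; ring.
Qed.

End Operator.
End Spectral.

(** * Parallel transport and the Laplacian *)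

Section Bundles.
Context {R : realType} {G : wgraph R} {k : kind} {r : nat} {F : bundle G k r}.
Variables (h : connection F) (H : potential F).
Implicit Types (x y : vertex G) (e : edge G).

Lemma transportE (U U' : ipspace R k) (p q : U = U') u : transport p u = transport q u.
Proof. by rewrite (Prop_irrelevance p q). Qed.

Lemma fcastE x y (p : vfib F x = vfib F y) (u : vfib F x) : x = y ->
  fcast y u = transport p u.
Proof. by move=> xy; rewrite /fcast; case: eqP => // q; exact: transportE. Qed.

Lemma fcast_id x (u : vfib F x) : fcast x u = u.
Proof. by rewrite (@fcastE x x erefl u erefl). Qed.

Lemma fcast_neq x y (u : vfib F x) : x != y -> fcast y u = 0.
Proof. by rewrite /fcast; case: eqP. Qed.

Lemma fcast_section (f : gsection F) x y : x = y -> fcast y (f x) = f y.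
Proof. by move=> <-; rewrite fcast_id. Qed.

Lemma fcast_rlinear x y : rlinear (fun u : vfib F x => fcast y u).
Proof.
have [<-|xy] := eqVneq x y.
  by split=> *; rewrite !fcast_id.
by split=> *; rewrite !fcast_neq ?addr0 ?scaler0.
Qed.

Lemma rip_fcast x y (u v : vfib F x) : x = y -> rip (fcast y u) (fcast y v) = rip u v.
Proof. by move=> <-; rewrite !fcast_id. Qed.

Lemma rip_fcast_le x y (u : vfib F x) : rip (fcast y u) (fcast y u) <= rip u u.
Proof.
have [<-|xy] := eqVneq x y; first by rewrite fcast_id.
by rewrite fcast_neq // rip0r rip_ge0.
Qed.

Lemma hedge_rlinear e : rlinear (hedge h e).
Proof. by split=> *; rewrite /hedge !(linearD, linearZ). Qed.

Lemma rip_hedge e u v : rip (hedge h e u) (hedge h e v) = rip u v.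
Proof. by rewrite /rip /hedge hout_ip hin_ip. Qed.

(** The holonomy along the inverse of an edge issued from [x], as a map into the
    fibre over [x]; it is the map that occurs in the Laplacian. *)
Definition back x e (v : vfib F (tgt e)) : vfib F x :=
  fcast x (hedge h (erev e) (fcast (src (erev e)) v)).
Arguments back : clear implicits.

Lemma src_erev e : src (erev e) = tgt e.
Proof. by rewrite -tgt_erev erevK. Qed.

Lemma back_rlinear x e : rlinear (back x e).
Proof.
split=> *; rewrite /back.
  by rewrite (fcast_rlinear _ _).1 (hedge_rlinear _).1 (fcast_rlinear _ _).1.
by rewrite (fcast_rlinear _ _).2 (hedge_rlinear _).2 (fcast_rlinear _ _).2.
Qed.

Lemma rip_back x e u v : src e = x -> rip (back x e u) (back x e v) = rip u v.
Proof.
move=> ex; rewrite /back rip_fcast ?tgt_erev // rip_hedge.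
by rewrite rip_fcast // src_erev.
Qed.

Lemma hedgeK e u : back (src e) e (hedge h e u) = u.
Proof.
have hin_hout (w : efib F e) : hin h (erev e) (fcast (src (erev e)) (hout h e w)) =
    transport (esym (efib_erev F e)) w.
  have /= := (houtK h (erev e)).2 (transport (esym (efib_erev F e)) w).
  move=> E; rewrite -[RHS]E; congr (hin h (erev e) _) => {E}.
  (* [houtK] at [erev e] lands in the fibre over [erev (erev e)]; generalising that
     edge reduces the casts to the identity. *)
  move: (efib_erev F (erev e)) (tgt_erev (erev e)).
  move: (src (erev e)) (esym (efib_erev F e)) (src_erev e) => y.
  move: (efib F (erev e)) (erev (erev e)) (erevK e) => E _ -> p ye q ty.
  rewrite (fcastE (congr1 (vfib F) ty)) //; congr (transport _ (hout h e _)).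
  by case: E / p q => q; rewrite (transportE (esym q) erefl).
rewrite /back {1}/hedge [hedge h e u]/hedge hin_hout.
rewrite (fcastE (congr1 (vfib F) (tgt_erev e))) ?tgt_erev //.
exact: (houtK h e).1.
Qed.

(** Transport along the inverse edge is the inverse, hence the adjoint, of an isometry. *)
Lemma rip_back_adj x e u v : src e = x ->
  rip u (back x e v) = rip (hedge h e (fcast (src e) u)) v.
Proof.
move=> ex; rewrite -(rip_back (hedge h e _) v ex); case: _ / ex in u *.
by rewrite hedgeK fcast_id.
Qed.

Section HolPot.
Hypothesis H_ge0 : pot_nonneg H.

Lemma pot_eigenbasis x : exists n (b : 'I_n -> vfib F x) (a : 'I_n -> R),
  eigenbasis (pot H x) b a.
Proof. exact: (eigenbasis_exists (@pot_sym _ _ _ _ _ H x) (@H_ge0 x)). Qed.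

Lemma hol_potE x n (b : 'I_n -> vfib F x) (a : 'I_n -> R) t v :
  eigenbasis (pot H x) b a ->
  hol_pot H t v = \sum_i kreal k (expR (- fine t * a i) * rip (b i) v) *: b i.
Proof. by move=> eb; rewrite /hol_pot (opexp_eigenbasis _ _ eb). Qed.

Lemma rip_hol_pot x n (b : 'I_n -> vfib F x) (a : 'I_n -> R) t v i :
  eigenbasis (pot H x) b a ->
  rip (b i) (hol_pot H t v) = expR (- fine t * a i) * rip (b i) v.
Proof.
by move=> eb; rewrite (hol_potE _ _ eb) rip_orthonormal_sum //; case: eb.
Qed.

Lemma hol_pot_rlinear x t : rlinear (@hol_pot _ _ _ _ _ H x t).
Proof.
have [n [b [a eb]]] := pot_eigenbasis x; split=> [u v|c u]; rewrite !(hol_potE _ _ eb).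
  by rewrite -big_split; apply: eq_bigr => i _; rewrite ripDr mulrDr krealD scalerDl.
rewrite scaler_sumr; apply: eq_bigr => i _.
by rewrite scalerA -krealM ripZr mulrCA.
Qed.

(** Parseval's identity. *)
Lemma rip_eigenbasis x n (b : 'I_n -> vfib F x) (a : 'I_n -> R) v :
  eigenbasis (pot H x) b a -> rip v v = \sum_i rip (b i) v ^+ 2.
Proof.
case=> _ _ _ cb; rewrite {2}[v]cb (rform_sum _ _ _ (rip_rform v)).
by apply: eq_bigr => i _; rewrite ripZr ripC.
Qed.

Lemma hol_pot_contraction x t (v : vfib F x) : 0 <= fine t ->
  rip (hol_pot H t v) (hol_pot H t v) <= rip v v.
Proof.
move=> t0; have [n [b [a eb]]] := pot_eigenbasis x.
rewrite !(rip_eigenbasis _ eb); apply: ler_sum => i _.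
rewrite (rip_hol_pot _ _ _ eb) exprMn ler_piMl ?sqr_ge0 //.
rewrite expr_le1 ?expR_ge0 // -expR0 ler_expR mulNr oppr_le0 mulr_ge0 //.
by case: eb.
Qed.

End HolPot.

Lemma kRe_sum I (s : seq I) (P : pred I) (f : I -> kfield R k) :
  kRe (\sum_(i <- s | P i) f i) = \sum_(i <- s | P i) kRe (f i).
Proof. by apply: (big_morph _ kReD); case: (k). Qed.

Definition rip_Omega0 (f g : gsection F) : R := kRe (ip_Omega0 f g).

Lemma rip_Omega0E f g : rip_Omega0 f g = \sum_x lambda x * rip (f x) (g x).
Proof. by rewrite /rip_Omega0 kRe_sum; apply: eq_bigr => x _; rewrite kRe_real. Qed.

Lemma lambda_gt0_edge e : 0 < lambda (src e).
Proof.
rewrite /lambda (bigD1 e) //= ltr_wpDr ?chi_gt0 //.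
by apply: sumr_ge0 => i _; rewrite ltW ?chi_gt0.
Qed.

Lemma lambda_trans x e : src e = x -> lambda x * trans x e = chi e.
Proof.
by move=> <-; rewrite /trans eqxx mulrC divfK // gt_eqF ?lambda_gt0_edge.
Qed.

Lemma rip_laplacian f g : Omega0 f -> Omega0 g ->
  rip_Omega0 f (laplacian h g) = \sum_x lambda x * rip (f x) (g x) -
    \sum_e chi e * rip (f (src e)) (back (src e) e (g (tgt e))).
Proof.
move=> f0 g0; rewrite rip_Omega0E.
rewrite [X in _ - X](partition_big src predT) //= -sumrB; apply: eq_bigr => x _.
have [xw|xw] := boolP (x \in well).
  rewrite f0 // !rip0l mulr0 big1 ?subr0 //.
  by move=> e /eqP ex; rewrite (f0 (src e)) ?ex // rip0l mulr0.
rewrite /laplacian (negPf xw) ripDr ripNr mulrBr; congr (_ - _).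
rewrite (rform_sum _ _ _ (rip_rform _)) mulr_sumr; apply: eq_bigr => e /eqP ex.
rewrite ripZr mulrA lambda_trans //; case: ifP => [tw|_].
  by rewrite (g0 (tgt e)) // (rlinear0 (back_rlinear _ _)) !rip0r.
by case: _ / ex.
Qed.

(** Edge reversal exchanges the two sides of the edge sum in [rip_laplacian], since the
    conductances [lambda x * trans x e = chi e] are symmetric. *)
Lemma laplacian_sym f g : Omega0 f -> Omega0 g ->
  rip_Omega0 f (laplacian h g) = rip_Omega0 g (laplacian h f).
Proof.
move=> f0 g0; rewrite !rip_laplacian //; congr (_ - _).
  by apply: eq_bigr => x _; rewrite ripC.
rewrite [RHS](reindex_inj (inv_inj (@erevK _ G))) /=; apply: eq_bigr => e _.
rewrite chi_erev [in RHS]rip_back_adj // fcast_id [RHS]mulrC [LHS]mulrC.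
rewrite /back (fcast_section g (esym (src_erev e))).
rewrite -(fcast_section f (tgt_erev e)) rip_fcast ?tgt_erev //.
by rewrite ripC.
Qed.

End Bundles.

Arguments back {R G k r F} h x e v.

(** * The maximum principle and the hitting time of the well *)

Section PotentialTheory.
Context {R : realType} {G : wgraph R}.
Implicit Types (x y : vertex G) (e : edge G) (v : vertex G -> R).

Lemma edge_from x : x \notin well -> exists e, src e = x.
Proof.
move=> xw; have [w ww] := well_nonempty G.
case/connectP: (connected_graph x w) => -[|y p] /=.
  by move=> _ wx; rewrite -wx ww in xw.
by case/andP => /existsP[e /andP[/eqP ex _]] _ _; exists e.
Qed.

Lemma lambda_gt0 x : x \notin well -> 0 < lambda x.
Proof. by case/edge_from => e <-; exact: lambda_gt0_edge. Qed.

Lemma trans_gt0 x e : src e = x -> 0 < trans x e.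
Proof. by move=> <-; rewrite /trans eqxx divr_gt0 ?chi_gt0 ?lambda_gt0_edge. Qed.

Lemma sum_trans x : x \notin well -> \sum_(e | src e == x) trans x e = 1.
Proof.
move=> xw; rewrite -(divff (lt0r_neq0 (lambda_gt0 xw))) mulr_suml.
by apply: eq_bigr => e ex; rewrite /trans ex.
Qed.

(** A maximal value is attained at all neighbours of a maximiser outside the
    well, hence, the graph being connected, somewhere in the well. *)
Lemma max_principle v : (forall x, x \in well -> v x <= 0) ->
  (forall x, x \notin well -> v x <= \sum_(e | src e == x) trans x e * v (tgt e)) ->
  forall x, v x <= 0.
Proof.
move=> vw vP x; have [w ww] := well_nonempty G.
have [m _ vm] := @arg_maxP _ R _ x predT v isT.
apply: (le_trans (vm x isT)); rewrite leNgt; apply/negP => m0.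
suff vE : v w = v m by move: (vw w ww); rewrite vE leNgt m0.
case/connectP: (connected_graph m w) => p.
have : v m = v m by [].
elim: p {1 3 4}m => [y vy _ -> //|z p IH y vy /= /andP[/existsP[e]]].
move=> /andP[/eqP ey /eqP ez] pz wz; apply: (IH z) => //.
have yw : y \notin well by apply: contraL m0 => /vw; rewrite vy leNgt.
have : \sum_(e | src e == y) trans y e * (v m - v (tgt e)) <= 0.
  under eq_bigr do rewrite mulrBr.
  by rewrite sumrB -mulr_suml sum_trans // mul1r subr_le0 -vy vP.
rewrite (bigD1 e) ?ey //= => le0.
have s0 : 0 <= \sum_(i | (src i == y) && (i != e)) trans y i * (v m - v (tgt i)).
  by apply: sumr_ge0 => i _; rewrite mulr_ge0 ?trans_ge0 // subr_ge0; exact: vm.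
have : trans y e * (v m - v (tgt e)) <= 0 by apply: le_trans le0; rewrite lerDl.
rewrite pmulr_rle0 ?trans_gt0 // subr_le0 ez => ge.
by apply/eqP; rewrite eq_le ge andbT; exact: vm.
Qed.

(** The solution is the expected number of jumps before the well is entered. By the
    maximum principle the linear system is injective, hence solvable. *)
Lemma hitting_time_exists : exists psi : vertex G -> R, (forall x, 0 <= psi x) /\
  forall x, x \notin well -> psi x = 1 + \sum_(e | src e == x) trans x e * psi (tgt e).
Proof.
pose L (v : {ffun vertex G -> R^o}) : {ffun vertex G -> R^o} := [ffun x => v x -
  if x \in well then 0 else \sum_(e | src e == x) trans x e * v (tgt e)].
have linL : linear L.
  move=> a u v; apply/ffunP => x; rewrite !ffunE; case: ifP => _.
    by rewrite !subr0.
  under eq_bigr do rewrite !ffunE mulrDr mulrCA.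
  by rewrite big_split -mulr_sumr opprD addrACA scalerBr.
pose Lm := GRing.isLinear.Build _ _ _ _ L linL.
pose LL : {linear {ffun vertex G -> R^o} -> {ffun vertex G -> R^o}} := HB.pack L Lm.
have LLE (u : {ffun vertex G -> R^o}) : linfun LL u = L u by rewrite lfunE.
have harm0 (v : {ffun vertex G -> R^o}) : L v = 0 -> forall x, v x <= 0.
  move=> /ffunP Lv; apply: max_principle => x xw; move: (Lv x); rewrite !ffunE.
    by rewrite xw subr0 => ->.
  by rewrite (negPf xw) => /subr0_eq ->.
have ker0 : lker (linfun LL) == 0%VS.
  apply/lker0P => u v; rewrite !LLE => uv; apply/subr0_eq.
  have L1 : L (u - v) = 0 by rewrite -[L _]/(LL _) linearB /= uv subrr.
  have L2 : L (v - u) = 0 by rewrite -[L _]/(LL _) linearB /= uv subrr.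
  apply/ffunP => x; rewrite !ffunE; apply/eqP; rewrite eq_le.
  have := harm0 _ L1 x; have := harm0 _ L2 x; rewrite !ffunE => A B.
  by rewrite B /= -oppr_le0 opprB.
have [psi _ psiE] : exists2 psi, psi \in fullv &
    [ffun x => if x \in well then 0 else 1] = linfun LL psi.
  apply/memv_imgP; rewrite (_ : limg _ = fullv) ?memvf //.
  by apply/eqP; rewrite -dimv_leqif_eq ?subvf // limg_dim_eq // (eqP ker0) capv0.
move: psiE; rewrite LLE => /ffunP psiE.
have psiw x : x \in well -> psi x = 0.
  by move=> xw; move: (psiE x); rewrite !ffunE xw subr0.
have psix x : x \notin well -> psi x = 1 + \sum_(e | src e == x) trans x e * psi (tgt e).
  by move=> xw; move: (psiE x); rewrite !ffunE (negPf xw) => /eqP; rewrite eq_sym subr_eq => /eqP.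
exists psi; split=> // x; rewrite -oppr_le0.
apply: (max_principle (v := fun x => - psi x)) => {}x xw; first by rewrite psiw ?oppr0.
rewrite psix //; under [leRHS]eq_bigr do rewrite mulrN.
by rewrite sumrN lerN2 lerDr.
Qed.

End PotentialTheory.

(** * Integration against the constructed measures *)

Section MeasureLemmas.
Local Open Scope ereal_scope.
Context {R : realType}.

Import HBNNSimple.

(** The density is given on measurable sets; simple functions and monotone
    convergence extend it to nonnegative integrands. *)
Lemma ge0_integral_density d (T : measurableType d) (m L : {measure set T -> \bar R})
    (rho : T -> R) (f : T -> \bar R) :
  measurable_fun setT rho -> (forall x, (0 <= rho x)%R) ->
  (forall A, measurable A -> m A = \int[L]_(x in A) (rho x)%:E) ->
  measurable_fun setT f -> (forall x, 0 <= f x) ->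
  \int[m]_x f x = \int[L]_x (f x * (rho x)%:E).
Proof.
move=> mrho rho0 mE mf f0; pose h := nnsfun_approx measurableT mf.
have mrhoE : measurable_fun setT (EFin \o rho) by exact/measurable_EFinP.
have hf x : EFin \o h^~ x @ \oo --> f x.
  by apply: cvg_nnsfun_approx => // *; exact: f0.
transitivity (limn (fun n => \int[m]_x (h n x)%:E)).
  rewrite -monotone_convergence //.
  - by apply: eq_integral => x _; apply/esym/cvg_lim => //; exact: hf.
  - by move=> n; exact/measurable_EFinP/measurable_funP.
  - by move=> n x _; rewrite lee_fin.
  - by move=> x _ a b ab; rewrite lee_fin; exact/lefP/nd_nnsfun_approx.
transitivity (limn (fun n => \int[L]_x ((h n x)%:E * (rho x)%:E))); last first.
  rewrite -monotone_convergence //.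
  - apply: eq_integral => x _; apply/cvg_lim => //.
    by apply: cvgeZr => //; exact: hf.
  - move=> n; apply: emeasurable_funM => //.
    exact/measurable_EFinP/measurable_funP.
  - by move=> n x _; rewrite mule_ge0 // lee_fin.
  - move=> x _ a b ab; rewrite lee_wpmul2r ?lee_fin //.
    exact/lefP/nd_nnsfun_approx.
congr (limn _); apply/funext => n.
have mh r : measurable_fun setT (fun x => (r * \1_(h n @^-1` [set r]) x)%:E).
  by apply/measurable_EFinP/measurable_funM.
transitivity (\sum_(r \in range (h n))
    \int[m]_x (r * \1_(h n @^-1` [set r]) x)%:E).
  under eq_integral do rewrite fimfunE -fsumEFin //.
  by rewrite ge0_integral_fsum // => r x _; rewrite nnfun_muleindic_ge0.
transitivity (\sum_(r \in range (h n))
    \int[L]_x ((r * \1_(h n @^-1` [set r]) x)%:E * (rho x)%:E)); last first.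
  rewrite -ge0_integral_fsum //.
  - apply: eq_integral => x _; rewrite [in RHS]fimfunE -fsumEFin //.
    rewrite ge0_mule_fsuml // => r; exact: nnfun_muleindic_ge0.
  - by move=> r; exact: emeasurable_funM.
  - by move=> r x _; apply: mule_ge0; rewrite ?lee_fin // -lee_fin EFinM nnfun_muleindic_ge0.
apply: eq_fsbigr => r; rewrite inE => -[x _ hx].
have r0 : (0 <= r)%R by rewrite -hx.
rewrite integralZl_indic_nnsfun // integral_indic // setIT mE //.
under [RHS]eq_integral do rewrite EFinM -muleA.
rewrite ge0_integralZl_EFin //.
- congr (_ * _); rewrite integral_mkcond; apply: eq_integral => y _.
  by rewrite patchE indicE; case: ifPn => _; rewrite ?mul1e ?mul0e.
- by move=> y _; rewrite mule_ge0 // lee_fin.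
- by apply: emeasurable_funM => //; exact/measurable_EFinP.
Qed.

Lemma ge0_integral_mrestr d (T : measurableType d) (m : {measure set T -> \bar R})
    (D : set T) (mD : measurable D) (f : T -> \bar R) :
  measurable_fun setT f -> (forall x, 0 <= f x) ->
  \int[mrestr m mD]_x f x = \int[m]_x (f x * (\1_D x)%:E).
Proof.
move=> mf f0; apply: ge0_integral_density => //.
by move=> A mA; rewrite integral_indic // setIC.
Qed.

Lemma ge0_integral_mpush d d' (T : measurableType d) (T' : measurableType d')
    (m : {measure set T -> \bar R}) (g : T -> T') (mg : measurable_fun setT g)
    (f : T' -> \bar R) :
  measurable_fun setT f -> (forall x, 0 <= f x) ->
  \int[mpush m mg]_x f x = \int[m]_x f (g x).
Proof. by move=> mf f0; rewrite [LHS]ge0_integral_pushforward. Qed.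

Lemma ge0_integral_mfsum d (T : measurableType d) (I : finType) (P : pred I)
    (m : I -> {measure set T -> \bar R}) (f : T -> \bar R) :
  measurable_fun setT f -> (forall x, 0 <= f x) ->
  \int[mfsum P m]_x f x = \sum_(i | P i) \int[m i]_x f x.
Proof.
move=> mf f0; pose ms := fix ms (s : seq I) : {measure set T -> \bar R} :=
  if s is i :: s' then
    if P i then (measure_add (m i) (ms s') : {measure set T -> \bar R}) else ms s'
  else (mzero : {measure set T -> \bar R}).
transitivity (\int[ms (index_enum I)]_x f x).
  congr (integral _ _ _); apply/funext => A; rewrite /mfsum.
  elim: (index_enum I) => [|i s IH]; first by rewrite big_nil.
  by rewrite big_cons IH /=; case: ifP => _ //; exact/esym/measure_addE.
elim: (index_enum I) => [|i s IH]; first by rewrite big_nil integral_measure_zero.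
rewrite big_cons -IH /=; case: ifP => _ //.
exact: ge0_integral_measure_add.
Qed.

End MeasureLemmas.

(** Finiteness of the mass is an argument, so that the structure of finite measure can
    be inferred from the term. *)
Definition fin_mass d (T : measurableType d) (R : realType)
  (m : {measure set T -> \bar R}) (mfin : (m setT < +oo)%E) : set T -> \bar R := m.

Section FinMass.
Local Open Scope ereal_scope.
Context d (T : measurableType d) (R : realType).
Variables (m : {measure set T -> \bar R}) (mfin : m setT < +oo).

HB.instance Definition _ := Measure.copy (fin_mass mfin) m.

Let fin_mass_fin : fin_num_fun (fin_mass mfin).
Proof.
move=> A mA; rewrite ge0_fin_numE //; apply: le_lt_trans mfin.
by rewrite le_measure ?inE.
Qed.

HB.instance Definition _ := Measure_isFinite.Build _ _ _ (fin_mass mfin) fin_mass_fin.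

End FinMass.

Section Tonelli.
Local Open Scope ereal_scope.
Context {R : realType}.

(** Tonelli's theorem wants a sigma-finite first factor; a sub-Markov path law is only
    known to be one through its mass. *)
Lemma tonelli_finite d d' (T : measurableType d) (T' : measurableType d')
    (m : {measure set T -> \bar R}) (m' : {sigma_finite_measure set T' -> \bar R})
    (f : T * T' -> \bar R) : m setT < +oo ->
  measurable_fun setT f -> (forall x, 0 <= f x) ->
  \int[product_measure1 m m']_z f z = \int[m]_x \int[m']_y f (x, y).
Proof.
move=> mfin mf f0.
exact: (@fubini_tonelli1 _ _ _ _ _ (fin_mass mfin) m').
Qed.

End Tonelli.

(** * Lebesgue measure and the exponential law on the line *)

Section OneDimensional.
Local Open Scope ereal_scope.
Context {R : realType}.
Local Notation leb := (@lebesgue_measure R).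
Local Notation RR := (measurableTypeR R).

Lemma ge0_eq_integral_off d (T : measurableType d) (m : {measure set T -> \bar R})
    (N : set T) (f g : T -> \bar R) :
  measurable N -> m N = 0 ->
  measurable_fun setT f -> measurable_fun setT g ->
  (forall x, 0 <= f x) -> (forall x, 0 <= g x) ->
  (forall x, ~ N x -> f x = g x) -> \int[m]_x f x = \int[m]_x g x.
Proof.
move=> mN N0 mf mg f0 g0 fg; apply: ge0_ae_eq_integral => //.
exists N; split=> // x /= /not_implyP[_]; apply: contra_notP; exact: fg.
Qed.

Lemma lebesgue_measureD (b : R) (A : set RR) : measurable A ->
  leb ((fun t : RR => t + b)%R @^-1` A) = leb A.
Proof.
move=> mA.
have mt : measurable_fun setT (fun t : RR => t + b : RR)%R by exact: measurable_funD.
rewrite -[LHS]/(mpush leb mt A); apply/esym.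
apply: (@lebesgue_measure_unique R (mpush leb mt)) => // _ [[c e] _ <-].
rewrite /mpush /pushforward /=.
have -> : (fun t : RR => t + b)%R @^-1` `]c, e] = `](c - b)%R, (e - b)%R]%classic :> set R.
  by apply/seteqP; split=> t /=; rewrite !in_itv /= ltrBlDr lerBrDr.
rewrite !lebesgue_measure_itv /= !lte_fin ltrD2r; case: ifP => // _.
by rewrite -!EFinD; congr EFin; ring.
Qed.

Lemma lebesgue_measureB (b : R) (A : set RR) : measurable A ->
  leb ((fun t : RR => b - t)%R @^-1` A) = leb A.
Proof.
move=> mA; rewrite -[RHS](lebesgue_measureD b) // -[RHS]lebesgue_measureN.
  by congr (leb _); apply/seteqP; split=> t /=; rewrite addrC.
rewrite -[X in measurable X]setTI; apply: (_ : measurable_fun setT _) => //.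
exact: measurable_funD.
Qed.

Lemma ge0_integral_translation (b : R) (f : RR -> \bar R) :
  measurable_fun setT f -> (forall t, 0 <= f t) ->
  \int[leb]_t f (t + b)%R = \int[leb]_t f t.
Proof.
move=> mf f0.
have mt : measurable_fun setT (fun t : RR => t + b : RR)%R by exact: measurable_funD.
rewrite -(ge0_integral_mpush leb mt) //; apply: eq_measure_integral => A mA _.
exact: lebesgue_measureD.
Qed.

Lemma exp_lawE (f : RR -> \bar R) : measurable_fun setT f -> (forall t, 0 <= f t) ->
  \int[exp_law R]_t f t = \int[leb]_t (f t * (exponential_pdf 1 t)%:E).
Proof.
move=> mf f0; apply: ge0_integral_density => //.
- exact: measurable_exponential_pdf.
- by move=> x; rewrite exponential_pdf_ge0.
Qed.

(** The exponential law charges positive times only. *)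
Lemma exp_law_eq (f g : RR -> \bar R) :
  measurable_fun setT f -> measurable_fun setT g ->
  (forall t, 0 <= f t) -> (forall t, 0 <= g t) ->
  (forall t, (0 < t)%R -> f t = g t) ->
  \int[exp_law R]_t f t = \int[exp_law R]_t g t.
Proof.
move=> mf mg f0 g0 fg; rewrite !exp_lawE //.
have mpdf : measurable_fun setT (EFin \o exponential_pdf (1 : R)).
  by apply/measurable_EFinP; exact: measurable_exponential_pdf.
have pdf0 t : 0 <= (exponential_pdf (1 : R) t)%:E.
  by rewrite lee_fin exponential_pdf_ge0.
apply: (@ge0_eq_integral_off _ _ leb [set 0%R]) => //.
- exact: lebesgue_measure_set1.
- exact: emeasurable_funM.
- exact: emeasurable_funM.
- by move=> t; rewrite mule_ge0.
- by move=> t; rewrite mule_ge0.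
move=> t /eqP t0; have [tneg|tpos] := ltP t 0%R.
  by rewrite lt0_exponential_pdf // !mule0.
by rewrite fg // lt_def t0.
Qed.

Lemma integral_exp_law1 : \int[exp_law R]_t (1 : \bar R) = 1.
Proof. by rewrite integral_cst // mul1e; exact: probability_setT. Qed.

Lemma exp_law_tail (t : R) : (0 < t)%R -> exp_law R `]t, +oo[%classic = (expR (- t))%:E.
Proof.
move=> t0; have -> : `]t, +oo[%classic = ~` `]-oo, t]%classic :> set RR.
  by rewrite setCitvl.
rewrite probability_setC; last exact: measurable_itv.
have -> : exp_law R `]-oo, t]%classic = exp_law R `[0%R, t]%classic.
  have E B : exp_law R B =
      \int[leb]_(s in B `&` `[0%R, +oo[) (1 * expR (-1 * s))%:E.
    by rewrite integral_mkcondr restrict_EFin.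
  rewrite !E; congr (integral _ _ _).
  apply/seteqP; split=> s /=; rewrite !in_itv /= ?andbT.
    by case=> -> ->.
  by move=> [/andP[-> ->]].
rewrite [exp_law R _]exponential_prob_itv0c // mulN1r -!EFinB.
by congr EFin; rewrite opprB addrC subrK.
Qed.

Lemma measurable_before (f : RR -> \bar R) : measurable_fun setT f ->
  measurable_fun setT
    (fun u : RR * RR => f u.2 * (\1_`]0%R, u.1[%classic u.2)%:E).
Proof.
move=> mf; pose A : set (RR * RR) := [set u | (0 < u.2)%R && (u.2 < u.1)%R].
have mA : measurable A.
  have : measurable_fun setT (fun u : RR * RR => (0 < u.2)%R && (u.2 < u.1)%R).
    by apply: measurable_and; apply: measurable_fun_ltr.
  by move=> /(_ measurableT [set true] Logic.I); rewrite setTI.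
rewrite (_ : (fun _ => _) = fun u : RR * RR => f u.2 * (\1_A u)%:E).
  apply: emeasurable_funM; first exact: (measurableT_comp mf measurable_snd).
  exact/measurable_EFinP.
by apply/funext => u; rewrite !indicE; congr (_ * (nat_of_bool _)%:R%:E).
Qed.

(** Integrating over the time spent before an exponential clock rings amounts to
    sampling that clock. *)
Lemma exp_law_time (f : RR -> \bar R) : measurable_fun setT f -> (forall t, 0 <= f t) ->
  \int[exp_law R]_s \int[leb]_t (f t * (\1_`]0%R, s[%classic t)%:E) = \int[exp_law R]_t f t.
Proof.
move=> mf f0; pose g (u : RR * RR) := f u.2 * (\1_`]0%R, u.1[%classic u.2)%:E.
have mg : measurable_fun setT g by exact: measurable_before.
have g0 u : 0 <= g u by rewrite mule_ge0.
rewrite (@fubini_tonelli _ _ _ _ _ (exp_law R) leb g) // exp_lawE //.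
apply: (@ge0_eq_integral_off _ _ leb [set 0%R]) => //.
- exact: lebesgue_measure_set1.
- exact: measurable_fun_fubini_tonelli_G.
- apply: emeasurable_funM => //; apply/measurable_EFinP.
  exact: measurable_exponential_pdf.
- by move=> t; apply: integral_ge0 => s _.
- by move=> t; rewrite mule_ge0 // lee_fin exponential_pdf_ge0.
move=> t /eqP t0; rewrite /fubini_G /g /=.
have [tneg|tpos] := ltP t 0%R.
  rewrite lt0_exponential_pdf // mule0 integral0_eq // => s _.
  rewrite indicE memNset ?mule0 //= in_itv /= => /andP[].
  by rewrite ltNge ltW.
have {t0}tpos : (0 < t)%R by rewrite lt_def t0.
transitivity (f t * \int[exp_law R]_s (\1_`]t, +oo[%classic s)%:E).
  rewrite -[RHS]ge0_integralZl //.
    apply: eq_integral => s _; rewrite !indicE; congr (_ * (nat_of_bool _)%:R%:E).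
    by apply/idP/idP; rewrite !inE /= !in_itv /= andbT tpos.
  exact/measurable_EFinP.
rewrite integral_indic ?setIT //.
rewrite exponential_pdfE ?ltW // mul1r mulN1r.
by congr (_ * _); exact: exp_law_tail.
Qed.

(** A holding time at an eigenvector of [H] with eigenvalue [a] contributes this factor:
    the exponential clock turns the semigroup into the resolvent. *)
Lemma exp_law_laplace (a : R) : (0 <= a)%R ->
  \int[exp_law R]_t (expR (- t * a))%:E = ((1 + a)^-1)%:E.
Proof.
move=> a0; have a1 : (0 < 1 + a)%R by rewrite ltr_wpDr.
rewrite exp_lawE; last 2 first.
- by apply/measurable_EFinP/measurableT_comp => //; exact: measurable_funM.
- by move=> t; rewrite lee_fin expR_ge0.
transitivity (((1 + a)^-1)%:E * \int[leb]_t (exponential_pdf (1 + a) t)%:E); last first.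
  by rewrite integral_exponential_pdf // mule1.
have p0 t : 0 <= (exponential_pdf (1 + a) t)%:E.
  by rewrite lee_fin exponential_pdf_ge0 // ltW.
have mp : measurable_fun [set: RR] (EFin \o exponential_pdf (1 + a)).
  by apply/measurable_EFinP; exact: measurable_exponential_pdf.
have ia : (0 <= (1 + a)^-1)%R by rewrite invr_ge0 ltW.
apply: etrans (ge0_integralZl_EFin leb measurableT (fun t _ => p0 t) mp ia).
apply: eq_integral => t _; rewrite -!EFinM; congr EFin.
have [t0|t0] := ltP t 0%R; first by rewrite !lt0_exponential_pdf // !mulr0.
rewrite !exponential_pdfE // mul1r mulrA mulVf ?gt_eqF // mul1r -expRD.
by congr expR; ring.
Qed.

End OneDimensional.

(** * The law of the random walk *)

Section Walk.
Local Open Scope ereal_scope.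
Context {R : realType} {G : wgraph R}.
Local Notation leb := (@lebesgue_measure R).
Local Notation RR := (measurableTypeR R).
Local Notation path := (cpath G).
Implicit Types (x y : vertex G) (e : edge G) (m : vertex G -> {measure set path -> \bar R}).

Lemma walk_law_steps_le1 n x : walk_law_steps n x setT <= 1.
Proof.
elim: n x => [|n IH] x /=.
  by case: ifP => _; rewrite /= ?diracT // /mzero lee_fin.
have [xw|xw] := boolP (x \in well); first by rewrite /= /mzero lee_fin.
rewrite /mfsum /= /mscale /=.
apply: (@le_trans _ _ (\sum_(e | src e == x) (trans x e)%:E)).
  apply: lee_sum => e _; rewrite -[leRHS]mule1; apply: lee_wpmul2l.
    by rewrite lee_fin trans_ge0.
  apply: (@le_trans _ _ ((walk_law_steps n (tgt e) \x exp_law R) (setT `*` setT))).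
    by rewrite setXTT.
  rewrite product_measure1E // [X in _ * X](_ : _ = 1) ?mule1 //.
  exact: (@probability_setT _ _ _ (exp_law R)).
by rewrite sumEFin sum_trans.
Qed.

Lemma walk_law_steps_fin n x : walk_law_steps n x setT < +oo.
Proof. by apply: le_lt_trans (walk_law_steps_le1 n x) _; rewrite ltry. Qed.

(** The Markov property at the first jump: [m'] is [m] with one step in front. Stated
    on integrals, it applies both to the full law and to its truncations. *)
Definition first_jump (m' : {measure set path -> \bar R}) m x :=
  forall f : path -> \bar R, measurable_fun setT f -> (forall g, 0 <= f g) ->
  \int[m']_g f g = \sum_(e | src e == x) (trans x e)%:E *
    \int[m (tgt e)]_g \int[exp_law R]_s f (cons_path x e (g, s)).

Lemma first_jump_steps n x : x \notin well ->
  first_jump (walk_law_steps n.+1 x) (walk_law_steps n) x.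
Proof.
move=> xw f mf f0; rewrite /= (negPf xw) ge0_integral_mfsum //.
apply: eq_bigr => e _; rewrite ge0_integral_mscale //; congr (_ * _).
rewrite ge0_integral_mpush // tonelli_finite //; first exact: walk_law_steps_fin.
exact: (measurableT_comp mf (measurable_cons_path x e)).
Qed.

Let measurable_jump x e (f : path -> \bar R) : measurable_fun setT f ->
  (forall g, 0 <= f g) ->
  measurable_fun setT (fun g : path => \int[exp_law R]_s f (cons_path x e (g, s))).
Proof.
move=> mf f0.
apply: (@measurable_fun_fubini_tonelli_F _ _ _ _ _ (exp_law R) (f \o cons_path x e)).
  exact: (measurableT_comp mf (measurable_cons_path x e)).
by move=> u; exact: f0.
Qed.

Lemma first_jump_walk x : x \notin well -> first_jump (walk_law x) walk_law x.
Proof.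
move=> xw f mf f0; rewrite ge0_integral_measure_series //.
rewrite (nneseries_split 0 1) => [|n _]; last exact: integral_ge0.
rewrite big_nat1 /= (negPf xw) integral_measure_zero add0e.
rewrite -(nneseries_addn 1); last by move=> n; exact: integral_ge0.
under eq_eseriesr do rewrite addn1 first_jump_steps //.
have i0 n e : 0 <= \int[walk_law_steps n (tgt e)]_g \int[exp_law R]_s f (cons_path x e (g, s)).
  by apply: integral_ge0 => g _; exact: integral_ge0.
rewrite nneseries_sum => [|e n _]; last by rewrite mule_ge0 ?lee_fin ?trans_ge0.
apply: eq_bigr => e _; rewrite nneseriesZl //; congr (_ * _).
rewrite ge0_integral_measure_series //; last exact: measurable_jump.
by move=> g _; exact: integral_ge0.
Qed.

Lemma walk_law_steps0 x : x \notin well -> walk_law_steps 0 x = mzero.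
Proof. by move=> xw; rewrite /= (negPf xw). Qed.

(** The walk restricted to the event that the well is entered in fewer than [n] jumps;
    the recursion on [n] lets a priori bounds be proved by induction. *)
Definition walk_law_upto n x : {measure set path -> \bar R} :=
  msum (fun j => walk_law_steps j x) n.

Lemma first_jump_upto n x : x \notin well ->
  first_jump (walk_law_upto n.+1 x) (walk_law_upto n) x.
Proof.
move=> xw f mf f0; rewrite ge0_integral_measure_sum //.
rewrite big_ord_recl walk_law_steps0 // integral_measure_zero add0e.
under eq_bigr do rewrite lift0 first_jump_steps //.
rewrite exchange_big /=; apply: eq_bigr => e _.
rewrite ge0_integral_measure_sum //; last exact: measurable_jump.
  rewrite ge0_sume_distrr // => i _; apply: integral_ge0 => g _.
  exact: integral_ge0.
by move=> g _; exact: integral_ge0.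
Qed.

Lemma first_jump_mass (m' : {measure set path -> \bar R}) m x : first_jump m' m x ->
  m' setT = \sum_(e | src e == x) (trans x e)%:E * m (tgt e) setT.
Proof.
move=> /(_ (cst 1)) E; move: E; rewrite integral_cst // mul1e => ->//.
apply: eq_bigr => e _; congr (_ * _).
transitivity (\int[m (tgt e)]_g (cst 1 : path -> \bar R) g).
  by apply: eq_integral => g _; exact: integral_exp_law1.
by rewrite integral_cst // mul1e.
Qed.

Lemma walk_law_steps_well n x : x \in well -> walk_law_steps n.+1 x = mzero.
Proof. by move=> xw; rewrite /= xw. Qed.

Lemma walk_law_upto_le1 n x : walk_law_upto n x setT <= 1.
Proof.
elim: n x => [|n IH] x; first by rewrite /walk_law_upto /= /msum big_ord0.
have [xw|xw] := boolP (x \in well).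
  rewrite /walk_law_upto /= /msum big_ord_recl big1 => [|i _].
    by rewrite adde0 walk_law_steps_le1.
  by rewrite lift0 walk_law_steps_well.
rewrite (first_jump_mass (first_jump_upto n xw)).
apply: (@le_trans _ _ (\sum_(e | src e == x) (trans x e)%:E)).
  apply: lee_sum => e _; rewrite -[leRHS]mule1; apply: lee_wpmul2l => //.
  by rewrite lee_fin trans_ge0.
by rewrite sumEFin sum_trans.
Qed.

Lemma walk_law_le1 x : walk_law x setT <= 1.
Proof.
apply: lime_le; first exact: is_cvg_nneseries.
by apply: nearW => n; rewrite big_mkord; exact: walk_law_upto_le1.
Qed.

Lemma walk_law_fin x : walk_law x setT < +oo.
Proof. by apply: le_lt_trans (walk_law_le1 x) _; rewrite ltry. Qed.

(** From the well, only the constant path is charged. *)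
Lemma walk_law_well x (f : path -> \bar R) : x \in well ->
  measurable_fun setT f -> (forall g, 0 <= f g) ->
  \int[walk_law x]_g f g = f (x, +oo, [::]).
Proof.
move=> xw mf f0; rewrite ge0_integral_measure_series //.
rewrite (nneseries_split 0 1) => [|n _]; last exact: integral_ge0.
rewrite big_nat1 /= xw eseries0 => [|[|n] // _ _]; last first.
  by rewrite walk_law_steps_well // integral_measure_zero.
by rewrite adde0 integral_dirac // diracT mul1e.
Qed.

(** The walk enters the well almost surely: the probability that it does not is
    harmonic and vanishes on the well. *)
Lemma walk_law_mass x : walk_law x setT = 1.
Proof.
pose p x := fine (walk_law x setT).
have pE y : walk_law y setT = (p y)%:E.
  by rewrite fineK // ge0_fin_numE // walk_law_fin.
have pw y : y \in well -> p y = 1%R.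
  move=> yw; have : \int[walk_law y]_g (cst 1 : path -> \bar R) g = 1.
    by rewrite (walk_law_well yw) // => g; rewrite lee_fin.
  by rewrite integral_cst // mul1e pE => -[].
have px y : y \notin well -> p y = (\sum_(e | src e == y) trans y e * p (tgt e))%R.
  move=> yw; have := first_jump_mass (first_jump_walk yw).
  by rewrite pE; under eq_bigr do rewrite pE -EFinM; rewrite sumEFin => -[].
have := @max_principle R G (fun y => 1 - p y)%R; have := walk_law_le1 x.
rewrite pE lee_fin => p1 /(_ _ _ x) q1.
congr EFin; apply/eqP; rewrite eq_le p1 -subr_le0 q1 // => y yw.
  by rewrite pw // subrr.
rewrite px //; under [leRHS]eq_bigr do rewrite mulrBr mulr1.
by rewrite sumrB sum_trans.
Qed.

Definition starts_off x : set path := [set g | g.1.1 != x].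

Lemma measurable_starts_off x : measurable (starts_off x).
Proof. exact: (measurable_skeleton [set q | q.1 != x]). Qed.

Lemma walk_law_steps_start n x : walk_law_steps n x (starts_off x) = 0.
Proof.
case: n => [|n] /=; case: ifP => xw //.
  transitivity ((((x, +oo%E, [::]) : path) \in starts_off x)%:R%:E : \bar R).
    exact: diracE.
  by rewrite memNset //= /starts_off /= eqxx.
rewrite /mfsum /=; apply: big1 => e _; rewrite /= /mscale /= [X in _ * X](_ : _ = 0) ?mule0 //.
transitivity ((walk_law_steps n (tgt e) \x exp_law R) set0); last exact: measure0.
apply: congr1; by apply/seteqP; split=> // -[g s] /=; rewrite /starts_off /= eqxx.
Qed.

Lemma walk_law_start x : walk_law x (starts_off x) = 0.
Proof.
rewrite /walk_law /= /mseries eseries0 // => n _ _.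
exact: walk_law_steps_start.
Qed.

Lemma walk_law_upto_start n x : walk_law_upto n x (starts_off x) = 0.
Proof. by rewrite /walk_law_upto /= /msum big1 // => i _; exact: walk_law_steps_start. Qed.

End Walk.

(** * Time integrals along the walk *)

Section FirstStep.
Local Open Scope ereal_scope.
Context {R : realType} {G : wgraph R}.
Local Notation leb := (@lebesgue_measure R).
Local Notation RR := (measurableTypeR R).
Local Notation path := (cpath G).
Implicit Types (x y : vertex G) (e : edge G) (m : vertex G -> {measure set path -> \bar R}).

Definition atom_path x (t : RR) : path := (x, t%:E, [::]).

Lemma measurable_atom_path x : measurable_fun setT (atom_path x).
Proof.
apply: measurable_cpathP => [p|[|k]].
- rewrite setTI; have [<-|xp] := pselect ((x, [::]) = p).
    by rewrite (_ : mkset _ = setT) //; apply/seteqP; split.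
  by rewrite (_ : mkset _ = set0) //; apply/seteqP; split.
- exact/measurable_EFinP.
- rewrite (_ : _ \o _ = cst 0) //.
  by apply/funext => u; rewrite /holding /= nth_nil.
Qed.

Definition stopped (u : path * RR) : path := cut_path (at_time u).

Definition occ_time y (f : path -> \bar R) (g : path) : \bar R :=
  \int[leb]_t (f (stopped (g, t)) * (\1_(occupation y) (g, t))%:E).

Lemma measurable_stopped_occ y (f : path -> \bar R) : measurable_fun setT f ->
  measurable_fun setT (fun u : path * RR => f (stopped u) * (\1_(occupation y) u)%:E).
Proof.
move=> mf; apply: emeasurable_funM.
  exact: (measurableT_comp mf measurable_restriction).
apply/measurable_EFinP; apply: measurable_indic; exact: measurable_occupation.
Qed.

Lemma stopped_occ_ge0 y (f : path -> \bar R) u : (forall g, 0 <= f g) ->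
  0 <= f (stopped u) * (\1_(occupation y) u)%:E.
Proof. by move=> f0; rewrite mule_ge0. Qed.

Lemma measurable_occ_time y (f : path -> \bar R) : measurable_fun setT f ->
  (forall g, 0 <= f g) -> measurable_fun setT (occ_time y f).
Proof.
move=> mf f0; apply: (@measurable_fun_fubini_tonelli_F _ _ _ _ _ leb
  (fun u : path * RR => f (stopped u) * (\1_(occupation y) u)%:E)).
  exact: measurable_stopped_occ.
by move=> u; exact: stopped_occ_ge0.
Qed.

Lemma occ_time_ge0 y (f : path -> \bar R) g : (forall g, 0 <= f g) -> 0 <= occ_time y f g.
Proof. by move=> f0; apply: integral_ge0 => t _; exact: stopped_occ_ge0. Qed.

(** The measure [nu2 x y] without its normalisation. *)
Definition green x y : {measure set path -> \bar R} :=
  mpush (mrestr (product_measure1 (walk_law x) leb) (measurable_occupation y))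
    measurable_restriction.

Lemma ge0_integral_green x y (f : path -> \bar R) :
  measurable_fun setT f -> (forall g, 0 <= f g) ->
  \int[green x y]_g f g = \int[walk_law x]_g occ_time y f g.
Proof.
move=> mf f0; rewrite ge0_integral_mpush // ge0_integral_mrestr //.
  rewrite tonelli_finite //; first exact: walk_law_fin.
  - exact: measurable_stopped_occ.
  - by move=> u; exact: stopped_occ_ge0.
exact: (measurableT_comp mf measurable_restriction).
Qed.

Lemma stopped_cons x e (g : path) (s t : R) : (s < t)%R ->
  stopped (cons_path x e (g, s), t) = cons_path x e (stopped (g, (t - s)%R), s).
Proof.
move=> st; rewrite /stopped /cut_path /at_time /cons_path /=.
rewrite lee_fin leNgt st /= -EFinB.
move: (t - s)%R g => {st}t [[y tau] l] /=.
by case: l => [|[e' tau'] l] /=; case: ifP => //= _; case: Defs.cut => [[? ?] ?].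
Qed.

Lemma stopped_cons_before x e (g : path) (s t : R) : (t <= s)%R ->
  stopped (cons_path x e (g, s), t) = atom_path x t.
Proof. by move=> ts; rewrite /stopped /cut_path /at_time /= lee_fin ts. Qed.

Lemma occupation_cons x y e (g : path) (s t : R) : (0 <= s < t)%R -> g.1.1 = tgt e ->
  ((cons_path x e (g, s), t) \in occupation y) = ((g, (t - s)%R) \in occupation y).
Proof.
case/andP=> s0 st ge.
have E : position_path (at_time (cons_path x e (g, s), t)) =
    position_path (at_time (g, (t - s)%R)).
  by rewrite /position_path /at_time /cons_path /= lte_fin ltNge ltW //= ge EFinB.
apply/idP/idP; rewrite !inE /occupation /= E => -[_ ->]; split=> //.
  by rewrite subr_gt0.
exact: le_lt_trans s0 st.
Qed.

Lemma occupation_cons_before x y e (g : path) (s t : R) : (t < s)%R ->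
  ((cons_path x e (g, s), t) \in occupation y) = (0 < t)%R && (x == y).
Proof.
move=> ts; have E : position_path (at_time (cons_path x e (g, s), t)) = Some x.
  by rewrite /position_path /at_time /cons_path /= lte_fin ts.
apply/idP/idP; rewrite inE /occupation /= E.
  by case=> -> [->]; rewrite eqxx.
by case/andP=> -> /eqP ->.
Qed.

Lemma occupation_le0 y (g : path) (t : R) : (t <= 0)%R ->
  ((g, t) \in occupation y) = false.
Proof.
by move=> t0; apply/negP; rewrite inE /occupation /= => -[]; rewrite ltNge t0.
Qed.

(** Before the first jump the stopped path is a single point held for the time [t];
    after it, the time [t] is shifted by the first holding time. The single
    time [t = s] is negligible. *)
Lemma occ_time_cons x y e (f : path -> \bar R) (g : path) (s : R) :
  measurable_fun setT f -> (forall g, 0 <= f g) -> (0 <= s)%R -> g.1.1 = tgt e ->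
  occ_time y f (cons_path x e (g, s)) =
  \int[leb]_t ((x == y)%:R%:E * f (atom_path x t) * (\1_`]0%R, s[%classic t)%:E) +
  occ_time y (fun g => f (cons_path x e (g, s))) g.
Proof.
move=> mf f0 s0 ge.
pose A (t : RR) := (x == y)%:R%:E * f (atom_path x t) * (\1_`]0%R, s[%classic t)%:E.
pose B (t : RR) := f (cons_path x e (stopped (g, t), s)) * (\1_(occupation y) (g, t))%:E.
have mA : measurable_fun setT A.
  apply: emeasurable_funM; last exact/measurable_EFinP.
  apply: emeasurable_funM => //.
  exact: (measurableT_comp mf (measurable_atom_path x)).
have mcons : measurable_fun setT (fun g : path => f (cons_path x e (g, s))).
  apply: (measurableT_comp mf).
  exact: (measurableT_comp (measurable_cons_path x e) (pair2_measurable s)).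
have mB : measurable_fun setT B.
  have := measurable_stopped_occ y mcons.
  by move=> /measurableT_comp/(_ (pair1_measurable g)).
have A0 t : 0 <= A t by rewrite !mule_ge0 // lee_fin ler0n.
have B0 t : 0 <= B t by rewrite mule_ge0.
have mBs : measurable_fun setT (fun t : RR => B (t + - s)%R).
  by apply: (measurableT_comp mB); exact: measurable_funD.
transitivity (\int[leb]_t (A t + B (t + - s)%R)); last first.
  rewrite ge0_integralD //; congr (_ + _).
  exact: ge0_integral_translation.
apply: (@ge0_eq_integral_off _ _ _ leb [set s]) => //.
- exact: lebesgue_measure_set1.
- have := measurable_stopped_occ y mf.
  by move=> /measurableT_comp/(_ (pair1_measurable (cons_path x e (g, s)))).
- exact: emeasurable_funD.
- by move=> t; rewrite mule_ge0.
- by move=> t; rewrite adde_ge0.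
move=> t /eqP ts; rewrite /A /B !indicE; have [{}ts|st] := ltP t s.
  rewrite (@occupation_le0 y g) ?subr_le0 1?ltW // mule0 adde0.
  rewrite stopped_cons_before ?ltW // occupation_cons_before //.
  rewrite (_ : (t \in `]0%R, s[%classic) = (0 < t)%R); last first.
    by apply/idP/idP; rewrite inE /= in_itv /= ts andbT.
  by case: eqP => _; rewrite ?andbT ?andbF ?mul1e ?mule0 ?mul0e.
have {}st : (s < t)%R by rewrite lt_def ts.
rewrite (_ : (t \in `]0%R, s[%classic) = false); last first.
  by apply/negP; rewrite inE /= in_itv /= => /andP[_]; rewrite ltNge ltW.
by rewrite mule0 add0e stopped_cons // occupation_cons // s0.
Qed.

(** The time spent before the first jump amounts to an exponential sample of
    [atom_path], by [exp_law_time]; after the jump, Tonelli's theorem moves the first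
    holding time inside the occupation integral of the remaining path. *)
Lemma occ_time_first_jump (m' : {measure set path -> \bar R}) m x y
    (f : path -> \bar R) : first_jump m' m x ->
  (forall e, m (tgt e) (starts_off (tgt e)) = 0) ->
  measurable_fun setT f -> (forall g, 0 <= f g) ->
  \int[m']_g occ_time y f g = \sum_(e | src e == x) (trans x e)%:E *
    ((x == y)%:R%:E * m (tgt e) setT * \int[exp_law R]_t f (atom_path x t) +
     \int[m (tgt e)]_g occ_time y (fun g => \int[exp_law R]_s f (cons_path x e (g, s))) g).
Proof.
move=> fj m0 mf f0; rewrite fj; last 2 first.
- exact: measurable_occ_time.
- by move=> g; exact: occ_time_ge0.
apply: eq_bigr => e _; congr (_ * _).
pose c := (x == y)%:R%:E * \int[exp_law R]_t f (atom_path x t).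
have c0 : 0 <= c.
  by rewrite mule_ge0 // ?lee_fin ?ler0n //; exact: integral_ge0.
pose fe (g : path) := \int[exp_law R]_s f (cons_path x e (g, s)).
have mfe : measurable_fun setT fe.
  apply: (@measurable_fun_fubini_tonelli_F _ _ _ _ _ (exp_law R) (f \o cons_path x e)).
    exact: (measurableT_comp mf (measurable_cons_path x e)).
  by move=> u; exact: f0.
have fe0 g : 0 <= fe g by exact: integral_ge0.
transitivity (\int[m (tgt e)]_g (c + occ_time y fe g)); last first.
  rewrite ge0_integralD //; last 2 first.
  - by move=> g _; exact: occ_time_ge0.
  - exact: measurable_occ_time.
  by rewrite integral_cst // muleAC.
apply: (@ge0_eq_integral_off _ _ _ (m (tgt e)) (starts_off (tgt e))) => //.
- exact: measurable_starts_off.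
- apply: (@measurable_fun_fubini_tonelli_F _ _ _ _ _ (exp_law R)
    (occ_time y f \o cons_path x e)).
    apply: (measurableT_comp _ (measurable_cons_path x e)).
    exact: measurable_occ_time.
  by move=> u; exact: occ_time_ge0.
- by apply: emeasurable_funD => //; exact: measurable_occ_time.
- by move=> g; apply: integral_ge0 => s _; exact: occ_time_ge0.
- by move=> g; rewrite adde_ge0 //; exact: occ_time_ge0.
move=> g /negP; rewrite negbK => /eqP ge.
pose fa (t : RR) := (x == y)%:R%:E * f (atom_path x t).
have mfat : measurable_fun setT (fun t : RR => f (atom_path x t)).
  exact: (measurableT_comp mf (measurable_atom_path x)).
have mfa : measurable_fun setT fa by exact: emeasurable_funM.
have fa0 t : 0 <= fa t by rewrite mule_ge0 // lee_fin ler0n.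
pose B (u : RR * RR) :=
  f (cons_path x e (stopped (g, u.2), u.1)) * (\1_(occupation y) (g, u.2))%:E.
have mB : measurable_fun setT B.
  have mg2 : measurable_fun setT (fun u : RR * RR => (g, u.2)).
    exact: (measurableT_comp (pair1_measurable g) measurable_snd).
  apply: emeasurable_funM.
    apply: (measurableT_comp mf); apply: (measurableT_comp (measurable_cons_path x e)).
    apply: measurable_fun_pair => //.
    exact: (measurableT_comp measurable_restriction).
  apply/measurable_EFinP; apply: (measurableT_comp _ mg2).
  apply: measurable_indic; exact: measurable_occupation.
have B0 u : 0 <= B u by rewrite mule_ge0.
have mtime := @measurable_fun_fubini_tonelli_F _ _ _ _ _ leb _ (measurable_before mfa)
  (fun u => mule_ge0 (fa0 u.2) (_ : 0 <= (\1_`]0%R, u.1[%classic u.2)%:E)).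
have {}mtime : measurable_fun setT
    (fun s : RR => \int[leb]_t (fa t * (\1_`]0%R, s[%classic t)%:E)).
  by apply: mtime.
have time0 s : 0 <= \int[leb]_t (fa t * (\1_`]0%R, s[%classic t)%:E).
  by apply: integral_ge0 => t _; rewrite mule_ge0.
have mBF : measurable_fun setT (fun s : RR => \int[leb]_t B (s, t)).
  exact: (@measurable_fun_fubini_tonelli_F _ _ _ _ _ leb B).
have BF0 s : 0 <= \int[leb]_t B (s, t) by apply: integral_ge0.
transitivity (\int[exp_law R]_s (\int[leb]_t (fa t * (\1_`]0%R, s[%classic t)%:E) +
    \int[leb]_t B (s, t))).
  apply: exp_law_eq.
  - apply: (measurableT_comp (measurable_occ_time y mf f0)).
    exact: (measurableT_comp (measurable_cons_path x e) (pair1_measurable g)).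
  - exact: emeasurable_funD.
  - by move=> s; exact: occ_time_ge0.
  - by move=> s; rewrite adde_ge0.
  - by move=> s s0; rewrite occ_time_cons // ltW.
rewrite ge0_integralD // exp_law_time //; congr (_ + _).
  by rewrite /c /fa ge0_integralZl // lee_fin ler0n.
rewrite (@fubini_tonelli _ _ _ _ _ (exp_law R) leb B) //.
apply: eq_integral => t _; rewrite /fubini_G /B /= /fe ge0_integralZr //.
apply: (measurableT_comp mf).
exact: (measurableT_comp (measurable_cons_path x e) (pair1_measurable _)).
Qed.

End FirstStep.

(** * The Green measure *)

Section Green.
Local Open Scope ereal_scope.
Context {R : realType} {G : wgraph R}.
Local Notation leb := (@lebesgue_measure R).
Local Notation RR := (measurableTypeR R).
Local Notation path := (cpath G).
Implicit Types (x y : vertex G) (e : edge G).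

Lemma occ_time_well x y (f : path -> \bar R) : x \in well -> y \notin well ->
  occ_time y f (x, +oo, [::]) = 0.
Proof.
move=> xw yw; apply: integral0_eq => t _; rewrite indicE memNset ?mule0 //.
case=> _; rewrite /position_path /= ltry => -[xy].
by rewrite -xy xw in yw.
Qed.

(** Each step of the walk spends one unit of mean time at its vertex, so the occupation
    time satisfies the recursion of [psi] with an inequality. *)
Lemma green_mass_upto n x y (psi : vertex G -> R) : y \notin well ->
  (forall x, 0 <= psi x)%R ->
  (forall x, x \notin well ->
     psi x = 1 + \sum_(e | src e == x) trans x e * psi (tgt e))%R ->
  \int[walk_law_upto n x]_g occ_time y (cst 1) g <= (psi x)%:E.
Proof.
move=> yw psi0 psiE; have occ0 g : 0 <= occ_time y (cst 1) g.
  by apply: occ_time_ge0 => ?; rewrite lee_fin.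
have mocc : measurable_fun setT (occ_time y (cst 1 : path -> \bar R)).
  by apply: measurable_occ_time => // ?; rewrite lee_fin.
elim: n x => [|n IH] x.
  by rewrite ge0_integral_measure_sum // big_ord0 lee_fin.
have [xw|xw] := boolP (x \in well).
  apply: (@le_trans _ _ (\int[walk_law x]_g occ_time y (cst 1) g)).
    rewrite ge0_integral_measure_sum // ge0_integral_measure_series //.
    rewrite -(big_mkord xpredT (fun i => \int[walk_law_steps i x]_g occ_time y (cst 1) g)).
    by apply: nneseries_lim_ge => i _ _; exact: integral_ge0.
  by rewrite walk_law_well // occ_time_well // lee_fin.
rewrite (occ_time_first_jump y (f := cst 1) (first_jump_upto n xw)) //; last first.
  by move=> e; exact: walk_law_upto_start.
rewrite psiE // -[X in (X + _)%R%:E](sum_trans xw) -big_split /= -sumEFin; apply: lee_sum => e _.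
rewrite EFinD EFinM -[X in _ <= X + _]mule1 -ge0_muleDr ?lee_fin //.
apply: lee_wpmul2l; first by rewrite lee_fin trans_ge0.
apply: leeD; last first.
  apply: le_trans (IH (tgt e)); rewrite le_eqVlt; apply/orP; left; apply/eqP.
  apply: eq_integral => g _; congr occ_time; apply/funext => g'.
  exact: integral_exp_law1.
rewrite [X in _ * X <= _]integral_exp_law1 mule1.
have m1 := walk_law_upto_le1 n (tgt e).
by case: eqP => _; rewrite ?mul1e ?mul0e ?lee_fin.
Qed.

(** Expected occupation times are finite: they are dominated by the expected
    hitting time of the well. *)
Lemma green_fin x y : y \notin well -> green x y setT < +oo.
Proof.
move=> yw; have [psi [psi0 psiE]] := @hitting_time_exists R G.
have occ0 g : 0 <= occ_time y (cst 1) g.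
  by apply: occ_time_ge0 => ?; rewrite lee_fin.
have mocc : measurable_fun setT (occ_time y (cst 1 : path -> \bar R)).
  by apply: measurable_occ_time => // ?; rewrite lee_fin.
have -> : green x y setT = \int[green x y]_g (cst 1 g).
  by rewrite integral_cst // mul1e.
rewrite ge0_integral_green //.
apply: (@le_lt_trans _ _ (psi x)%:E); last exact: ltry.
rewrite ge0_integral_measure_series //; apply: lime_le.
  by apply: is_cvg_nneseries => n _ _; exact: integral_ge0.
apply: nearW => n; rewrite big_mkord.
by have := green_mass_upto n x yw psi0 psiE; rewrite ge0_integral_measure_sum.
Qed.

(** The renewal equation: the mass of the walk after the first jump is 1, so the first
    term carries no weight. *)
Lemma green_first_step x y (f : path -> \bar R) : x \notin well ->
  measurable_fun setT f -> (forall g, 0 <= f g) ->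
  \int[green x y]_g f g = (x == y)%:R%:E * \int[exp_law R]_t f (atom_path x t) +
    \sum_(e | src e == x) (trans x e)%:E *
      \int[green (tgt e) y]_g \int[exp_law R]_s f (cons_path x e (g, s)).
Proof.
move=> xw mf f0; rewrite ge0_integral_green //.
rewrite (occ_time_first_jump _ (first_jump_walk xw)) //; last first.
  by move=> e; exact: walk_law_start.
have fe0 e g : 0 <= \int[exp_law R]_s f (cons_path x e (g, s)) by exact: integral_ge0.
under eq_bigr => e _.
  rewrite walk_law_mass mule1 -ge0_integral_green //; last first.
    apply: (@measurable_fun_fubini_tonelli_F _ _ _ _ _ (exp_law R) (f \o cons_path x e)).
      exact: (measurableT_comp mf (measurable_cons_path x e)).
    by move=> u; exact: f0.
  rewrite ge0_muleDr; last 2 first.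
  - by rewrite mule_ge0 // ?lee_fin ?ler0n //; exact: integral_ge0.
  - exact: integral_ge0.
  over.
rewrite big_split /=; congr (_ + _).
rewrite -ge0_sume_distrl; last by move=> e _; rewrite lee_fin trans_ge0.
by rewrite sumEFin sum_trans // mul1e.
Qed.

Lemma integral_green_well x y (f : path -> \bar R) : x \in well -> y \notin well ->
  measurable_fun setT f -> (forall g, 0 <= f g) -> \int[green x y]_g f g = 0.
Proof.
move=> xw yw mf f0; rewrite ge0_integral_green // walk_law_well //.
- exact: occ_time_well.
- exact: measurable_occ_time.
- by move=> g; exact: occ_time_ge0.
Qed.

Lemma stopped_vertex (g : path) (t : R) : (stopped (g, t)).1.1 = g.1.1.
Proof.
rewrite /stopped /cut_path /at_time /=; case: g => [[x tau] l] /=.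
by case: l => [|[e s] l] /=; case: ifP => //= _; case: Defs.cut => [[? ?] ?].
Qed.

Lemma green_start x y : green x y (starts_off x) = 0.
Proof.
have ms := measurable_starts_off x.
rewrite -[X in green x y X]setIT -integral_indic //.
rewrite ge0_integral_green //; last exact/measurable_EFinP.
rewrite (@ge0_eq_integral_off _ _ _ (walk_law x) (starts_off x) _ (cst 0)) //.
- by rewrite integral0.
- exact: walk_law_start.
- by apply: measurable_occ_time => //; exact/measurable_EFinP.
- by move=> g; exact: occ_time_ge0.
move=> g /negP; rewrite negbK => /eqP gx; apply: integral0_eq => t _.
by rewrite indicE memNset ?mul0e //= /starts_off /= stopped_vertex gx eqxx.
Qed.

End Green.

(** * Integrals of bounded functions and vectors *)

Section BoundedIntegrals.
Context d (T : measurableType d) (R : realType) (m : {measure set T -> \bar R}).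
Hypothesis mfin : (m setT < +oo)%E.

Lemma bounded_integrable (f : T -> R) C : measurable_fun setT f ->
  (forall t, `|f t| <= C) -> m.-integrable setT (EFin \o f).
Proof.
move=> mf fC; apply: measurable_bounded_integrable => //.
by exists C; split; rewrite ?num_real // => M CM t _; exact: le_trans (fC t) (ltW CM).
Qed.

Lemma Rintegral_posneg (f : T -> R) C : measurable_fun setT f ->
  (forall t, `|f t| <= C) ->
  \int[m]_t f t = \int[m]_t Num.max (f t) 0 - \int[m]_t Num.max (- f t) 0.
Proof.
move=> mf fC; rewrite -RintegralB //.
- apply: eq_Rintegral => t _; case: (leP 0 (f t)) => f0.
    by rewrite max_r ?oppr_le0 // subr0.
  by rewrite max_l ?oppr_ge0 ?ltW // sub0r opprK.
- apply: (bounded_integrable (C := C)); first exact: measurable_maxr.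
  move=> t; rewrite ger0_norm ?le_max ?lexx ?orbT // ge_max.
  by rewrite (le_trans (ler_norm _)) //= (le_trans (normr_ge0 (f t))).
- apply: (bounded_integrable (C := C)).
    by apply: measurable_maxr => //; exact: measurable_funN.
  move=> t; rewrite ger0_norm ?le_max ?lexx ?orbT // ge_max.
  by rewrite (le_trans (ler_norm _)) ?normrN //= (le_trans (normr_ge0 (f t))).
Qed.

End BoundedIntegrals.

Section Rint.
Context d (T : measurableType d) (R : realType) (m : {measure set T -> \bar R}).

Lemma Rintegral_sum (I : Type) (s : seq I) (f : I -> T -> R) :
  (forall i, m.-integrable setT (EFin \o f i)) ->
  \int[m]_t (\sum_(i <- s) f i t) = \sum_(i <- s) \int[m]_t f i t.
Proof.
move=> fi; elim: s => [|i s IH].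
  rewrite big_nil (_ : (fun _ => _) = cst 0); first by rewrite Rintegral_cst // mul0r.
  by apply/funext => t; rewrite big_nil.
rewrite big_cons -IH -RintegralD //.
  by apply: eq_Rintegral => t _; rewrite big_cons.
have := @integrable_sum _ _ _ m setT measurableT _ s xpredT (fun i => EFin \o f i).
move=> /(_ (fun i _ => fi i)); apply: eq_integrable => // t _.
by rewrite /= sumEFin.
Qed.

Lemma fine_integral_EFin (f : T -> R) : m.-integrable setT (EFin \o f) ->
  (\int[m]_t (f t)%:E = (\int[m]_t f t)%R%:E)%E.
Proof. by move=> fi; rewrite /Rintegral fineK // integrable_fin_num. Qed.

Context {k : kind} (U : vectType (kfield R k)).

Definition vintegrable (g : T -> U) := forall i, m.-integrable setT (EFin \o (vcoord i \o g)).

(** The integral is defined in one basis; this makes it usable in every other one. *)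
Lemma rform_vint (l : U -> R) (g : T -> U) : rform l -> vintegrable g ->
  l (vint m setT g) = \int[m]_t l (g t).
Proof.
move=> rl ig; rewrite (rform_coord _ rl).
transitivity (\int[m]_t (\sum_i l (vunit i) * vcoord i (g t))).
  rewrite Rintegral_sum => [|i].
    apply: eq_bigr => i _; rewrite of_vcoordK mulrC RintegralZl //.
    exact: ig.
  rewrite (_ : EFin \o _ = fun t => ((l (vunit i))%:E * (vcoord i (g t))%:E)%E) //.
  by apply: integrableZl => //; exact: ig.
apply: eq_Rintegral => t _; rewrite [in RHS](rform_coord _ rl).
by apply: eq_bigr => i _; rewrite mulrC.
Qed.

End Rint.

(** An identity between measures tested on nonnegative functions extends to
    bounded functions. *)
Lemma Rintegral_comb d (T : measurableType d) (R : realType) (I : finType)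
    (P : pred I) (c : I -> R) (ms : I -> {measure set T -> \bar R})
    (m : {measure set T -> \bar R}) (f : T -> R) C :
  (m setT < +oo)%E -> (forall i, P i -> (ms i setT < +oo)%E) ->
  (forall g : T -> \bar R, measurable_fun setT g -> (forall t, 0 <= g t)%E ->
    \int[m]_t g t = \sum_(i | P i) (c i)%:E * \int[ms i]_t g t)%E ->
  measurable_fun setT f -> (forall t, `|f t| <= C) ->
  \int[m]_t f t = \sum_(i | P i) c i * \int[ms i]_t f t.
Proof.
move=> mfin msfin mE mf fC.
have ge0 (g : T -> R) : measurable_fun setT g -> (forall t, 0 <= g t <= C) ->
    \int[m]_t g t = \sum_(i | P i) c i * \int[ms i]_t g t.
  move=> mg gC.
  have Ig (m' : {measure set T -> \bar R}) : (m' setT < +oo)%E ->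
      m'.-integrable setT (EFin \o g).
    move=> m'fin; apply: (bounded_integrable m'fin mg (C := C)) => t.
    by case/andP: (gC t) => g0 ?; rewrite ger0_norm.
  suff : ((\int[m]_t g t)%:E = (\sum_(i | P i) c i * \int[ms i]_t g t)%:E)%E by case.
  rewrite -fine_integral_EFin ?Ig // mE; last 2 first.
  - exact/measurable_EFinP.
  - by move=> t; rewrite lee_fin; case/andP: (gC t).
  rewrite -sumEFin; apply: eq_bigr => i Pi.
  by rewrite EFinM fine_integral_EFin // Ig // msfin.
have CE t : 0 <= Num.max (f t) 0 <= C /\ 0 <= Num.max (- f t) 0 <= C.
  rewrite !le_max lexx !orbT !ge_max (le_trans (normr_ge0 (f t))) //.
  by rewrite (le_trans (ler_norm (f t))) // (le_trans (ler_norm (- f t))) ?normrN.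
rewrite (Rintegral_posneg mfin mf fC) !ge0; first last.
- by move=> t; case: (CE t).
- exact: measurable_maxr.
- by move=> t; case: (CE t).
- by apply: measurable_maxr => //; exact: measurable_funN.
rewrite -sumrB; apply: eq_bigr => i Pi.
by rewrite -mulrBr -(Rintegral_posneg (msfin i Pi) mf fC).
Qed.

Section SeparatedFirstStep.
Context {R : realType} {G : wgraph R}.
Local Notation RR := (measurableTypeR R).
Local Notation path := (cpath G).
Variables (x z : vertex G).
Hypotheses (xw : x \notin well) (zw : z \notin well).
Variables (w : RR -> R) (W : R).
Hypotheses (mw : measurable_fun setT w) (w0 : forall t, 0 <= w t).
Hypothesis wW : (\int[exp_law R]_t (w t)%:E = W%:E)%E.

Let green_step_ge0 (f : path -> R) (fe : edge G -> path -> R) (c C : R) :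
  measurable_fun setT f -> (forall e, measurable_fun setT (fe e)) ->
  (forall g, 0 <= f g <= C) -> (forall e g, 0 <= fe e g <= C) -> 0 <= c ->
  (forall t, f (atom_path x t) = w t * c) ->
  (forall e g s, src e = x -> f (cons_path x e (g, s)) = w s * fe e g) ->
  \int[green x z]_g f g = W * ((x == z)%:R * c +
    \sum_(e | src e == x) trans x e * \int[green (tgt e) z]_g fe e g).
Proof.
move=> mf mfe fC feC c0 fatom fcons.
have If : (green x z).-integrable setT (EFin \o f).
  apply: (@bounded_integrable _ _ _ _ _ f C) => // [|g]; first exact: green_fin.
  by case/andP: (fC g) => f0 ?; rewrite ger0_norm.
have Ife e y : (green y z).-integrable setT (EFin \o fe e).
  apply: (@bounded_integrable _ _ _ _ _ (fe e) C) => // [|g]; first exact: green_fin.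
  by case/andP: (feC e g) => f0 ?; rewrite ger0_norm.
suff : ((\int[green x z]_g f g)%R%:E = (W * ((x == z)%:R * c +
    \sum_(e | src e == x) trans x e * \int[green (tgt e) z]_g fe e g))%R%:E)%E by case.
rewrite -fine_integral_EFin // green_first_step //; last 2 first.
- exact/measurable_EFinP.
- by move=> g; rewrite lee_fin; case/andP: (fC g).
have mwE : measurable_fun setT (EFin \o w) by exact/measurable_EFinP.
have w0E t : (0 <= (w t)%:E)%E by rewrite lee_fin.
rewrite mulrDr EFinD mulrCA mulr_sumr -sumEFin.
congr (_ + _)%E.
  rewrite EFinM EFinM; congr (_ * _)%E.
  under eq_integral do rewrite fatom EFinM.
  by rewrite ge0_integralZr // ?lee_fin // wW.
apply: eq_bigr => e /eqP ex; rewrite mulrCA EFinM EFinM; congr (_ * _)%E.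
transitivity (\int[green (tgt e) z]_g (W%:E * (fe e g)%:E))%E.
  apply: eq_integral => g _; rewrite -wW -ge0_integralZr //.
    by apply: eq_integral => s _; rewrite fcons // EFinM.
  by rewrite lee_fin; case/andP: (feC e g).
rewrite -(fine_integral_EFin (Ife _ _)).
by apply: integralZl => //; exact: Ife.
Qed.

(** First step analysis for an integrand that factors through the first holding time.
    The weight [w] being nonnegative, the positive and negative parts of the integrand
    factor in the same way. *)
Lemma green_step (f : path -> R) (fe : edge G -> path -> R) (c C : R) :
  measurable_fun setT f -> (forall e, measurable_fun setT (fe e)) ->
  (forall g, `|f g| <= C) -> (forall e g, `|fe e g| <= C) ->
  (forall t, f (atom_path x t) = w t * c) ->
  (forall e g s, src e = x -> f (cons_path x e (g, s)) = w s * fe e g) ->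
  \int[green x z]_g f g = W * ((x == z)%:R * c +
    \sum_(e | src e == x) trans x e * \int[green (tgt e) z]_g fe e g).
Proof.
move=> mf mfe fC feC fatom fcons.
pose p (a : R) := Num.max a 0; pose n (a : R) := Num.max (- a) 0.
have pn a : a = p a - n a.
  by rewrite /p /n; case: (leP 0 a) => a0; rewrite ?(max_l a0) ?(max_r (ltW a0));
    [rewrite max_r ?oppr_le0 // subr0|rewrite max_l ?oppr_ge0 ?ltW // opprK add0r].
have pC a : `|a| <= C -> 0 <= p a <= C.
  move=> aC; rewrite /p le_max lexx orbT ge_max (le_trans (ler_norm _) aC) /=.
  exact: le_trans aC.
have nC a : `|a| <= C -> 0 <= n a <= C.
  move=> aC; rewrite /n le_max lexx orbT ge_max /= (le_trans _ aC) /= ?(le_trans _ aC) //.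
  by rewrite -normrN ler_norm.
have pM a b : 0 <= a -> p (a * b) = a * p b.
  by move=> a0; rewrite /p maxr_pMr // mulr0.
have nM a b : 0 <= a -> n (a * b) = a * n b.
  by move=> a0; rewrite /n -mulrN maxr_pMr // mulr0.
have mp (h : path -> R) : measurable_fun setT h -> measurable_fun setT (p \o h).
  by move=> mh; apply: measurable_maxr.
have mn (h : path -> R) : measurable_fun setT h -> measurable_fun setT (n \o h).
  by move=> mh; apply: measurable_maxr => //; exact: measurable_funN.
have decomp (h : path -> R) y : measurable_fun setT h -> (forall g, `|h g| <= C) ->
    \int[green y z]_g h g = \int[green y z]_g (p (h g)) - \int[green y z]_g (n (h g)).
  by move=> mh hC; rewrite (Rintegral_posneg (green_fin y zw) mh hC).
rewrite decomp // (@green_step_ge0 (p \o f) (fun e => p \o fe e) (p c) C) //; last 7 first.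
- exact: mp.
- by move=> e; exact: mp.
- by move=> g; exact: pC.
- by move=> e g; exact: pC.
- by rewrite /p le_max lexx orbT.
- by move=> t; rewrite /= fatom pM.
- by move=> e g s ex; rewrite /= fcons // pM.
rewrite (@green_step_ge0 (n \o f) (fun e => n \o fe e) (n c) C) //; last 7 first.
- exact: mn.
- by move=> e; exact: mn.
- by move=> g; exact: nC.
- by move=> e g; exact: nC.
- by rewrite /n le_max lexx orbT.
- by move=> t; rewrite /= fatom nM.
- by move=> e g s ex; rewrite /= fcons // nM.
rewrite -mulrBr; congr (W * _); rewrite opprD addrACA -mulrBr -pn; congr (_ + _).
by rewrite -sumrB; apply: eq_bigr => e _; rewrite -mulrBr -decomp.
Qed.

End SeparatedFirstStep.

(** * Holonomy along the inverse of a path *)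

Section BackwardHolonomy.
Context {R : realType} {G : wgraph R} {k : kind} {r : nat} {F : bundle G k r}.
Variables (h : connection F) (H : potential F).
Hypothesis H_ge0 : pot_nonneg H.
Local Notation path := (cpath G).
Implicit Types (x y : vertex G) (e : edge G) (tau : \bar R).

(** The holonomy along the inverse of a path started at [x], computed by recursion
    on the path itself, and extended by 0 to data that are not paths from [x]. *)
Fixpoint bhol y (u : vfib F y) x tau (l : seq (edge G * \bar R)) : vfib F x :=
  if l is (e, sigma) :: l' then
    if [&& (0 < tau)%E, (tau < +oo)%E & src e == x] then
      hol_pot H tau (back h x e (bhol u (tgt e) sigma l'))
    else 0
  else if (0 < tau)%E then hol_pot H tau (fcast x u) else 0.

Let holonomy_after x x' (acc : seq (edge G * \bar R)) : vfib F x -> vfib F x' :=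
  match acc with
  | [::] => fun v => fcast x' v
  | (e, s) :: acc' => fun v =>
      fcast x' (@hol_rec _ _ _ _ F h H (tgt e) s acc' (hedge h e (fcast (src e) v)))
  end.

Let holonomy_after_hol x x' tau acc v :
  holonomy_after x' acc (hol_pot H tau v) = fcast x' (@hol_rec _ _ _ _ F h H x tau acc v).
Proof. by case: acc => [|[e s] acc]. Qed.

Let hol_rec_fcast x z x' tau acc (v : vfib F z) : z = x ->
  fcast x' (@hol_rec _ _ _ _ F h H z tau acc v) =
  fcast x' (@hol_rec _ _ _ _ F h H x tau acc (fcast x v)).
Proof. by move=> zx; case: _ / zx; rewrite fcast_id. Qed.

(** Path reversal works with an accumulator; for an arbitrary accumulator the holonomy
    of the reversed path is the backward holonomy followed by that of the accumulator,
    which an induction on the path can prove. *)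
Let hol_block_rev_path y (u : vfib F y) x' x tau l acc : is_contpath x tau l ->
  hol_block h H (Defs.rev_path x tau l acc) y x' u = holonomy_after x' acc (bhol u x tau l).
Proof.
elim: l x tau acc => [|[e sigma] l IH] x tau acc /=.
  by move=> ->; rewrite holonomy_after_hol.
case/and4P=> tau0 tauy /eqP ex pl; rewrite IH //= tau0 tauy ex eqxx /=.
rewrite holonomy_after_hol (hol_rec_fcast _ _ _ _ (_ : tgt (erev e) = x)) //.
by rewrite tgt_erev.
Qed.

Lemma hol_block_path_inv y (u : vfib F y) x (g : path) : contpath g ->
  hol_block h H (path_inv g) y x u = if g.1.1 == x then bhol u x g.1.2 g.2 else 0.
Proof.
case: g => [[x0 tau] l] /= pg; rewrite /path_inv /= hol_block_rev_path //=.
by case: eqP => [->|/eqP x0x]; rewrite ?fcast_id // fcast_neq.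
Qed.

Lemma bhol_contpath y (u : vfib F y) x tau l : ~~ is_contpath x tau l -> bhol u x tau l = 0.
Proof.
elim: l x tau => [|[e sigma] l IH] x tau /=; first by move/negPf => ->.
case: (0 < tau)%E => //=; case: (tau < +oo)%E => //=; case: (src e == x) => //= nl.
by rewrite IH // (rlinear0 (back_rlinear _ _ _)) (rlinear0 (hol_pot_rlinear H_ge0 _ _)).
Qed.

(** Transport is isometric and [exp (- tau H)] is a contraction since [H] is
    non-negative; all integrands are therefore bounded. *)
Lemma rip_bhol_le y (u : vfib F y) x tau l : rip (bhol u x tau l) (bhol u x tau l) <= rip u u.
Proof.
elim: l x tau => [|[e sigma] l IH] x tau /=; case: ifP => [|_]; rewrite ?rip0r ?rip_ge0 //.
  move=> tau0; apply: le_trans (hol_pot_contraction H_ge0 _ _) (rip_fcast_le _ _).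
  exact/fine_ge0/ltW.
case/and3P=> tau0 _ /eqP ex; apply: le_trans (hol_pot_contraction H_ge0 _ _) _.
  exact/fine_ge0/ltW.
by rewrite rip_back.
Qed.

(** The crude bound, linear in the squared norm, is enough for boundedness and spares a
    square root. *)
Lemma rform_bounded x (l : vfib F x -> R) : rform l ->
  exists2 C, 0 <= C & forall v, `|l v| <= C * (1 + rip v v).
Proof.
move=> rl; have [n [b [a eb]]] := pot_eigenbasis H_ge0 x.
exists (\sum_i `|l (b i)|); first by apply: sumr_ge0.
move=> v; case: (eb) => _ _ _ cb; rewrite {1}[v]cb (rform_sum _ _ _ rl) mulr_suml.
apply: le_trans (ler_norm_sum _ _ _) _; apply: ler_sum => i _.
rewrite rl.2 normrM mulrC ler_wpM2l //.
have : rip (b i) v ^+ 2 <= rip v v.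
  rewrite (rip_eigenbasis v eb) (bigD1 i) //= lerDl.
  by apply: sumr_ge0 => j _; rewrite sqr_ge0.
rewrite -real_normK ?num_real // => le1.
have := normr_ge0 (rip (b i) v); set t := `|_| in le1 *; move=> t0; nra.
Qed.

Lemma rform_bhol_bounded x (l : vfib F x -> R) y (u : vfib F y) : rform l ->
  exists C, forall tau s, `|l (bhol u x tau s)| <= C.
Proof.
case/rform_bounded => C C0 lC; exists (C * (1 + rip u u)) => tau s.
by apply: le_trans (lC _) _; rewrite ler_wpM2l // lerD2l rip_bhol_le.
Qed.

(** * Measurability of the backward holonomy *)

Lemma rform_hol_potE x n (b : 'I_n -> vfib F x) (a : 'I_n -> R) (l : vfib F x -> R) t v :
  eigenbasis (pot H x) b a -> rform l ->
  l (hol_pot H t v) = \sum_i expR (- fine t * a i) * (rip (b i) v * l (b i)).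
Proof.
move=> eb rl; rewrite (hol_potE _ _ eb) (rform_sum _ _ _ rl).
by apply: eq_bigr => i _; rewrite rl.2 mulrA.
Qed.

Let head_edge (g : path) := ohead (skeleton g).2.

Let measurable_expR_holding a :
  measurable_fun setT (fun g : path => expR (- fine (holding 0 g) * a)).
Proof.
apply: measurableT_comp => //; apply: measurable_funM => //.
apply: measurable_funN; apply: (measurableT_comp (fine_measurable measurableT)).
exact: measurable_holding.
Qed.

Let measurable_holding_pos : measurable_fun setT (fun g : path => (0 < holding 0 g)%E).
Proof. by apply: measurable_fun_lte => //; exact: measurable_holding. Qed.

Let measurable_skeleton_bool (q : pred (vertex G * seq (edge G))) :
  measurable_fun setT (fun g : path => q (skeleton g)).
Proof.
by apply: (measurable_fun_bool true); rewrite setTI; exact: (measurable_skeleton q).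
Qed.

(** On paths of given length, expanding every [exp (- tau H)] in an eigenbasis gives a
    finite sum of products of exponentials of the holding times. *)
Let measurable_bhol_size y (u : vfib F y) n x (l : vfib F x -> R) : rform l ->
  measurable_fun setT (fun g : path => if size g.2 == n then l (bhol u x g.1.2 g.2) else 0).
Proof.
elim: n x l => [|n IH] x l rl; have [m [b [a eb]]] := pot_eigenbasis H_ge0 x.
  rewrite (_ : (fun _ => _) = fun g : path => if (size (skeleton g).2 == 0%N) && (0 < holding 0 g)%E
      then \sum_i expR (- fine (holding 0 g) * a i) * (rip (b i) (fcast x u) * l (b i)) else 0).
    apply: measurable_fun_ifT => //.
      apply: measurable_and => //; exact: (measurable_skeleton_bool (fun q => size q.2 == 0%N)).
    by apply: measurable_sum => i; apply: measurable_funM.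
  apply/funext => -[[x0 t] [|[e s] s']] //=; rewrite /holding /=.
  by case: ifP => _; rewrite ?(rform0 rl) ?(rform_hol_potE _ _ eb).
rewrite (_ : (fun _ => _) = fun g : path => \sum_(e : edge G)
    if [&& head_edge g == Some e, src e == x, (0 < holding 0 g)%E & (holding 0 g < +oo)%E]
    then \sum_i expR (- fine (holding 0 g) * a i) *
       ((if size (tail_path g).2 == n then
          rip (b i) (back h x e (bhol u (tgt e) (tail_path g).1.2 (tail_path g).2)) else 0) *
          l (b i))
    else 0).
  apply: measurable_sum => e; apply: measurable_fun_ifT => //.
    apply: measurable_and.
      exact: (measurable_skeleton_bool (fun q => ohead q.2 == Some e)).
    apply: measurable_and; first exact: measurable_cst.
    apply: measurable_and => //; apply: measurable_fun_lte => //.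
    exact: measurable_holding.
  apply: measurable_sum => i; apply: measurable_funM => //.
  apply: measurable_funM => //.
  have := IH (tgt e) (rip (b i) \o back h x e).
  move=> /(_ (rform_comp (rip_rform _) (back_rlinear _ _ _))) mIH.
  exact: (measurableT_comp mIH measurable_tail_path).
apply/funext => -[[x0 t] [|[e s] s']] //=.
  by rewrite big1 // => e _; rewrite /head_edge /=.
rewrite (bigD1 e) //= [X in _ + X]big1 => [|e' e'e]; last first.
  by rewrite ifF //; apply/negP => /andP[/eqP[ee'] _]; rewrite ee' eqxx in e'e.
rewrite addr0 /head_edge /= eqxx /holding /= eqSS.
case: eqP => [_|_]; last first.
  by case: ifP => // _; rewrite big1 // => i _; rewrite mul0r mulr0.
rewrite [(src e == x) && _]andbC -andbA; case: ifP => _; last by rewrite (rform0 rl).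
by rewrite (rform_hol_potE _ _ eb).
Qed.

Lemma measurable_bhol y (u : vfib F y) x (l : vfib F x -> R) : rform l ->
  measurable_fun setT (fun g : path => l (bhol u x g.1.2 g.2)).
Proof.
move=> rl; pose D n := [set g : path | size g.2 = n].
have mD n : measurable (D n).
  have := measurable_skeleton [set q : vertex G * seq (edge G) | size q.2 = n].
  by congr measurable; apply/seteqP; split=> g; rewrite /D /= size_map.
rewrite (_ : [set: path] = \bigcup_n D n); last first.
  by apply/seteqP; split=> // g _; exists (size g.2).
apply/measurable_fun_bigcup => // n.
apply: (eq_measurable_fun (fun g : path => if size g.2 == n then l (bhol u x g.1.2 g.2) else 0)).
  by move=> g; rewrite inE /D /= => ->; rewrite eqxx.
by apply: measurable_funTS; exact: measurable_bhol_size.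
Qed.

Lemma vintegrable_bhol y (u : vfib F y) x x' z : z \notin well ->
  vintegrable (green x' z) (fun g : path => bhol u x g.1.2 g.2).
Proof.
move=> zw i; have [C uC] := rform_bhol_bounded u (vcoord_rform i).
apply: (@bounded_integrable _ _ _ _ _ _ C); first exact: green_fin.
  exact: (measurable_bhol u (vcoord_rform i)).
by move=> g; exact: uC.
Qed.

End BackwardHolonomy.

(** * The path integral inverts the Laplacian with potential *)

Section FeynmanKac.
Context {R : realType} {G : wgraph R} {k : kind} {r : nat} {F : bundle G k r}.
Variables (h : connection F) (H : potential F).
Hypothesis H_ge0 : pot_nonneg H.
Local Notation path := (cpath G).
Local Notation RR := (measurableTypeR R).
Implicit Types (x y z : vertex G) (e : edge G).

(** The Feynman-Kac kernel: the block from [y] to [x] of the integral of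
    [hol (gamma^-1)] over the paths [gamma] from [x] to [z], applied to [u]. *)
Definition fk z y (u : vfib F y) x : vfib F x :=
  vint (green x z) setT (fun g : path => bhol h H u x g.1.2 g.2).

Lemma rform_fk z y (u : vfib F y) x (l : vfib F x -> R) : z \notin well -> rform l ->
  l (fk z u x) = \int[green x z]_g l (bhol h H u x g.1.2 g.2).
Proof. by move=> zw rl; rewrite rform_vint //; exact: vintegrable_bhol. Qed.

(** A walk started in the well spends no time at a proper vertex. *)
Lemma fk_well z y (u : vfib F y) x : z \notin well -> x \in well -> fk z u x = 0.
Proof.
move=> zw xw; apply: vcoord_inj => i; rewrite (rform0 (vcoord_rform i)) of_vcoordK.
rewrite /Rintegral (eq_measure_integral mzero) ?integral_measure_zero //= => A mA _.
rewrite -[LHS]/(green x z A) -[A in LHS]setIT -integral_indic //.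
by rewrite integral_green_well //; exact/measurable_EFinP.
Qed.

Lemma eigenbasis_inj x n (b : 'I_n -> vfib F x) (a : 'I_n -> R) v w :
  eigenbasis (pot H x) b a -> (forall i, rip (b i) v = rip (b i) w) -> v = w.
Proof. by case=> _ _ _ cb vw; rewrite [v]cb [w]cb; apply: eq_bigr => i _; rewrite vw. Qed.

(** First step analysis, tested against an eigenvector of the potential: the holding
    time is exponential, so it contributes the Laplace transform of its law. *)
Lemma fk_step z y (u : vfib F y) x n (b : 'I_n -> vfib F x) (a : 'I_n -> R) i :
  z \notin well -> x \notin well -> eigenbasis (pot H x) b a ->
  (1 + a i) * rip (b i) (fk z u x) = (x == z)%:R * rip (b i) (fcast x u) +
    \sum_(e | src e == x) trans x e * rip (b i) (back h x e (fk z u (tgt e))).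
Proof.
move=> zw xw eb; have ai : 0 <= a i by case: (eb).
have rb e : rform (rip (b i) \o back h x e).
  exact: rform_comp (rip_rform _) (back_rlinear _ _ _).
have [C0 uC0] := rform_bhol_bounded h H_ge0 u (rip_rform (b i)).
have [C uC] : exists C, forall e tau s, `|rip (b i) (back h x e (bhol h H u (tgt e) tau s))| <= C.
  have /choice[C uC] e : exists C, forall tau s, `|(rip (b i) \o back h x e) (bhol h H u (tgt e) tau s)| <= C.
    exact: rform_bhol_bounded.
  exists (\sum_e `|C e|) => e tau s; apply: le_trans (uC e tau s) _.
  by rewrite (bigD1 e) //= (le_trans (ler_norm _)) // lerDl sumr_ge0.
pose w (t : RR) := if 0 < t then expR (- t * a i) else 0 : R.
have mexp : measurable_fun setT (fun t : RR => expR (- t * a i)).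
  by apply: measurableT_comp => //; apply: measurable_funM.
have mw : measurable_fun setT w.
  by apply: measurable_fun_ifT => //; exact: measurable_fun_ltr.
have w0 t : 0 <= w t by rewrite /w; case: ifP => // _; exact: expR_ge0.
have wW : (\int[exp_law R]_t (w t)%:E = ((1 + a i)^-1)%:E)%E.
  rewrite -(exp_law_laplace ai); apply: exp_law_eq.
  - exact/measurable_EFinP.
  - exact/measurable_EFinP.
  - by move=> t; rewrite lee_fin.
  - by move=> t; rewrite lee_fin expR_ge0.
  - by move=> t t0; rewrite /w t0.
have hw (t : R) (v : vfib F x) : rip (b i) (if (0 < t%:E)%E then hol_pot H t%:E v else 0) =
    w t * rip (b i) v.
  rewrite lte_fin /w; case: ifP => _; last by rewrite rip0r mul0r.
  by rewrite (rip_hol_pot _ _ _ eb).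
rewrite (rform_fk _ zw (rip_rform _)).
rewrite (green_step xw zw mw w0 wW (c := rip (b i) (fcast x u)) (C := Num.max C0 C)
  (fe := fun e g => rip (b i) (back h x e (bhol h H u (tgt e) g.1.2 g.2)))).
- rewrite mulrA divff ?mul1r; last by rewrite gt_eqF // ltr_wpDr.
  congr (_ + _); apply: eq_bigr => e _; congr (_ * _).
  by rewrite -[RHS]/((rip (b i) \o back h x e) _) rform_fk.
- exact: measurable_bhol (rip_rform _).
- by move=> e; exact: (measurable_bhol h H_ge0 u (rb e)).
- by move=> g; rewrite le_max uC0.
- by move=> e g; rewrite le_max uC orbT.
- by move=> t; rewrite /= hw.
- by move=> e g s ex; rewrite /= ltry ex eqxx !andbT hw.
Qed.

(** [fk_step] in all coordinates of an eigenbasis: as a function of its starting point,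
    the kernel is a fundamental solution of [Delta_h + H]. *)
Lemma fk_resolvent z y (u : vfib F y) x : z \notin well -> x \notin well ->
  fk z u x + pot H x (fk z u x) - \sum_(e | src e == x)
    kreal k (trans x e) *: back h x e (fk z u (tgt e)) =
  if x == z then fcast x u else 0.
Proof.
move=> zw xw; have [n [b [a eb]]] := pot_eigenbasis H_ge0 x.
apply: (eigenbasis_inj eb) => i; have := fk_step u i zw xw eb.
rewrite !ripDr ripNr [X in _ - X](rform_sum _ _ _ (rip_rform _)).
have -> : rip (b i) (pot H x (fk z u x)) = a i * rip (b i) (fk z u x).
  by rewrite {1}/rip -pot_sym -/(rip _ _); case: eb => _ _ -> _; rewrite ripZl.
under [X in _ - X]eq_bigr do rewrite ripZr.
rewrite mulrDl mul1r => ->; rewrite addrK.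
by case: eqP => _; rewrite ?mul1r ?mul0r ?rip0r.
Qed.

Definition lap_pot (f : gsection F) : gsection F :=
  add_section (laplacian h f) (pot_section H f).

Lemma laplacianE (f : gsection F) x : Omega0 f -> x \notin well ->
  laplacian h f x = f x - \sum_(e | src e == x) kreal k (trans x e) *: back h x e (f (tgt e)).
Proof.
move=> f0 xw; rewrite /laplacian (negPf xw); congr (_ - _); apply: eq_bigr => e _.
by case: ifP => // tw; rewrite f0 // (rlinear0 (back_rlinear _ _ _)).
Qed.

Lemma lap_potE (f : gsection F) x : Omega0 f -> x \notin well ->
  lap_pot f x = f x + pot H x (f x) -
    \sum_(e | src e == x) kreal k (trans x e) *: back h x e (f (tgt e)).
Proof.
by move=> f0 xw; rewrite /lap_pot /add_section laplacianE // /pot_section addrAC.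
Qed.

Definition green_op (g : gsection F) : gsection F :=
  fun x => \sum_(y | y \notin well) fk y (g y) x.

Lemma green_op_Omega0 g : Omega0 (green_op g).
Proof. by move=> x xw; apply: big1 => y yw; exact: fk_well. Qed.

(** Superposition of fundamental solutions. *)
Lemma lap_pot_green_op g x : x \notin well -> lap_pot (green_op g) x = g x.
Proof.
move=> xw; rewrite lap_potE //; last exact: green_op_Omega0.
rewrite /green_op linear_sum /= -big_split /=.
rewrite [X in _ - X](_ : _ = \sum_(y | y \notin well) \sum_(e | src e == x)
    kreal k (trans x e) *: back h x e (fk y (g y) (tgt e))); last first.
  rewrite [RHS]exchange_big; apply: eq_bigr => e _.
  by rewrite -[RHS]scaler_sumr (rlinear_sum _ _ _ (back_rlinear _ _ _)).
rewrite -sumrB (bigD1 x xw) /= [X in X + _](fk_resolvent (g x) xw xw) eqxx fcast_id.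
rewrite big1 ?addr0 // => y /andP[yw yx].
by apply: etrans (fk_resolvent (g y) yw xw) _; rewrite eq_sym (negPf yx).
Qed.

Lemma lap_pot_sym f g : Omega0 f -> Omega0 g ->
  rip_Omega0 f (lap_pot g) = rip_Omega0 g (lap_pot f).
Proof.
move=> f0 g0; have := laplacian_sym h f0 g0; rewrite !rip_Omega0E => E.
rewrite /lap_pot /add_section; under eq_bigr do rewrite ripDr mulrDr.
under [RHS]eq_bigr do rewrite ripDr mulrDr.
rewrite !big_split /= E; congr (_ + _); apply: eq_bigr => x _; congr (_ * _).
by rewrite /pot_section [RHS]/rip -pot_sym -/(rip _ _) ripC.
Qed.

Lemma rip_Omega0_eq0 (f : gsection F) : Omega0 f -> rip_Omega0 f f = 0 -> forall x, f x = 0.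
Proof.
move=> f0; rewrite rip_Omega0E => /eqP; rewrite psumr_eq0 => [/allP E x|x _]; last first.
  by rewrite mulr_ge0 ?lambda_ge0 ?rip_ge0.
have [xw|xw] := boolP (x \in well); first exact: f0.
have := E x (mem_index_enum x); rewrite /= mulf_eq0 gt_eqF ?lambda_gt0 //=.
by rewrite rip_eq0 => /eqP.
Qed.

(** A symmetric operator with a right inverse is injective. *)
Lemma lap_pot_inj f : Omega0 f -> (forall x, x \notin well -> lap_pot f x = 0) ->
  forall x, f x = 0.
Proof.
move=> f0 Lf; apply: rip_Omega0_eq0 => //.
transitivity (rip_Omega0 f (lap_pot (green_op f))).
  rewrite !rip_Omega0E; apply: eq_bigr => x _; have [xw|xw] := boolP (x \in well).
    by rewrite f0 // !rip0l.
  by rewrite lap_pot_green_op.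
rewrite lap_pot_sym //; last exact: green_op_Omega0.
rewrite rip_Omega0E big1 // => x _; have [xw|xw] := boolP (x \in well).
  by rewrite green_op_Omega0 // rip0l mulr0.
by rewrite Lf // rip0r mulr0.
Qed.

(** For [z != y] the resolvent equation is homogeneous. *)
Lemma fk_neq z y (u : vfib F y) x : z \notin well -> z != y -> fk z u x = 0.
Proof.
move=> zw zy; apply: (lap_pot_inj (f := fk z u)) => [{}x xw|{}x xw]; first exact: fk_well.
rewrite lap_potE //; last by move=> ? ?; exact: fk_well.
rewrite (fk_resolvent u zw xw); case: eqP => // xz; rewrite fcast_neq //.
by rewrite xz eq_sym.
Qed.

End FeynmanKac.

(** * Reflections preserve Lebesgue measure on tuples *)

Section LebesgueTuple.
Context {R : realType}.
Local Notation RR := (measurableTypeR R).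
Local Notation leb := (@lebesgue_measure R).

Definition reflect_tuple n (b c : n.-tuple RR) : n.-tuple RR :=
  [tuple tnth b i - tnth c i | i < n].

Lemma measurable_reflect_tuple n (b : n.-tuple RR) :
  measurable_fun setT (reflect_tuple b).
Proof.
apply/measurable_fun_tnthP => i.
rewrite (_ : _ \o _ = fun c => tnth b i - tnth c i); last first.
  by apply/funext => c; rewrite /= tnth_mktuple.
by apply: measurable_funB => //; exact: measurable_tnth.
Qed.

Lemma reflect_tuple_cons n (b : n.+1.-tuple RR) (t : RR) (c : n.-tuple RR) :
  reflect_tuple b [tuple of t :: c] =
  [tuple of (thead b - t) :: reflect_tuple [tuple of behead b] c].
Proof.
apply: eq_from_tnth => i; rewrite tnth_mktuple.
case: (unliftP ord0 i) => [j ->|->]; last by rewrite !tnth0.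
by rewrite !tnthS tnth_mktuple tnth_behead; congr (tnth b _ - _); apply/ord_inj;
  rewrite lift0 inordK // ltnS; exact: ltn_ord.
Qed.

Lemma lebesgue_tuple_reflect n (b : n.-tuple RR) (A : set (n.-tuple RR)) :
  measurable A -> lebesgue_tuple R n (reflect_tuple b @^-1` A) = lebesgue_tuple R n A.
Proof.
elim: n b A => [|n IH] b A mA.
  rewrite (_ : reflect_tuple b @^-1` A = A) //.
  apply/seteqP; split=> c; rewrite /preimage /= (tuple0 (reflect_tuple b c));
    by rewrite (tuple0 c).
have mcons := measurable_cons (@measurable_snd _ _ (n.-tuple RR) RR)
  (@measurable_fst _ _ (n.-tuple RR) (measurableTypeR R)).
pose B := (fun p : n.-tuple RR * RR => [tuple of p.2 :: p.1]) @^-1` A.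
have mB : measurable B by rewrite -[B]setTI; exact: mcons.
pose phi (c : n.-tuple RR) := leb (xsection B c).
have mphi : measurable_fun setT phi by exact: measurable_fun_xsection.
transitivity (\int[lebesgue_tuple R n]_c phi c)%E; last by [].
transitivity (\int[lebesgue_tuple R n]_c phi (reflect_tuple [tuple of behead b] c))%E.
  rewrite /= /mpush /pushforward /product_measure1.
  apply: eq_integral => c _; rewrite /phi /=.
  rewrite -[RHS](lebesgue_measureB (thead b)); last exact: measurable_xsection.
  congr (leb _); apply/seteqP; split=> t; rewrite /xsection /= !inE /B /=;
    by rewrite reflect_tuple_cons.
pose mr := measurable_reflect_tuple [tuple of behead b].
transitivity (\int[mpush (lebesgue_tuple R n) mr]_c phi c)%E.
  by rewrite ge0_integral_mpush.
by apply: eq_measure_integral => D mD _; exact: IH.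
Qed.

Lemma ge0_integral_reflect_tuple n (b : n.-tuple RR) (f : n.-tuple RR -> \bar R) :
  measurable_fun setT f -> (forall c, 0 <= f c)%E ->
  (\int[lebesgue_tuple R n]_c f (reflect_tuple b c) = \int[lebesgue_tuple R n]_c f c)%E.
Proof.
move=> mf f0.
transitivity (\int[mpush (lebesgue_tuple R n) (measurable_reflect_tuple b)]_c f c)%E.
  by rewrite ge0_integral_mpush.
by apply: eq_measure_integral => D mD _; exact: lebesgue_tuple_reflect.
Qed.

End LebesgueTuple.

(** * Coordinates and quadratic forms on sections *)

Lemma reflect_matchT (P : Prop) b (i : reflect P b) T (f : P -> T) z (p : P) :
  match i with ReflectT q => f q | ReflectF _ => z end = f p.
Proof. by case: i => [q|/(_ p)//]; rewrite (Prop_irrelevance q p). Qed.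

Lemma reflect_matchF (P : Prop) b (i : reflect P b) T (f : P -> T) z (p : ~ P) :
  match i with ReflectT q => f q | ReflectF _ => z end = z.
Proof. by case: i. Qed.

Section SectionCoordinates.
Context {R : realType} {G : wgraph R} {k : kind} {r : nat} {F : bundle G k r}.
Local Notation RR := (measurableTypeR R).
Local Notation N := #|sec_idx F|.
Local Notation S := (@of_sec_coord R G k r F).
Implicit Types (x y : vertex G) (c : N.-tuple RR).

Lemma of_sec_coord_Omega0 c : Omega0 (S c).
Proof. by move=> x xw; apply: reflect_matchF; rewrite xw. Qed.

(** Each real coordinate of the section is one of the entries of the tuple. *)
Lemma of_sec_coord_tnth x (i : vidx (vfib F x)) (xw : x \notin well) :
  {j : 'I_N | forall c, vcoord i (S c x) = tnth c j}.
Proof.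
exists (enum_rank (Tagged (fun z : {x : vertex G | x \notin well} => vidx (vfib F (val z)))
  (i : vidx (vfib F (val (exist _ x xw)))) : sec_idx F)) => c.
by rewrite /of_sec_coord (reflect_matchT _ _ _ xw) of_vcoordK.
Qed.

Lemma of_sec_coord_surj (f : gsection F) : Omega0 f -> exists c, forall x, S c x = f x.
Proof.
move=> f0; exists [tuple let s := enum_val j in
  vcoord (tagged s) (f (val (tag s))) | j < N] => x.
have [xw|xw] := boolP (x \in well); first by rewrite of_sec_coord_Omega0 // f0.
rewrite /of_sec_coord (reflect_matchT _ _ _ xw).
apply: vcoord_inj => i; rewrite of_vcoordK tnth_mktuple.
by rewrite enum_rankK.
Qed.

Lemma of_sec_coord_reflect (b c : N.-tuple RR) x :
  S (reflect_tuple b c) x = S b x - S c x.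
Proof.
have [xw|xw] := boolP (x \in well).
  by rewrite !of_sec_coord_Omega0 // subr0.
apply: vcoord_inj => i; have [j cj] := of_sec_coord_tnth i xw.
by rewrite (vcoord_rform i).1 (rformN _ (vcoord_rform i)) !cj tnth_mktuple.
Qed.

Lemma measurable_rform_coord x (l : vfib F x -> R) : rform l ->
  measurable_fun setT (fun c => l (S c x)).
Proof.
move=> rl; have [xw|xw] := boolP (x \in well).
  rewrite (_ : (fun _ => _) = cst 0) //; apply/funext => c.
  by rewrite of_sec_coord_Omega0 // (rform0 rl).
rewrite (_ : (fun _ => _) = fun c => \sum_i vcoord i (S c x) * l (vunit i)).
  apply: measurable_sum => i; apply: measurable_funM => //.
  have [j cj] := of_sec_coord_tnth i xw.
  rewrite (_ : (fun _ => _) = fun c => tnth c j); first exact: measurable_tnth.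
  exact/funext.
by apply/funext => c; rewrite (rform_coord _ rl).
Qed.

Lemma measurable_rip d (T : measurableType d) x (f g : T -> vfib F x) :
  (forall l : vfib F x -> R, rform l -> measurable_fun setT (l \o f)) ->
  (forall l : vfib F x -> R, rform l -> measurable_fun setT (l \o g)) ->
  measurable_fun setT (fun t => rip (f t) (g t)).
Proof.
move=> mf mg; rewrite (_ : (fun _ => _) =
    fun t => \sum_i vcoord i (f t) * rip (vunit i) (g t)).
  apply: measurable_sum => i; apply: measurable_funM.
    exact: mf (vcoord_rform i).
  exact: mg (rip_rform _).
apply/funext => t; rewrite ripC (rform_coord _ (rip_rform _)).
by apply: eq_bigr => i _; rewrite ripC.
Qed.

End SectionCoordinates.

Section QuadraticForms.
Context {R : realType} {G : wgraph R} {k : kind} {r : nat} {F : bundle G k r}.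
Variables (h : connection F) (H : potential F).
Implicit Types (x y : vertex G) (a b c : gsection F).

Definition opp_section a : gsection F := fun x => - a x.

Lemma add_Omega0 a b : Omega0 a -> Omega0 b -> Omega0 (add_section a b).
Proof. by move=> a0 b0 x xw; rewrite /add_section a0 // b0 // addr0. Qed.

Lemma opp_Omega0 a : Omega0 a -> Omega0 (opp_section a).
Proof. by move=> a0 x xw; rewrite /opp_section a0 // oppr0. Qed.

Definition dirichlet a b := rip_Omega0 a (laplacian h b).
Definition energy a b := rip_Omega0 a (pot_section H b).

Lemma eq_section a b : (forall x, a x = b x) -> a = b.
Proof. exact: functional_extensionality_dep. Qed.

Lemma laplacian_add a b x : Omega0 a -> Omega0 b ->
  laplacian h (add_section a b) x = laplacian h a x + laplacian h b x.
Proof.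
move=> a0 b0; have [xw|xw] := boolP (x \in well); first by rewrite /laplacian xw addr0.
rewrite !laplacianE //; last exact: add_Omega0.
rewrite addrACA -opprD -big_split /=; congr (_ - _); apply: eq_bigr => e _.
by rewrite -scalerDr (back_rlinear _ _ _).1.
Qed.

Lemma rip_Omega0Dl a b c : rip_Omega0 (add_section a b) c = rip_Omega0 a c + rip_Omega0 b c.
Proof.
by rewrite !rip_Omega0E -big_split; apply: eq_bigr => x _; rewrite ripDl mulrDr.
Qed.

Lemma dirichletC a b : Omega0 a -> Omega0 b -> dirichlet a b = dirichlet b a.
Proof. exact: laplacian_sym. Qed.

Lemma energyC a b : energy a b = energy b a.
Proof.
rewrite /energy !rip_Omega0E; apply: eq_bigr => x _; congr (_ * _).
by rewrite /pot_section [RHS]/rip -pot_sym -/(rip _ _) ripC.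
Qed.

Lemma dirichletD a b : Omega0 a -> Omega0 b ->
  dirichlet (add_section a b) (add_section a b) =
  dirichlet a a + 2 * dirichlet a b + dirichlet b b.
Proof.
move=> a0 b0; have D c : Omega0 c ->
    dirichlet c (add_section a b) = dirichlet c a + dirichlet c b.
  move=> c0; rewrite /dirichlet !rip_Omega0E -big_split; apply: eq_bigr => x _.
  by rewrite laplacian_add // ripDr mulrDr.
rewrite D; last exact: add_Omega0.
rewrite /dirichlet !rip_Omega0Dl -/(dirichlet b a) dirichletC // /dirichlet.
by ring.
Qed.

Lemma energyD a b : energy (add_section a b) (add_section a b) =
  energy a a + 2 * energy a b + energy b b.
Proof.
have D c : energy c (add_section a b) = energy c a + energy c b.
  rewrite /energy !rip_Omega0E -big_split; apply: eq_bigr => x _.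
  by rewrite /pot_section /add_section linearD ripDr mulrDr.
rewrite D /energy !rip_Omega0Dl -/(energy b a) energyC /energy.
by ring.
Qed.

Lemma laplacian_opp a x : Omega0 a -> laplacian h (opp_section a) x = - laplacian h a x.
Proof.
move=> a0; have [xw|xw] := boolP (x \in well); first by rewrite /laplacian xw oppr0.
rewrite !laplacianE //; last exact: opp_Omega0.
rewrite opprB addrC -sumrN; congr (_ + _); apply: eq_bigr => e _.
rewrite -scalerN; congr (_ *: _); have [_ bZ] := back_rlinear h x e.
have := bZ (- 1) (a (tgt e)); rewrite krealN kreal1 !scaleN1r => bN.
by rewrite /opp_section bN opprK.
Qed.

Lemma dirichletN a : Omega0 a ->
  dirichlet (opp_section a) (opp_section a) = dirichlet a a.
Proof.
move=> a0; rewrite /dirichlet !rip_Omega0E; apply: eq_bigr => x _.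
by rewrite laplacian_opp // ripNr ripNl opprK.
Qed.

Lemma energyN a : energy (opp_section a) (opp_section a) = energy a a.
Proof.
rewrite /energy !rip_Omega0E; apply: eq_bigr => x _.
by rewrite /pot_section /opp_section linearN ripNr ripNl opprK.
Qed.

Lemma energy_ge0 a : pot_nonneg H -> 0 <= energy a a.
Proof.
move=> H0; rewrite /energy rip_Omega0E; apply: sumr_ge0 => x _.
by rewrite mulr_ge0 ?lambda_ge0 // kRe_ge0.
Qed.

(** Completing the square: the total exponent has its critical point at [phi = M - f].
    The cross term pairs [chi] with [Delta_h (M - f) + H M], which is 0 by the choice of
    [M]. *)
Lemma exponent_centred f M phi chi : Omega0 f -> Omega0 M -> Omega0 phi ->
  (forall x, x \notin well -> lap_pot h H M x = laplacian h f x) ->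
  chi = add_section phi (add_section f (opp_section M)) ->
  dirichlet phi phi + energy (add_section phi f) (add_section phi f) =
  dirichlet chi chi + energy chi chi +
  (dirichlet (add_section M (opp_section f)) (add_section M (opp_section f)) + energy M M).
Proof.
move=> f0 M0 phi0 LM chiE; pose m := add_section M (opp_section f).
have m0 : Omega0 m by apply: add_Omega0 => //; exact: opp_Omega0.
have chi0 : Omega0 chi.
  by rewrite chiE; do 2![apply: add_Omega0 => //]; exact: opp_Omega0.
have -> : add_section phi f = add_section chi M.
  by apply: eq_section => x; rewrite chiE /add_section /opp_section addrA addrNK.
have -> : phi = add_section chi m.
  apply: eq_section => x; rewrite chiE /m /add_section /opp_section.
  by rewrite -[M x - f x]opprB addrK.
rewrite dirichletD // energyD -/m.
suff : dirichlet chi m + energy chi M = 0 by move=> E; lra.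
rewrite /dirichlet /energy !rip_Omega0E -big_split big1 //= => x _.
have [xw|xw] := boolP (x \in well); first by rewrite chi0 // !rip0l mulr0 addr0.
rewrite -mulrDr -ripDr laplacian_add //; last exact: opp_Omega0.
rewrite laplacian_opp // addrAC -/(add_section (laplacian h M) (pot_section H M) x).
by rewrite -/(lap_pot h H M) LM // subrr rip0r mulr0.
Qed.

End QuadraticForms.

Section Riesz.
Context {R : realType} {G : wgraph R} {k : kind} {r : nat} {F : bundle G k r}.
Variable (h : connection F).

Lemma zero_pot_sym x (u v : vfib F x) : ip ((0 : 'End(vfib F x)) u) v = ip u ((0 : 'End(vfib F x)) v).
Proof.
have ip0 (w : vfib F x) : ip w 0 = 0.
  by have := ip_linear (-1) w 0 0; rewrite scaler0 addr0 mulN1r addNr.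
rewrite !zero_lfunE ip0 ip_sym ip0.
by case: (k) => //=; rewrite /conjc oppr0.
Qed.

(** With a null potential, the spectral decomposition gives orthonormal bases of the
    fibres, and [green_op] inverts the Laplacian itself. *)
Definition zero_pot : potential F :=
  Potential (pot := fun x => 0) zero_pot_sym (fun x _ => erefl).

Lemma zero_pot_ge0 : pot_nonneg zero_pot.
Proof.
move=> x u; rewrite /= zero_lfunE.
by have := ip_linear (-1) u 0 0; rewrite scaler0 addr0 mulN1r addNr => ->.
Qed.

Lemma riesz_fibre x (l : vfib F x -> R) : rform l -> exists v, forall u, l u = rip u v.
Proof.
move=> rl; have [n [b [a [_ _ _ cb]]]] := pot_eigenbasis zero_pot_ge0 x.
exists (\sum_i kreal k (l (b i)) *: b i) => u.
rewrite (rform_sum _ _ _ (rip_rform u)) {1}[u]cb (rform_sum _ _ _ rl).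
by apply: eq_bigr => i _; rewrite rl.2 ripZr mulrC ripC.
Qed.

(** Every evaluation is represented by the Dirichlet form, the Laplacian being onto. *)
Lemma riesz_dirichlet x (l : vfib F x -> R) : x \notin well -> rform l ->
  exists2 m, Omega0 m & forall phi, Omega0 phi -> dirichlet h phi m = l (phi x).
Proof.
move=> xw rl; have [v lv] := riesz_fibre rl.
pose g : gsection F := fun y => fcast y (kreal k (lambda x)^-1 *: v).
exists (green_op h zero_pot g); first exact: green_op_Omega0.
move=> phi phi0; rewrite /dirichlet rip_Omega0E (bigD1 x) //= big1 => [|y yx].
  have := lap_pot_green_op h zero_pot_ge0 g xw.
  rewrite /lap_pot /add_section /pot_section /= zero_lfunE addr0 => ->.
  rewrite /g fcast_id ripZr mulrA divff ?mul1r ?addr0 ?lv //.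
  by rewrite gt_eqF // lambda_gt0.
have [yw|yw] := boolP (y \in well); first by rewrite phi0 // rip0l mulr0.
have := lap_pot_green_op h zero_pot_ge0 g yw.
rewrite /lap_pot /add_section /pot_section /= zero_lfunE addr0 => ->.
by rewrite /g fcast_neq ?rip0r ?mulr0 // eq_sym.
Qed.

End Riesz.

(** * The Gaussian field tilted by the potential *)

Lemma complete_square (R : realType) (z u a b : R) :
  expR u * (z * expR (- 2^-1 * a)) =
  expR (2^-1 * b) * (z * expR (- 2^-1 * (a + 2 * - u + b))).
Proof.
rewrite mulrCA [RHS]mulrCA -!expRD; congr (_ * expR _); by field.
Qed.

Lemma combine_exponents (R : realType) (z a b : R) :
  expR (- 2^-1 * b) * (z * expR (- 2^-1 * a)) = z * expR (- 2^-1 * (a + b)).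
Proof. by rewrite mulrCA -expRD; congr (_ * expR _); field. Qed.

Section GaussianTilt.
Context {R : realType} {G : wgraph R} {k : kind} {r : nat} {F : bundle G k r}.
Variables (h : connection F) (H : potential F).
Hypothesis H_ge0 : pot_nonneg H.
Local Notation RR := (measurableTypeR R).
Local Notation N := #|sec_idx F|.
Local Notation S := (@of_sec_coord R G k r F).
Local Notation L := (lebesgue_tuple R N).
Implicit Types (x y : vertex G) (c : N.-tuple RR).

Lemma gff_densityE (f : gsection F) : gff_density h f = expR (- 2^-1 * dirichlet h f f).
Proof. by []. Qed.

Lemma pot_weightE (f : gsection F) : pot_weight H f = expR (- 2^-1 * energy H f f).
Proof. by []. Qed.

Lemma pot_weight_gt0 (f : gsection F) : 0 < pot_weight H f.
Proof. exact: expR_gt0. Qed.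

Lemma pot_weight_le1 (f : gsection F) : pot_weight H f <= 1.
Proof.
by rewrite pot_weightE -expR0 ler_expR mulNr oppr_le0 mulr_ge0 ?invr_ge0 // energy_ge0.
Qed.

Lemma measurable_gff_density : measurable_fun setT (fun c => gff_density h (S c)).
Proof.
apply: measurableT_comp => //; apply: measurable_funM => //.
rewrite (_ : (fun _ => _) = fun c => \sum_x lambda x * rip (S c x) (S c x) -
    \sum_e chi e * rip (S c (src e)) (back h (src e) e (S c (tgt e)))); last first.
  by apply/funext => c; exact: (rip_laplacian h (of_sec_coord_Omega0 c) (of_sec_coord_Omega0 c)).
apply: measurable_funB.
  apply: measurable_sum => x; apply: measurable_funM => //.
  by apply: measurable_rip => l rl; exact: measurable_rform_coord.
apply: measurable_sum => e; apply: measurable_funM => //.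
apply: measurable_rip => l rl; first exact: measurable_rform_coord.
exact: (measurable_rform_coord (rform_comp rl (back_rlinear h _ e))).
Qed.

Lemma measurable_pot_weight (f : gsection F) :
  measurable_fun setT (fun c => pot_weight H (add_section (S c) f)).
Proof.
apply: measurableT_comp => //; apply: measurable_funM => //.
rewrite (_ : (fun _ => _) = fun c => \sum_x lambda x *
    rip (add_section (S c) f x) (pot H x (add_section (S c) f x))); last first.
  by apply/funext => c; exact: rip_Omega0E.
apply: measurable_sum => x; apply: measurable_funM => //.
have madd (l : vfib F x -> R) : rform l ->
    measurable_fun setT (fun c => l (add_section (S c) f x)).
  move=> rl; rewrite (_ : (fun _ => _) = fun c => l (S c x) + l (f x)).
    by apply: measurable_funD => //; exact: measurable_rform_coord.
  by apply/funext => c; rewrite /add_section rl.1.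
apply: measurable_rip => l rl; first exact: madd.
exact: (madd _ (rform_comp rl (hom_rlinear _))).
Qed.

Section Law.
Context d (T : measurableType d) (P : probability T R) (Phi : T -> gsection F).
Variables (X : {mfun T >-> N.-tuple RR}) (Z : R).
Hypotheses (PhiE : forall t, Phi t = S (X t)) (Z_gt0 : 0 < Z).
Hypothesis XE : forall A, measurable A -> distribution P X A =
  (\int[L]_(c in A) (Z^-1 * gff_density h (S c))%:E)%E.

Let dens c := Z^-1 * gff_density h (S c).

Let dens_ge0 c : 0 <= dens c.
Proof. by rewrite mulr_ge0 ?invr_ge0 ?expR_ge0 // ltW. Qed.

Let measurable_dens : measurable_fun setT dens.
Proof. by apply: measurable_funM => //; exact: measurable_gff_density. Qed.

Let measurable_X : measurable_fun setT X.
Proof. exact: measurable_funP. Qed.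

Lemma ge0_integral_gff (g : N.-tuple RR -> \bar R) : measurable_fun setT g ->
  (forall c, 0 <= g c)%E ->
  (\int[P]_t g (X t) = \int[L]_c (g c * (dens c)%:E))%E.
Proof.
move=> mg g0; transitivity (\int[mpush P measurable_X]_c g c)%E.
  by rewrite ge0_integral_mpush.
exact: ge0_integral_density.
Qed.

Lemma integral_dens : (\int[L]_c (dens c)%:E = 1)%E.
Proof.
transitivity (\int[P]_t (cst 1 : N.-tuple RR -> \bar R) (X t))%E.
  rewrite ge0_integral_gff //.
  by apply: eq_integral => c _; rewrite mul1e.
by rewrite /= integral_cst // mul1e; exact: probability_setT.
Qed.

(** If the Dirichlet form represents [l] by [m], the reflection [phi |-> m - phi] turns
    the density multiplied by [exp l] into a multiple of the density. The moment is thus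
    finite without evaluating any Gaussian integral. *)
Lemma gff_exp_moment x (l : vfib F x -> R) : x \notin well -> rform l ->
  (\int[P]_t (expR (l (Phi t x)))%:E < +oo)%E.
Proof.
move=> xw rl; have [m m0 lm] := riesz_dirichlet h xw rl.
have [b bm] := of_sec_coord_surj m0.
have ml : measurable_fun setT (fun c => (expR (l (S c x)))%:E).
  by apply/measurable_EFinP/measurableT_comp => //; exact: measurable_rform_coord.
have E c : expR (l (S c x)) * dens c =
    expR (2^-1 * dirichlet h m m) * dens (reflect_tuple b c).
  have c0 := of_sec_coord_Omega0 c.
  have Sb : S (reflect_tuple b c) = add_section (opp_section (S c)) m.
    by apply: eq_section => y; rewrite of_sec_coord_reflect bm /add_section addrC.
  have DN : dirichlet h (opp_section (S c)) m = - l (S c x).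
    rewrite -(lm _ c0) /dirichlet !rip_Omega0E -sumrN; apply: eq_bigr => y _.
    by rewrite ripNl mulrN.
  have DE : dirichlet h (S (reflect_tuple b c)) (S (reflect_tuple b c)) =
      dirichlet h (S c) (S c) + 2 * - l (S c x) + dirichlet h m m.
    by rewrite Sb dirichletD ?dirichletN ?DN //; exact: opp_Omega0.
  rewrite /dens !gff_densityE DE; exact: complete_square.
under eq_integral do rewrite PhiE.
rewrite (ge0_integral_gff ml) => [|c]; last by rewrite lee_fin expR_ge0.
under eq_integral do rewrite -EFinM E EFinM.
rewrite ge0_integralZl_EFin ?expR_ge0 //.
- rewrite (ge0_integral_reflect_tuple b (f := fun c => (dens c)%:E)).
  + by rewrite integral_dens mule1 ltry.
  + exact/measurable_EFinP.
  + by move=> c; rewrite lee_fin.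
- by move=> c _; rewrite lee_fin.
- apply/measurable_EFinP; apply: (measurableT_comp measurable_dens).
  exact: measurable_reflect_tuple.
Qed.

Lemma measurable_rform_Phi x (l : vfib F x -> R) : rform l ->
  measurable_fun setT (fun t => l (Phi t x)).
Proof.
move=> rl; rewrite (_ : (fun _ => _) = (fun c => l (S c x)) \o X).
  by apply: measurableT_comp => //; exact: measurable_rform_coord.
by apply/funext => t; rewrite /= PhiE.
Qed.

Lemma integrable_rform_Phi x (l : vfib F x -> R) : rform l ->
  P.-integrable setT (fun t => (l (Phi t x))%:E).
Proof.
move=> rl; have mlP := measurable_rform_Phi rl.
have [xw|xw] := boolP (x \in well).
  apply: (eq_integrable measurableT (cst 0%E)) => [t _|]; last exact: integrable0.
  by rewrite PhiE of_sec_coord_Omega0 // (rform0 rl).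
have rN : rform (fun u => - l u).
  by split=> *; rewrite ?rl.1 ?rl.2 ?opprD ?mulrN.
have mE (l' : vfib F x -> R) : rform l' -> measurable_fun setT (fun t => (expR (l' (Phi t x)))%:E).
  by move=> rl'; apply/measurable_EFinP/measurableT_comp => //; exact: measurable_rform_Phi.
apply/integrableP; split; first exact/measurable_EFinP.
apply: (@le_lt_trans _ _ (\int[P]_t ((expR (l (Phi t x)))%:E + (expR (- l (Phi t x)))%:E))%E).
  apply: ge0_le_integral => //.
  - by apply/measurable_EFinP/measurableT_comp.
  - by apply: emeasurable_funD; [exact: mE|exact: (mE _ rN)].
  move=> t _; rewrite /= -EFinD lee_fin; set u := l _.
  (* |u| <= exp u + exp (- u) *)
  have e1 := expR_ge1Dx u; have e2 := expR_ge1Dx (- u).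
  have := expR_ge0 u; have := expR_ge0 (- u).
  by rewrite ler_norml => *; lra.
rewrite ge0_integralD //.
- by rewrite lte_add_pinfty //; [exact: gff_exp_moment|exact: (gff_exp_moment xw rN)].
- exact: mE.
- exact: (mE _ rN).
Qed.

Variables (f M : gsection F).
Hypotheses (f0 : Omega0 f) (M0 : Omega0 M).
Hypothesis LM : forall x, x \notin well -> lap_pot h H M x = laplacian h f x.

Let w t := pot_weight H (add_section (Phi t) f).

Let measurable_w : measurable_fun setT w.
Proof.
rewrite (_ : w = (fun c => pot_weight H (add_section (S c) f)) \o X).
  by apply: measurableT_comp => //; exact: measurable_pot_weight.
by apply/funext => t; rewrite /w /= PhiE.
Qed.

Let w_bounded t : `|w t| <= 1.
Proof. by rewrite ger0_norm ?pot_weight_le1 // ltW // pot_weight_gt0. Qed.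

Lemma integrable_weight : P.-integrable setT (EFin \o w).
Proof.
have Pfin : (P setT < +oo)%E by rewrite probability_setT ltry.
exact: (bounded_integrable Pfin measurable_w w_bounded).
Qed.

Lemma expectation_weight_gt0 : 0 < \int[P]_t w t.
Proof.
rewrite lt_def Rintegral_ge0 ?andbT; last by move=> t _; rewrite ltW // pot_weight_gt0.
apply/eqP => w0.
have : (\int[P]_t `|(w t)%:E| = 0)%E.
  have := fine_integral_EFin integrable_weight; rewrite w0 => w0E; apply: etrans w0E.
  by apply: eq_integral => t _; rewrite gee0_abs // lee_fin ltW // pot_weight_gt0.
move/ae_eq_integral_abs => /(_ measurableT) /=.
case; first by apply/measurable_EFinP.
move=> N [mN N0 sub]; have := probability_setT P.
rewrite (_ : setT = N) ?N0 => [/eqP|]; first by rewrite eq_sym onee_eq0.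
apply/seteqP; split=> // t _; apply: sub => /= /(_ Logic.I) [wt].
by have := pot_weight_gt0 (add_section (Phi t) f); rewrite -/(w t) wt ltxx.
Qed.

(** The change of variable [phi |-> 2 (M - f) - phi] exchanges the positive and
    negative parts of every linear form of [phi + f - M]. *)
Lemma tilted_symmetric x (l : vfib F x -> R) : rform l ->
  (\int[P]_t (w t * Num.max (l (Phi t x + f x - M x)) 0)%:E =
   \int[P]_t (w t * Num.max (- l (Phi t x + f x - M x)) 0)%:E)%E.
Proof.
move=> rl; pose m := add_section M (opp_section f).
have m0 : Omega0 m by apply: add_Omega0 => //; exact: opp_Omega0.
have [b bm] := of_sec_coord_surj (add_Omega0 m0 m0).
pose chi c : gsection F := add_section (S c) (add_section f (opp_section M)).
have chi_reflect c : chi (reflect_tuple b c) = opp_section (chi c).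
  apply: eq_section => y; rewrite /chi /add_section /opp_section of_sec_coord_reflect bm.
  rewrite /m /add_section /opp_section.
  rewrite -[f y - M y]opprB; move: (M y - f y) (S c y) => a s.
  by rewrite opprB addrAC addrK.
pose W c := pot_weight H (add_section (S c) f) * dens c.
have W_reflect c : W (reflect_tuple b c) = W c.
  have WE c' : W c' = Z^-1 * expR (- 2^-1 * (dirichlet h (S c') (S c') +
      energy H (add_section (S c') f) (add_section (S c') f))).
    by rewrite /W /dens pot_weightE gff_densityE combine_exponents.
  have E c' := exponent_centred f0 M0 (of_sec_coord_Omega0 c') LM (erefl (chi c')).
  rewrite !WE !E chi_reflect energyN dirichletN //.
  apply: add_Omega0; first exact: of_sec_coord_Omega0.
  by apply: add_Omega0 => //; exact: opp_Omega0.
have mchi (s : R) : measurable_fun setT (fun c => Num.max (s * l (chi c x)) 0).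
  apply: measurable_maxr => //; apply: measurable_funM => //.
  rewrite (_ : (fun _ => _) = fun c => l (S c x) + l (f x - M x)).
    by apply: measurable_funD => //; exact: measurable_rform_coord.
  by apply/funext => c; rewrite /chi /add_section /opp_section rl.1.
have part (s : R) : (\int[P]_t (w t * Num.max (s * l (Phi t x + f x - M x)) 0)%:E =
    \int[L]_c (Num.max (s * l (chi c x)) 0 * W c)%:E)%E.
  pose g c := (pot_weight H (add_section (S c) f) * Num.max (s * l (chi c x)) 0)%:E.
  transitivity (\int[P]_t g (X t))%E.
    apply: eq_integral => t _; rewrite /g /w PhiE /chi /add_section /opp_section.
    by rewrite addrA.
  rewrite (@ge0_integral_gff g).
  - by apply: eq_integral => c _; rewrite -EFinM; congr EFin; rewrite /W mulrAC mulrC.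
  - apply/measurable_EFinP/measurable_funM => //; exact: measurable_pot_weight.
  - by move=> c; rewrite lee_fin mulr_ge0 ?le_max ?lexx ?orbT // ltW // pot_weight_gt0.
transitivity (\int[P]_t (w t * Num.max (1 * l (Phi t x + f x - M x)) 0)%:E)%E.
  by apply: eq_integral => t _; rewrite mul1r.
transitivity (\int[P]_t (w t * Num.max (- 1 * l (Phi t x + f x - M x)) 0)%:E)%E; last first.
  by apply: eq_integral => t _; rewrite mulN1r.
have mW : measurable_fun setT W.
  by apply: measurable_funM => //; exact: measurable_pot_weight.
rewrite !part -(ge0_integral_reflect_tuple b
  (f := fun c => (Num.max (1 * l (chi c x)) 0 * W c)%:E)); last 2 first.
- by apply/measurable_EFinP; exact: measurable_funM.
- move=> c; rewrite lee_fin mulr_ge0 ?le_max ?lexx ?orbT // mulr_ge0 //.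
  by rewrite ltW // pot_weight_gt0.
- apply: eq_integral => c _; rewrite W_reflect chi_reflect /opp_section (rformN _ rl).
  by rewrite mul1r mulN1r.
Qed.

Lemma integrable_tilted x (l : vfib F x -> R) : rform l ->
  P.-integrable setT (fun t => (w t * l (Phi t x))%:E).
Proof.
move=> rl; apply: (le_integrable measurableT _ _ (integrable_rform_Phi rl)).
  by apply/measurable_EFinP/measurable_funM => //; exact: measurable_rform_Phi.
move=> t _; rewrite /= lee_fin normrM ler_piMl //.
Qed.

(** [phi + f - M] is centred for the tilted law; [l] being arbitrary, [M] is the tilted
    mean of [phi + f]. *)
Lemma tilted_mean x (l : vfib F x -> R) : rform l ->
  \int[P]_t (w t * l (Phi t x + f x)) = l (M x) * \int[P]_t w t.
Proof.
move=> rl.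
have Iw := integrable_weight.
have Iwl := integrable_tilted rl.
have IwC (C : R) : P.-integrable setT (fun t => (C * w t)%:E).
  by under eq_fun do rewrite EFinM; exact: integrableZl.
have Ichi : P.-integrable setT (fun t => (w t * l (Phi t x + f x - M x))%:E).
  have := integrableD measurableT Iwl (IwC (l (f x - M x))).
  apply: eq_integrable => // t _; rewrite /= -EFinD; congr EFin.
  by rewrite -addrA [l (Phi t x + _)]rl.1 mulrDr [w t * l (_ - _)]mulrC.
have zero : \int[P]_t (w t * l (Phi t x + f x - M x)) = 0.
  pose u t := l (Phi t x + f x - M x).
  have Ipart (s : R) : `|s| = 1 -> P.-integrable setT (fun t => (w t * Num.max (s * u t) 0)%:E).
    move=> s1; have /measurable_int/measurable_EFinP := Ichi; rewrite -/(u _) => mwu.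
    have wu t : w t * Num.max (s * u t) 0 = Num.max (s * (w t * u t)) 0.
      by rewrite [s * (w t * _)]mulrCA maxr_pMr ?mulr0 // ltW // pot_weight_gt0.
    apply: (le_integrable measurableT _ _ Ichi).
      apply/measurable_EFinP; under eq_fun do rewrite wu.
      by apply: measurable_maxr => //; exact: measurable_funM.
    move=> t _; rewrite /= lee_fin wu -/(u t).
    rewrite ger0_norm ?le_max ?lexx ?orbT // ge_max normr_ge0 andbT.
    by rewrite (le_trans (ler_norm _)) // normrM s1 mul1r.
  have I1 := Ipart 1 (normr1 R); have IN := Ipart (- 1) (normrN1 R).
  transitivity (\int[P]_t (w t * Num.max (1 * u t) 0) - \int[P]_t (w t * Num.max (- 1 * u t) 0)).
    rewrite -(RintegralB measurableT I1 IN); apply: eq_Rintegral => t _.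
    rewrite -mulrBr mul1r mulN1r -/(u t); congr (_ * _).
    have [u0|u0] := leP 0 (u t).
      by rewrite max_r ?subr0 ?oppr_le0.
    by rewrite max_l ?sub0r ?opprK // oppr_ge0 ltW.
  apply/eqP; rewrite subr_eq0; apply/eqP; congr fine.
  under eq_integral do rewrite mul1r.
  under [RHS]eq_integral do rewrite mulN1r.
  exact: tilted_symmetric.
transitivity (\int[P]_t (w t * l (Phi t x + f x - M x)) + \int[P]_t (l (M x) * w t)).
  rewrite -(RintegralD measurableT Ichi (IwC _)); apply: eq_Rintegral => t _.
  rewrite -{1}[Phi t x + f x](subrK (M x)).
  by rewrite [l (_ - _ + _)]rl.1 mulrDr [l (M x) * _]mulrC.
by rewrite zero add0r RintegralZl.
Qed.

End Law.
End GaussianTilt.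

(** * Integrating the holonomy against the path measures *)

Lemma Rintegral_prod d d' (T : measurableType d) (T' : measurableType d') (R : realType)
    (P : probability T R) (m : {measure set T' -> \bar R}) (w : T -> R) (phi : T' -> R) A B :
  (m setT < +oo)%E -> measurable_fun setT w -> measurable_fun setT phi ->
  (forall t, `|w t| <= A) -> (forall g, `|phi g| <= B) ->
  \int[(P \x^ m)%E]_z (w z.1 * phi z.2) = \int[P]_t w t * \int[m]_g phi g.
Proof.
move=> mfin mw mphi wA phiB.
pose m' := (fin_mass mfin : {finite_measure set T' -> \bar R}).
have Pfin : (P setT < +oo)%E by rewrite probability_setT ltry.
have Iw := bounded_integrable Pfin mw wA.
have Iphi := bounded_integrable mfin mphi phiB.
have prodfin : ((P \x m')%E setT < +oo)%E.
  rewrite -setXTT product_measure1E // lte_mul_pinfty ?fin_num_measure //.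
have mf : measurable_fun setT (fun z : T * T' => w z.1 * phi z.2).
  by apply: measurable_funM; apply: measurableT_comp.
have fAB z : `|w z.1 * phi z.2| <= A * B by rewrite normrM ler_pM.
have If := bounded_integrable prodfin mf fAB.
have EE : (\int[(P \x^ m)%E]_z (w z.1 * phi z.2)%:E =
    (\int[P]_t w t * \int[m]_g phi g)%R%:E)%E.
  apply: etrans (esym (integral12_prod_meas2 If)) _.
  transitivity (\int[P]_t ((\int[m]_g phi g)%R%:E * (w t)%:E))%E.
    apply: eq_integral => t _; rewrite /fubini_F /= muleC.
    rewrite -(fine_integral_EFin Iphi) -integralZl //.
  by rewrite integralZl // (fine_integral_EFin Iw) -EFinM mulrC.
by rewrite /Rintegral EE.
Qed.

Section OccupationMeasures.
Context {R : realType} {G : wgraph R}.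
Local Notation path := (cpath G).
Implicit Types (x y z : vertex G).

Lemma measurable_starts_at x : measurable_fun setT (fun g : path => g.1.1 == x).
Proof.
apply: (measurable_fun_bool true); rewrite setTI.
exact: (measurable_skeleton [set q | q.1 == x]).
Qed.

(** The measure [green x' z] charges only paths issued from [x']. *)
Lemma Rintegral_green_start x z x' (phi : path -> R) : measurable_fun setT phi ->
  \int[green x' z]_g (if g.1.1 == x then phi g else 0) =
  if x' == x then \int[green x' z]_g phi g else 0.
Proof.
move=> mphi; pose phi' g := if x' == x then phi g else 0 : R.
transitivity (\int[green x' z]_g phi' g); last first.
  by rewrite /phi'; case: eqP => // _; rewrite Rintegral_cst // mul0r.
congr fine; apply: ae_eq_integral => //.
- apply/measurable_EFinP; apply: measurable_fun_ifT => //; exact: measurable_starts_at.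
- by apply/measurable_EFinP; rewrite /phi'; case: eqP.
exists (starts_off x'); split; first exact: measurable_starts_off.
  exact: green_start.
move=> g; apply: contra_notP => /=; rewrite /starts_off /= => /negP; rewrite negbK => /eqP gx'.
by move=> _; rewrite /phi' gx'.
Qed.

Lemma ge0_integral_nu2 x y (f : path -> \bar R) : measurable_fun setT f ->
  (forall g, 0 <= f g)%E ->
  (\int[nu2 x y]_g f g = ((lambda y)^-1)%:E * \int[green x y]_g f g)%E.
Proof. by move=> mf f0; exact: (ge0_integral_mscale (green x y)). Qed.

Lemma ge0_integral_nu (f : path -> \bar R) : measurable_fun setT f ->
  (forall g, 0 <= f g)%E ->
  (\int[nu G]_g f g = \sum_(p : vertex G * vertex G | (p.1 \notin well) && (p.2 \notin well))
     1%:E * \int[green p.1 p.2]_g f g)%E.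
Proof.
move=> mf f0; rewrite ge0_integral_mfsum //; apply: eq_bigr => p /andP[_ p2].
rewrite (ge0_integral_mscale (nu2 p.1 p.2)) // ge0_integral_nu2 // muleA -EFinM.
by rewrite /= divff // gt_eqF // lambda_gt0.
Qed.

Lemma nu2_fin x y : y \notin well -> (nu2 x y setT < +oo)%E.
Proof.
move=> yw; rewrite -[X in (X < _)%E]/(((lambda y)^-1)%:E * green x y setT)%E.
by rewrite lte_mul_pinfty ?green_fin // lee_fin inv_lambda_ge0.
Qed.

Lemma nu_fin : (nu G setT < +oo)%E.
Proof.
have := @ge0_integral_nu (cst 1%E) (measurable_cst _) (fun _ => lee01).
rewrite integral_cst // mul1e => ->; apply: lte_sum_pinfty => p /andP[_ p2].
by rewrite integral_cst // !mul1e green_fin.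
Qed.

End OccupationMeasures.

Section PathIntegral.
Context {R : realType} {G : wgraph R} {k : kind} {r : nat} {F : bundle G k r}.
Variables (h : connection F) (H : potential F).
Hypothesis H_ge0 : pot_nonneg H.
Local Notation path := (cpath G).
Implicit Types (x y z : vertex G).

Let hol_block_patch y (u : vfib F y) x i :
  (fun g : path => vcoord i (hol_block h H (path_inv g) y x u)) \_ (@contpath R G) =
  fun g : path => if g.1.1 == x then vcoord i (bhol h H u x g.1.2 g.2) else 0.
Proof.
apply/funext => g; rewrite patchE; have rv := @vcoord_rform R k _ i.
case: ifPn => [|gp].
  by rewrite inE => gp; rewrite hol_block_path_inv //; case: eqP; rewrite ?(rform0 rv).
case: eqP => // gx; rewrite bhol_contpath ?(rform0 rv) // -gx.
by move: gp; rewrite notin_setE /contpath /= => /negP.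
Qed.

(** The factor [lambda y] undoes the normalisation of [nu2], and the test on the starting
    point holds almost surely. *)
Lemma vint_nu2 x y (u : vfib F y) : y \notin well ->
  kreal k (lambda y) *: vint (nu2 x y) (@contpath R G)
    (fun g => hol_block h H (path_inv g) y x u) = fk h H y u x.
Proof.
move=> yw; apply: vcoord_inj => i; rewrite vcoordZ of_vcoordK Rintegral_mkcond hol_block_patch.
have rv := @vcoord_rform R k _ i.
have [C uC] := rform_bhol_bounded h H_ge0 u rv.
have mb := measurable_bhol h H_ge0 u rv.
pose phi (g : path) := if g.1.1 == x then vcoord i (bhol h H u x g.1.2 g.2) else 0.
have mphi : measurable_fun setT phi.
  apply: measurable_fun_ifT => //; exact: measurable_starts_at.
have phiC g : `|phi g| <= C.
  rewrite /phi; case: eqP => // _; rewrite normr0.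
  exact: le_trans (normr_ge0 _) (uC 0%E [::]).
rewrite -/phi (Rintegral_comb (I := unit) (P := xpredT) (c := fun _ => (lambda y)^-1)
  (ms := fun _ => green x y) _ _ _ mphi phiC).
- rewrite (big_pred1 tt) => [|[]//]; rewrite mulrA divff ?mul1r ?gt_eqF ?lambda_gt0 //.
  by rewrite Rintegral_green_start // eqxx rform_fk.
- exact: nu2_fin.
- by move=> _ _; exact: green_fin.
- by move=> g mg g0; rewrite (big_pred1 tt) => [|[]//]; exact: ge0_integral_nu2.
Qed.

(** A real coordinate at [x] of [hol (gamma^-1)] applied to [L], for a path [gamma]
    issued from [x]. *)
Definition section_form (L : gsection F) x (i : vidx (vfib F x)) (g : path) : R :=
  \sum_(y | y \notin well) vcoord i (bhol h H (L y) x g.1.2 g.2).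

Let section_form_bounded L x (i : vidx (vfib F x)) : exists C, forall g, `|section_form L i g| <= C.
Proof.
have /choice[C LC] y : exists C, forall tau s, `|vcoord i (bhol h H (L y) x tau s)| <= C.
  exact: (rform_bhol_bounded h H_ge0 _ (vcoord_rform i)).
exists (\sum_(y | y \notin well) C y) => g.
by apply: le_trans (ler_norm_sum _ _ _) _; apply: ler_sum => y _.
Qed.

Let measurable_section_form L x (i : vidx (vfib F x)) : measurable_fun setT (section_form L i).
Proof.
rewrite /section_form; under eq_fun do rewrite -big_filter.
apply: measurable_sum => y; exact: (measurable_bhol h H_ge0 _ (vcoord_rform i)).
Qed.

(** Only the block over the endpoint of the paths survives. *)
Let Rintegral_section_form L x z (i : vidx (vfib F x)) : z \notin well ->
  \int[green x z]_g section_form L i g = vcoord i (fk h H z (L z) x).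
Proof.
move=> zw; have rv := @vcoord_rform R k _ i.
transitivity (\int[green x z]_g (\sum_(y <- [seq y <- index_enum (vertex G) | y \notin well])
    vcoord i (bhol h H (L y) x g.1.2 g.2))).
  by apply: eq_Rintegral => g _; rewrite big_filter.
rewrite Rintegral_sum => [|y]; last exact: (vintegrable_bhol h H_ge0).
rewrite big_filter (bigD1 z) //= big1 => [|y /andP[_ yz]].
  by rewrite addr0 (rform_fk h H_ge0).
by rewrite -(rform_fk h H_ge0) // fk_neq ?(rform0 rv) // eq_sym.
Qed.

(** For [x] in the well both sides vanish: the paths under [nu] start at proper
    vertices. *)
Lemma Rintegral_nu_section_form L x (i : vidx (vfib F x)) :
  \int[nu G]_g (if g.1.1 == x then section_form L i g else 0) =
  vcoord i (green_op h H L x).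
Proof.
have [C LC] := section_form_bounded L i.
have ms := measurable_section_form L i.
pose phi (g : path) := if g.1.1 == x then section_form L i g else 0.
have mphi : measurable_fun setT phi.
  apply: measurable_fun_ifT => //; exact: measurable_starts_at.
have phiC g : `|phi g| <= C.
  rewrite /phi; case: eqP => // _; rewrite normr0.
  exact: le_trans (normr_ge0 _) (LC g).
rewrite -/phi (Rintegral_comb (P := fun p : vertex G * vertex G =>
    (p.1 \notin well) && (p.2 \notin well))
  (c := fun _ => 1) (ms := fun p => green p.1 p.2) _ _ _ mphi phiC); last 3 first.
- exact: nu_fin.
- by move=> p /andP[_]; exact: green_fin.
- exact: ge0_integral_nu.
rewrite -(pair_big (fun x => x \notin well) (fun y => y \notin well)
  (fun x' z => 1 * \int[green x' z]_g phi g)) /=.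
transitivity (\sum_(x' | x' \notin well) \sum_(z | z \notin well)
    if x' == x then vcoord i (fk h H z (L z) x) else 0).
  apply: eq_bigr => x' _; apply: eq_bigr => z zw; rewrite mul1r Rintegral_green_start //.
  by case: eqP => // ->; exact: Rintegral_section_form.
have [xw|xw] := boolP (x \in well).
  rewrite green_op_Omega0 // (rform0 (vcoord_rform i)) big1 // => x' x'w.
  by rewrite big1 // => z _; case: eqP => // x'x; rewrite x'x xw in x'w.
rewrite (bigD1 x) //= [X in _ + X]big1 ?addr0 => [|x' /andP[_ /negPf ->]]; last by rewrite big1.
by rewrite eqxx /green_op (rform_sum _ _ _ (vcoord_rform i)).
Qed.

Lemma hol_End_patch d (T : measurableType d) (w : T -> R) (L : gsection F) x (i : vidx (vfib F x)) :
  (fun z : T * path => vcoord i (kreal k (w z.1) *: hol_End h H (path_inv z.2) L x)) \_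
    [set z : T * path | contpath z.2] =
  fun z : T * path => w z.1 * (if z.2.1.1 == x then section_form L i z.2 else 0).
Proof.
have rv := @vcoord_rform R k _ i.
apply/funext => -[t g] /=; rewrite patchE vcoordZ /= /hol_End (rform_sum _ _ _ rv).
transitivity (w t * \sum_(y | y \notin well)
    ((fun g : path => vcoord i (hol_block h H (path_inv g) y x (L y))) \_ (@contpath R G)) g).
  under [in RHS]eq_bigr do rewrite patchE.
  rewrite (_ : ((t, g) \in _) = (g \in @contpath R G)); last by apply/idP/idP; rewrite !inE.
  by case: ifP => _ //; rewrite big1 // mulr0.
congr (_ * _); under eq_bigr do rewrite hol_block_patch.
by case: eqP => // _; rewrite big1.
Qed.

(** The integrand is a function of the field times a function of the path. *)
Lemma vcoord_int_End d (T : measurableType d) (P : probability T R) (w : T -> R) A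
    (L : gsection F) x (i : vidx (vfib F x)) :
  measurable_fun setT w -> (forall t, `|w t| <= A) ->
  vcoord i (int_End (P \x^ nu G)%E [set z : T * path | contpath z.2]
      (fun (z : T * path) s y => kreal k (w z.1) *: hol_End h H (path_inv z.2) s y) L x) =
  \int[P]_t w t * vcoord i (green_op h H L x).
Proof.
move=> mw wA; rewrite of_vcoordK Rintegral_mkcond hol_End_patch.
have [C LC] := section_form_bounded L i.
pose phi (g : path) := if g.1.1 == x then section_form L i g else 0.
have mphi : measurable_fun setT phi.
  by apply: measurable_fun_ifT => //; exact: measurable_starts_at.
have phiC g : `|phi g| <= C.
  by rewrite /phi; case: eqP => // _; rewrite normr0; exact: le_trans (normr_ge0 _) (LC g).
rewrite -Rintegral_nu_section_form -/phi.
exact: (@Rintegral_prod _ _ _ _ _ P (nu G) w phi A C nu_fin mw mphi wA phiC).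
Qed.

End PathIntegral.

(** * Path integrals and the mean of the tilted field *)

Theorem theorem5p2 (R : realType) (G : wgraph R) (k : kind) (r : nat)
    (F : bundle G k r) (h : connection F) (H : potential F)
    (H_ge0 : pot_nonneg H) (f : gsection F) (f_Omega0 : Omega0 f)
    (d : measure_display) (T : measurableType d) (P : probability T R)
    (Phi : T -> gsection F) (Phi_law : has_law_gff h P Phi) :
  (forall x : vertex G,
     int_End (P \x^ nu G)%E [set z : T * cpath G | contpath z.2]
       (fun z s y => kreal k (pot_weight H (add_section (Phi z.1) f)) *:
                     hol_End h H (path_inv z.2) s y)
       (laplacian h f) x
     = vint P setT (fun t =>
         kreal k (pot_weight H (add_section (Phi t) f)) *:
         add_section (Phi t) f x))
  /\
  (forall x : vertex G, x \notin well ->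
     \sum_(y | y \notin well)
        kreal k (lambda y) *:
        vint (nu2 x y) (@contpath R G)
          (fun g => hol_block h H (path_inv g) y x (laplacian h f y))
     = (kreal k (\int[P]_t pot_weight H (add_section (Phi t) f)))^-1 *:
       vint P setT (fun t =>
         kreal k (pot_weight H (add_section (Phi t) f)) *:
         add_section (Phi t) f x)).
Proof.
case: Phi_law => X [PhiE [Z Z_gt0 XE]].
pose M := green_op h H (laplacian h f).
have M0 : Omega0 M by exact: green_op_Omega0.
have LM x : x \notin well -> lap_pot h H M x = laplacian h f x.
  exact: lap_pot_green_op.
have mean x i : \int[P]_t (pot_weight H (add_section (Phi t) f) *
    vcoord i (add_section (Phi t) f x)) =
    vcoord i (M x) * \int[P]_t pot_weight H (add_section (Phi t) f).
  exact: (tilted_mean H_ge0 PhiE Z_gt0 XE f_Omega0 M0 LM (vcoord_rform i)).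
have rhs x : vint P setT (fun t => kreal k (pot_weight H (add_section (Phi t) f)) *:
    add_section (Phi t) f x) =
    kreal k (\int[P]_t pot_weight H (add_section (Phi t) f)) *: M x.
  apply: vcoord_inj => i; rewrite of_vcoordK vcoordZ mulrC -mean.
  by apply: eq_Rintegral => t _; rewrite vcoordZ.
have mw : measurable_fun setT (fun t => pot_weight H (add_section (Phi t) f)).
  rewrite (_ : (fun _ => _) = (fun c => pot_weight H (add_section (of_sec_coord c) f)) \o X).
    by apply: measurableT_comp => //; exact: measurable_pot_weight.
  by apply/funext => t; rewrite /= PhiE.
split=> [x|x xw]; rewrite rhs.
  have w1 t : `|pot_weight H (add_section (Phi t) f)| <= 1.
    by rewrite ger0_norm ?pot_weight_le1 // ltW // pot_weight_gt0.
  apply: vcoord_inj => i; rewrite vcoordZ.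
  exact: (vcoord_int_End h H_ge0 P (laplacian h f) i mw w1).
rewrite scalerA -krealV -krealM mulVf ?kreal1 ?scale1r; last first.
  by rewrite gt_eqF // (expectation_weight_gt0 H_ge0 P PhiE).
by apply: eq_bigr => y yw; exact: vint_nu2.
Qed.
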